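(* Let $\rho\equiv 1$ on $[0,1]$, let $N\ge 1$, let $(x^1(t),\dots,x^N(t))$, $t\ge 0$, be a gradient flow of $F_{N,2}$, i.e. a solution of $\dot x^i(t)=-\frac{\partial F_{N,2}}{\partial x^i}(x^1(t),\dots,x^N(t))$ for $i=1,\dots,N$, starting from ordered points $0\le x^1(0)\le\dots\le x^N(0)\le 1$, and let $X(t)=X(t,\theta)$ be the ($L^2$-)gradient flow of $\mathcal F$ starting from $X_0$, i.e. the solution of $$\partial_t X=\tfrac14\,\partial_\theta\big((\partial_\theta X)^2\big)\ \text{ on } [0,\infty)\times[0,1],\qquad X(t,0)=0,\quad X(t,1)=1,\quad X(0,\cdot)=X_0 .$$ Define $X^i(t):=X\big(t,\frac{i-1/2}{N}\big)$, $\bar x^i(t):=x^i(N^3t)$ for $i=1,\dots,N$, and $\mu_t^N:=\frac1N\sum_{i=1}^N\delta_{x^i(t)}$. Assume that $X_0\in C^{4,\alpha}([0,1])$ for some $\alpha\in(0,1)$ and that there exist positive constants $c_0,C_0$ such that $$\frac{c_0}{N}\le \bar x^i(0)-\bar x^{i-1}(0)\le\frac{C_0}{N}\quad (i=1,\dots,N+1),\qquad c_0\le\partial_\theta X_0\le C_0 \ \text{ on } [0,1],$$ with the convention $\bar x^0:=-\bar x^1$, $\bar x^{N+1}:=2-\bar x^N$. Then there exist two constants $c',C'>0$, depending only on $c_0$, $C_0$ and $\|X_0\|_{C^{4,\alpha}([0,1])}$ (in particular independent of $N$ and $t$), such that for all $t\ge0$ $$\frac1N\sum_{i=1}^N\big(\bar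 x^i(t)-X^i(t)\big)^2\le e^{-c't}\,\frac1N\sum_{i=1}^N\big(\bar x^i(0)-X^i(0)\big)^2+\frac{C'}{N^4}$$ and $$MK_1(\mu_t^N,d\theta)\le\frac1{4N}+C'e^{-c't/N^3}+\frac{C'}{N^2}.$$ In particular $$MK_1(\mu_t^N,d\theta)\le\frac1{4N}+\frac{2C'}{N^2}\qquad\text{for all } t\ge\frac{2N^3\log N}{c'}.$$
   Context: For a probability density $\rho$ on $[0,1]$ and $0\le x^1\le\dots\le x^N\le1$, $$F_{N,2}(x^1,\dots,x^N):=\int_0^1\min_{1\le i\le N}|x^i-y|^2\,\rho(y)\,dy,$$ with $\frac{\partial F_{N,2}}{\partial x^i}=-2\int_{x^{i-1/2}}^{x^{i+1/2}}(y-x^i)\rho(y)\,dy$, where $x^{i+1/2}:=\frac{x^i+x^{i+1}}2$ for $1\le i\le N-1$, $x^{1/2}:=0$, $x^{N+1/2}:=1$. For $\rho\equiv1$ this gives the system $\dot x^i=\frac14\big((x^{i+1}-x^i)^2-(x^i-x^{i-1})^2\big)$, $i=1,\dots,N$, with the convention $x^0:=-x^1$, $x^{N+1}:=2-x^N$. The continuous functional is $\mathcal F[X]:=\frac1{12}\int_0^1\rho(X(\theta))|\partial_\theta X(\theta)|^3\,d\theta$. For probability measures $\mu,\nu$ on $[0,1]$, $MK_1(\mu,\nu):=\inf_\gamma\int|x-y|\,d\gamma(x,y)$, the infimum being over all probability measures $\gamma$ on $[0,1]\times[0,1]$ with marginals $\mu$ and $\nu$. $d\theta$ denotes Lebesgue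 measure on $[0,1]$. *)

(* Defs.v *)
From HB Require Import structures.
From mathcomp Require Import all_boot all_order all_algebra.
From mathcomp Require Import all_classical all_reals all_analysis.
Set Implicit Arguments.
Unset Strict Implicit.
Unset Printing Implicit Defensive.
Import Order.TTheory GRing.Theory Num.Theory.
Import numFieldNormedType.Exports.
Local Open Scope classical_set_scope.
Local Open Scope ring_scope.

Section Derivatives.
Context {R : realType}.
Implicit Types (A : set R) (f : R -> R).

(* Difference quotients are taken inside A only, so at an end point of an
   interval these are the one-sided derivatives, and the values of f outside A
   are irrelevant. *)
Definition derivable_in A f (a : R) : Prop :=
  cvg ((f y - f a) / (y - a) @[y --> within A a^']).

Definition derive_in A f : R -> R :=
  fun a => lim ((f y - f a) / (y - a) @[y --> within A a^']).

Definition derive_in_n A (n : nat) f : R -> R := iter n (derive_in A) f.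

(* \sum_(j <= k) sup_A |f^(j)| + sup_(a <> b) |f^(k) a - f^(k) b| / |a - b|^alpha *)
Definition holder_norm A (k : nat) (alpha : R) f : \bar R :=
  (\sum_(j < k.+1) ereal_sup [set `|derive_in_n A j f a|%:E | a in A]
   + ereal_sup
       [set (`|derive_in_n A k f p.1 - derive_in_n A k f p.2|
             / `|p.1 - p.2| `^ alpha)%:E
       | p in [set p : R * R | [/\ A p.1, A p.2 & p.1 != p.2]]])%E.

Definition in_holder A (k : nat) (alpha : R) f : Prop :=
  (forall j, (j < k)%N -> forall a, A a -> derivable_in A (derive_in_n A j f) a)
  /\ (holder_norm A k alpha f < +oo)%E.

End Derivatives.

Section Quantization.
Context {R : realType}.
Implicit Types (N : nat) (rho : R -> R).

(* Configurations of N points are sequences of which only the entries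
   1, ..., N are used.  For N >= 1 the integrand is finite: +oo is only the
   neutral element of the minimum. *)
Definition F_N2 N rho (x : nat -> R) : R :=
  fine (\int[lebesgue_measure]_(y in `[0%R, 1%R])
     ((\big[mine/+oo]_(1 <= i < N.+1) (`|x i - y| ^+ 2)%:E) * (rho y)%:E))%E.

Definition set_coord (x : nat -> R) (i : nat) (s : R) : nat -> R :=
  fun j => if j == i then s else x j.

Definition F_N2_gradient_flow N rho (x : R -> nat -> R) : Prop :=
  forall t : R, 0 <= t -> forall i, (1 <= i <= N)%N ->
    let Fi := fun s => F_N2 N rho (set_coord (x t) i s) in
    [/\ derivable Fi (x t i) 1,
        derivable_in `[0, +oo[ (fun s => x s i) t &
        derive_in `[0, +oo[ (fun s => x s i) t = - derive1 Fi (x t i)].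

Definition ghost_extend N (x : nat -> R) : nat -> R :=
  fun i => if i == 0%N then - x 1%N else if i == N.+1 then 2 - x N else x i.

Definition empirical_measure N (x : nat -> R) :
    {measure set (measurableTypeR R) -> \bar R} :=
  mscale (N%:R^-1 : R)%:nng
    (msum (fun i => \d_(x i.+1 : measurableTypeR R)) N).

Definition lebesgue01 : {measure set (measurableTypeR R) -> \bar R} :=
  mrestr (@lebesgue_measure R) (measurable_itv `[0 : R, 1]).

End Quantization.

Section ContinuousFlow.
Context {R : realType}.
Implicit Types X : R -> R -> R.

Definition dt X : R -> R -> R :=
  fun t th => derive_in `[0, +oo[ (X ^~ th) t.

Definition dth X : R -> R -> R :=
  fun t th => derive_in `[0, 1] (X t) th.

(* The L^2-gradient flow of X |-> 1/12 \int_0^1 |dth X|^3, that is, the equation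
   dt X = 1/4 dth ((dth X)^2) with Dirichlet data 0 and 1.
   Classical solutions: X and the derivatives occurring in the equation exist
   and are continuous up to the boundary of [0, +oo[ x [0, 1] (continuity of
   the right-hand side follows from that of dt X). *)
Definition F_gradient_flow (X0 : R -> R) X : Prop :=
  let strip := `[0, +oo[%classic `*` `[0, 1]%classic : set (R * R) in
  [/\ {within strip, continuous (fun p : R * R => X p.1 p.2)},
      {within strip, continuous (fun p : R * R => dt X p.1 p.2)} &
      {within strip, continuous (fun p : R * R => dth X p.1 p.2)}] /\
  (forall t th : R, 0 <= t -> 0 <= th <= 1 ->
    [/\ derivable_in `[0, +oo[ (X ^~ th) t,
        derivable_in `[0, 1] (X t) th,
        derivable_in `[0, 1] (fun y => dth X t y ^+ 2) th &
        dt X t th = 4^-1 * dth (fun s y => dth X s y ^+ 2) t th]) /\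
  (forall t : R, 0 <= t -> X t 0 = 0 /\ X t 1 = 1) /\
  (forall th : R, 0 <= th <= 1 -> X 0 th = X0 th).

End ContinuousFlow.

Section MongeKantorovich.
Context {R : realType}.
Implicit Types mu nu : {measure set (measurableTypeR R) -> \bar R}.

(* Probability measures on [0, 1] are seen as measures on R carried by [0, 1];
   a coupling of two such measures is automatically carried by
   [0, 1] x [0, 1]. *)
Definition couplings mu nu :
    set (probability (measurableTypeR R * measurableTypeR R)%type R) :=
  [set g | forall A : set (measurableTypeR R), measurable A ->
     g (A `*` setT) = mu A /\ g (setT `*` A) = nu A].

Definition MK1 mu nu : \bar R :=
  ereal_inf [set (\int[g]_z `|(z.1 : R) - z.2|%:E)%E | g in couplings mu nu].

End MongeKantorovich.

(* Main.v *)
(* Put h = 1/N, theta_i = (i - 1/2) h and let u = d_theta X, g = d_t X. The point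
   system is the finite volume scheme xbar_i' = N/4 (a_i^2 - a_(i-1)^2) for
   X_t = (u^2)_theta / 4, where a_i = N (xbar_(i+1) - xbar_i). Maximum principles
   keep a_i >= c0, c0 <= u <= C0 and |g| <= C0 |K|, so subtracting the equations,
   summing by parts and using a discrete Poincare inequality gives, for
   E = h sum_i (xbar_i - X(theta_i))^2,
     E' <= - (c0/4) E + C h^4 (1 + \int (d_theta^2 g)^2),
   the last integral coming from the consistency error. Since
   g_t = (u g_theta)_theta / 2, the functional \int u g_theta^2 + const \int g^2
   decays exponentially with dissipation \int ((u g_theta)_theta)^2, which controls
   \int (d_theta^2 g)^2; adding h^4 times this functional to E closes the estimate.
   Solutions are only C^1 in time, so g is replaced by (X(t + s) - X(t)) / s and
   theta-derivatives by differences on a grid of mesh h / (2k); these errors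
   vanish as s -> 0 and then k -> oo, leaving no trace in the constants.
   The same energy estimate with the stationary profile X(theta) = theta gives
   exponential convergence of xbar_i to theta_i, hence the transport bounds. *)

Require Import Defs.
From HB Require Import structures.
From mathcomp Require Import all_boot all_order all_algebra.
From mathcomp Require Import all_classical all_reals all_analysis.
From mathcomp Require Import measurable_realfun.
From mathcomp Require Import ring lra zify.
Set Implicit Arguments.
Unset Strict Implicit.
Unset Printing Implicit Defensive.
Import Order.TTheory GRing.Theory Num.Theory.
Import numFieldNormedType.Exports.
Local Open Scope classical_set_scope.
Local Open Scope ring_scope.

(** * Maximum principle and bounds for the continuous flow *)

(** X is only once differentiable in time, so the equation of g cannot be obtained by
    differentiation. It is replaced by A^2 - B^2 = 2 p w, with p the mean and w the difference of
    the slopes of two solutions: their difference solves exactly a linear equation with coefficient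
    p, without linearization error. For X(t + s) and X(t) this gives an energy which has to be
    divided by s^2. That division forces the consistency error of the fine grid to be at most eta
    s^2, so the grid is chosen after s. At time 0 the same energy is bounded by running the estimate
    on [0, s] between X and its frozen initial profile, with the Lipschitz function g(0) as a
    source. As g is merely continuous in theta, the consistency errors are expressed by differences
    of g at unknown intermediate points, which are then rounded to the grid; the mesh h / (2k) makes
    the centres theta_i and the interfaces i h nodes. On the side of the points, the gradient is
    computed only for strictly ordered points, while the order is itself to be proved; a threshold
    in the maximum principle breaks this circle. *)

Section Derivatives.
Context {R : realType}.
Implicit Types (A : set R) (f : R -> R) (a l : R).

(** The difference quotient is the one of [derivable_in], so that the two notions of derivative can
    be compared at interior points. *)
Lemma is_derive_epsP f a l :
  is_derive a (1 : R) f l <->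
  (forall e, 0 < e -> exists2 d, 0 < d & forall y, `|y - a| < d -> y != a ->
     `|(f y - f a) / (y - a) - l| <= e).
Proof.
have quot (h : R) : h^-1 *: ((f \o shift a) (h *: (1 : R)) - f a)
    = (f (a + h) - f a) / (a + h - a).
  by rewrite /= [h *: _]mulr1 (addrC a h) addrK mulrC.
split=> [dfa e e0|H].
  have [fa fl] := dfa.
  have /cvgrPdist_le /(_ e e0) : h^-1 *: ((f \o shift a) (h *: (1 : R)) - f a)
      @[h --> (0 : R)^'] --> l by rewrite -fl; exact: fa.
  move=> /nbhs_ballP[d /= d0 dP]; exists d => // y yad ya.
  have := dP (y - a); rewrite quot addrCA subrr addr0 distrC; apply.
    by rewrite -ball_normE /= sub0r normrN.
  by rewrite subr_eq0.
have fl : h^-1 *: ((f \o shift a) (h *: (1 : R)) - f a)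
      @[h --> (0 : R)^'] --> l.
  apply/cvgrPdist_le => e /H[d d0 dP]; apply/nbhs_ballP; exists d => //= y.
  rewrite -ball_normE /= sub0r normrN => yd y0.
  rewrite -/(is_true _) quot distrC; apply: dP.
    by rewrite addrAC subrr add0r.
  by rewrite -subr_eq0 addrAC subrr add0r.
split; last by rewrite /derive; apply/cvg_lim.
by apply/cvg_ex; exists l.
Qed.

Lemma is_derive_derive_in A f a : nbhs a A -> derivable_in A f a ->
  is_derive a (1 : R) f (derive_in A f a).
Proof.
move=> aA fa; apply/is_derive_epsP => e e0.
have /cvgrPdist_le /(_ e e0) : (f y - f a) / (y - a) @[y --> within A a^'] -->
  derive_in A f a by exact: fa.
move=> /nbhs_ballP[d d0 dP]; move/nbhs_ballP : aA => [d' /= d'0 d'P].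
exists (Num.min d d'); first by rewrite lt_min d0.
move=> y; rewrite lt_min => /andP[yd yd'] ya; rewrite distrC; apply: dP => //.
  by rewrite -ball_normE /= distrC.
by apply: d'P; rewrite -ball_normE /= distrC.
Qed.

Lemma eq_derive_in A f f' a : A a -> (forall y, A y -> f y = f' y) ->
  derive_in A f a = derive_in A f' a.
Proof.
move=> Aa ff'; rewrite /derive_in; congr (lim _); apply/seteqP; split=> P /=;
  (apply: filterS2; last (by apply: withinT; exact: filter_filter);
   move=> y /= Ay; by rewrite !ff'//).
Qed.

Lemma is_derive_unique f a l l' : is_derive a (1 : R) f l ->
  is_derive a (1 : R) f l' -> l = l'.
Proof. by move=> [_ <-] [_ <-]. Qed.

End Derivatives.

Section MaximumPrinciple.
Context {R : realType}.

Lemma continuous_slice1 (S T U : topologicalType) (f : S -> T -> U) (y : T) :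
  continuous (fun p : S * T => f p.1 p.2) -> continuous (f ^~ y).
Proof.
move=> cf x; apply: (@cvg_comp _ _ _ (fun s => (s, y)) (fun p => f p.1 p.2) _
  (nbhs ((x, y) : S * T))); last exact: (cf (x, y)).
by apply: cvg_pair; [exact: cvg_id|exact: cvg_cst].
Qed.

Lemma continuous_slice2 (S T U : topologicalType) (f : S -> T -> U) (x : S) :
  continuous (fun p : S * T => f p.1 p.2) -> continuous (f x).
Proof.
move=> cf y; apply: (@cvg_comp _ _ _ (fun t => (x, t)) (fun p => f p.1 p.2) _
  (nbhs ((x, y) : S * T))); last exact: (cf (x, y)).
by apply: cvg_pair; [exact: cvg_cst|exact: cvg_id].
Qed.

Lemma continuous_comp2 (S : topologicalType) (f : R -> R -> R) (a b : S -> R) :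
  continuous (fun p : R * R => f p.1 p.2) -> continuous a -> continuous b ->
  continuous (fun p => f (a p) (b p)).
Proof.
move=> cf ca cb p; apply: (@cvg_comp _ _ _ (fun p => (a p, b p)) (fun p => f p.1 p.2) _
  (nbhs ((a p, b p) : R * R))); last exact: (cf (a p, b p)).
by apply: (@cvg_pair _ _ _ _ (nbhs (a p)) (nbhs (b p))); [exact: ca|exact: cb].
Qed.

(* First touching time of Z and the barrier e (1 + t). *)
Lemma maximum_principle (T : topologicalType) (K : set T) (Z : R -> T -> R)
    (t1 delta : R) :
  0 < delta -> compact K ->
  continuous (fun p : R * T => Z p.1 p.2) ->
  (forall w, K w -> Z 0 w <= 0) ->
  (forall t w, 0 < t <= t1 -> K w -> 0 < Z t w <= delta ->
    (forall w', K w' -> Z t w' <= Z t w) ->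
    exists2 d, is_derive t (1 : R) (Z ^~ w) d & d <= 0) ->
  forall t w, 0 <= t <= t1 -> K w -> Z t w <= 0.
Proof.
move=> delta0 cK cZ Z0 dZ.
(* It suffices to stay below every barrier with small e. The condition e (1 + t1) <= delta puts the
   value at the touching point in the range where the hypothesis on derivatives is available. *)
have t1K t w : 0 <= t <= t1 -> K w -> forall e, 0 < e -> e * (1 + t1) <= delta ->
    Z t w <= e * (1 + t).
  move=> tt1 Kw e e0 edelta; rewrite leNgt; apply/negP => Zt.
  pose S := (`[0, t1] `*` K) `&` [set p | e * (1 + p.1) <= Z p.1 p.2].
  have cS : compact S.
    apply: compact_closedI.
      by apply: compact_setX => //; exact: segment_compact.
    rewrite (_ : [set _ | _] = (fun p => Z p.1 p.2 - e * (1 + p.1)) @^-1` [set x | 0 <= x]); last first.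
      by apply/seteqP; split=> p /=; rewrite subr_ge0.
    apply: closed_comp; last exact: closed_ge.
    move=> p _; apply: cvgB; first exact: cZ.
    apply: cvgM; first exact: cvg_cst.
    by apply: cvgD; [exact: cvg_cst|exact: cvg_fst].
  have cfst : {within S, continuous (fun p : R * T => p.1)}.
    by apply: continuous_subspaceT => p; exact: cvg_fst.
  have S0 : S !=set0.
    by exists (t, w); split => /=; [split => //=; rewrite in_itv|exact: ltW].
  have [[t0 w0]] := compact_EVT_min S0 cS cfst.
  rewrite inE => -[[/=]]; rewrite in_itv/= => /andP[t00 t01] Kw0 Zt0 tmin.
  have before s v : 0 <= s < t0 -> K v -> Z s v < e * (1 + s).
    move=> /andP[s0 st0] Kv; rewrite ltNge; apply/negP => Zs.
    have := tmin (s, v); rewrite inE /=.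
    suff HS : S (s, v) by move=> /(_ HS); rewrite leNgt st0.
    by split => //=; split => //=; rewrite in_itv/= s0 (le_trans (ltW st0)).
  have t0gt0 : 0 < t0.
    rewrite lt_neqAle t00 andbT; apply/eqP => t0E.
    have := Z0 _ Kw0; rewrite t0E => /(le_trans Zt0); rewrite -t0E addr0 mulr1.
    by rewrite leNgt e0.
  have at0 v : K v -> Z t0 v <= e * (1 + t0).
    move=> Kv; apply/ler_addgt0Pr => r r0.
    have /cvgrPdist_lt /(_ r r0) : Z s v @[s --> t0] --> Z t0 v
      by exact: continuous_slice1.
    move=> /nbhs_ballP[d /= d0 dP].
    pose s := t0 - Num.min (d / 2) (t0 / 2).
    have m0 : 0 < Num.min (d / 2) (t0 / 2) by rewrite lt_min !divr_gt0.
    have st0 : 0 <= s < t0.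
      rewrite subr_ge0 ltrBlDr ltrDl m0 andbT ge_min; apply/orP; right.
      by rewrite ler_pdivrMr// ler_pMr// ler1n.
    have /dP : ball t0 d s.
      rewrite -ball_normE /= /s opprB addrC subrK gtr0_norm//.
      by rewrite gt_min ltr_pdivrMr// ltr_pMr// ltr1n.
    have := before _ _ st0 Kv; move: (st0) => /andP[_ st0'].
    move=> Zs /ltr_distlDr Zr.
    apply: (le_trans (ltW Zr)); rewrite lerD2r; apply: (le_trans (ltW Zs)).
    by rewrite ler_pM2l// lerD2l ltW.
  have ZE : Z t0 w0 = e * (1 + t0) by apply/le_anti; rewrite at0//= Zt0.
  have [|||d dZd d0] := dZ t0 w0 _ Kw0.
  - by rewrite t0gt0.
  - rewrite ZE mulr_gt0 ?addr_gt0//=; apply: le_trans edelta.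
    by rewrite ler_pM2l// lerD2l.
  - by move=> v Kv; rewrite ZE at0.
  (* Before t0 the function lies below the barrier and at t0 on it, so left quotients are at least
     e, whereas their limit d is nonpositive. Precision e / 2 gives the contradiction. *)
  move/is_derive_epsP : dZd => /(_ _ (divr_gt0 e0 (ltr0Sn _ 1)))[r r0 rP].
  pose m := Num.min (r / 2) (t0 / 2).
  have m0 : 0 < m by rewrite lt_min !divr_gt0.
  have mt0 : m < t0 by rewrite gt_min; apply/orP; right; rewrite ltr_pdivrMr// ltr_pMr// ltr1n.
  have := rP (t0 - m); rewrite addrAC subrr add0r normrN gtr0_norm//.
  have -> : m < r by rewrite gt_min ltr_pdivrMr// ltr_pMr// ltr1n.
  have mE : t0 - m != t0 by rewrite lt_eqF// ltrBlDr ltrDl.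
  move=> /(_ isT mE).
  have : e <= (Z (t0 - m) w0 - Z t0 w0) / - m.
    rewrite invrN mulrN -mulNr opprB ler_pdivlMr// ZE lerBrDr -lerBrDl.
    apply: ltW; apply: (lt_le_trans (before _ _ _ Kw0)).
      by rewrite subr_ge0 (ltW mt0)/= ltrBlDr ltrDl.
    by rewrite -mulrBr -addrA mulrC; lra.
  by move=> H /ler_normlP[_]; move: H d0 e0; lra.
move=> t w tt1 Kw; apply/ler_addgt0Pr => r r0; rewrite add0r.
have t10 : 0 < 1 + t1.
  by move: tt1 => /andP[/le_trans]/[apply] ?; rewrite addrC ltr_wpDl.
pose e := Num.min delta r / (1 + t1).
have e0 : 0 < e by rewrite divr_gt0// lt_min delta0.
have := t1K _ _ tt1 Kw e e0; rewrite mulfVK ?gt_eqF// ge_min lexx.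
move=> /(_ isT) /le_trans; apply; rewrite /e -mulrA.
apply: (@le_trans _ _ (Num.min delta r)); last by rewrite ge_min lexx orbT.
rewrite ler_piMr ?le_min ?(ltW delta0) ?(ltW r0)// ler_pdivrMl// mulr1.
by rewrite lerD2l; case/andP: tt1.
Qed.

End MaximumPrinciple.

Section Flow.
Context {R : realType}.

Lemma cont_gt0_near (f : R -> R) a : {for a, continuous f} -> 0 < f a ->
  exists2 d, 0 < d & forall y, `|y - a| < d -> 0 < f y.
Proof.
move=> /cvgrPdist_lt fa fa0; have /nbhs_ballP[d /= d0 dP] := fa _ fa0.
exists d => // y ya; have := dP y; rewrite -ball_normE /= distrC => /(_ ya).
by move=> /ltr_normlW; rewrite ltrBlDr ltrDl.
Qed.

Lemma is_derive_continuous (f : R -> R) a l : is_derive a (1 : R) f l ->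
  {for a, continuous f}.
Proof. by move=> [/derivable1_diffP/differentiable_continuous]. Qed.

(* A_t = (A_th ^2)_th / 4: comparison of fluxes at a maximum of A - B replaces
   the comparison of second derivatives. *)
Lemma local_max_flux (A B uA uB : R -> R) a d D : 0 < d ->
  (forall y, `|y - a| < d -> is_derive y (1 : R) A (uA y)) ->
  (forall y, `|y - a| < d -> is_derive y (1 : R) B (uB y)) ->
  {for a, continuous uA} -> {for a, continuous uB} -> 0 < uA a \/ 0 < uB a ->
  is_derive a (1 : R) (fun y => uA y ^+ 2 - uB y ^+ 2) D ->
  (forall y, `|y - a| < d -> A y - B y <= A a - B a) -> D <= 0.
Proof.
move=> d0 dA dB cA cB u0 dD maxa.
have dAB y : `|y - a| < d -> is_derive y (1 : R) (fun x => A x - B x) (uA y - uB y).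
  by move=> yd; have ? := dA _ yd; have ? := dB _ yd; exact: is_deriveB.
have aa : `|a - a| < d by rewrite subrr normr0.
have uAB : uA a = uB a.
  apply/eqP; rewrite -subr_eq0 -normr_le0; apply/ler_addgt0Pr => e e0.
  have := dAB _ aa; move/is_derive_epsP => /(_ _ e0)[r r0 rP].
  pose m := Num.min (r / 2) (d / 2).
  have m0 : 0 < m by rewrite lt_min !divr_gt0.
  have mr : m < r by rewrite gt_min ltr_pdivrMr// ltr_pMr// ltr1n.
  have md : m < d by rewrite gt_min orbC ltr_pdivrMr// ltr_pMr// ltr1n.
  rewrite add0r ler_norml andbC; apply/andP; split.
    have := rP (a + m); have := maxa (a + m).
    rewrite addrAC subrr add0r gtr0_norm// => /(_ md) + /(_ mr).
    rewrite -subr_eq0 addrAC subrr add0r gt_eqF// => H /(_ isT) /ler_normlP[+ _].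
    have : (A (a + m) - B (a + m) - (A a - B a)) / m <= 0.
      by rewrite pmulr_lle0 ?invr_gt0// subr_le0.
    by lra.
  have := rP (a - m); have := maxa (a - m).
  rewrite addrAC subrr add0r normrN gtr0_norm// => /(_ md) + /(_ mr).
  rewrite -subr_eq0 addrAC subrr add0r oppr_eq0 gt_eqF// => H /(_ isT) /ler_normlP[_].
  have : 0 <= (A (a - m) - B (a - m) - (A a - B a)) / - m.
    by rewrite invrN mulrN -mulNr mulr_ge0 ?invr_ge0 ?(ltW m0)// oppr_ge0 subr_le0.
  by lra.
(* If D were positive, uA^2 - uB^2, which vanishes at a, would be positive just to the right of a;
   dividing by uA + uB > 0, the difference A - B would increase there. *)
rewrite leNgt; apply/negP => D0.
have cAB : {for a, continuous (fun y => uA y + uB y)}.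
  by apply: cvgD; [exact: cA|exact: cB].
have {u0}uAB0 : 0 < uA a + uB a by case: u0; rewrite uAB => u0; rewrite addr_gt0.
have [r r0 rP] := cont_gt0_near cAB uAB0.
move/is_derive_epsP : dD => /(_ _ (divr_gt0 D0 (ltr0Sn _ 1)))[q q0 qP].
pose m := Num.min (Num.min (r / 2) (d / 2)) (q / 2).
have m0 : 0 < m by rewrite !lt_min !divr_gt0.
have mr : m < r by rewrite !gt_min [r / 2 < r]ltr_pdivrMr// ltr_pMr// ltr1n.
have md : m < d by rewrite !gt_min [d / 2 < d]ltr_pdivrMr// ltr_pMr// ltr1n// orbT.
have mq : m < q by rewrite !gt_min [q / 2 < q]ltr_pdivrMr// ltr_pMr// ltr1n// orbT.
have am : a < a + m by rewrite ltrDl.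
have inm y : a < y < a + m -> `|y - a| < m.
  by move=> /andP[ay yam]; rewrite gtr0_norm ?subr_gt0// ltrBlDl.
have [x||x xam] := @MVT _ (fun x => A x - B x) (fun x => uA x - uB x) _ _ am.
- by rewrite in_itv/= => /inm xm; apply: dAB; exact: lt_trans md.
- apply: derivable_within_continuous => z.
  rewrite in_itv/= => /andP[az zam].
  suff /dAB[] : `|z - a| < d by [].
  by rewrite ger0_norm ?subr_ge0//; apply: (le_lt_trans _ md); rewrite lerBlDl.
have xm : `|x - a| < m by apply: inm; move: xam; rewrite in_itv.
have x0 : 0 < x - a by rewrite subr_gt0; move: xam; rewrite in_itv /= => /andP[].
have := maxa (a + m); rewrite addrAC subrr add0r gtr0_norm// => /(_ md) maxm.
have xa : x != a by rewrite -subr_eq0 gt_eqF.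
have := qP x (lt_trans xm mq) xa.
rewrite uAB subrr subr0 => /ler_normlP[+ _].
set w := _ / (x - a) => wD.
have w0 : 0 < w by move: wD D0; clear; lra.
have : 0 < (uA x - uB x) * (uA x + uB x).
  by move: w0; rewrite pmulr_lgt0 ?invr_gt0// subr_sqr.
rewrite pmulr_lgt0; last by apply: rP; exact: lt_trans mr.
move=> H eqm; move: maxm; rewrite -subr_le0 eqm leNgt mulr_gt0//.
Qed.

(** The functions are total and continuous on the whole plane, which avoids subspace topologies from
    here on. The spatial part of the equation stays in flux form, (u^2)' = 4 g: u itself is seen to
    be differentiable only after it is bounded away from 0. *)
Record classical_flow (X u g : R -> R -> R) : Prop := ClassicalFlow {
  flow_cX : continuous (fun p : R * R => X p.1 p.2) ;
  flow_cu : continuous (fun p : R * R => u p.1 p.2) ;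
  flow_cg : continuous (fun p : R * R => g p.1 p.2) ;
  flow_dt : forall t y : R, 0 < t -> 0 <= y <= 1 ->
    is_derive t (1 : R) (X ^~ y) (g t y) ;
  flow_dy : forall t y : R, 0 <= t -> 0 < y < 1 -> is_derive y (1 : R) (X t) (u t y) ;
  flow_dflux : forall t y : R, 0 <= t -> 0 < y < 1 ->
    is_derive y (1 : R) (fun z => u t z ^+ 2) (4 * g t y) ;
  flow_0 : forall t : R, 0 <= t -> X t 0 = 0 ;
  flow_1 : forall t : R, 0 <= t -> X t 1 = 1 }.

End Flow.

Section FlowBounds.
Context {R : realType}.
Variables (X u g : R -> R -> R).
Hypothesis flowX : classical_flow X u g.

Let near01 (a d : R) : 0 < a < 1 -> 0 < d -> exists2 r, 0 < r &
  forall y, `|y - a| < r -> 0 < y < 1 /\ `|y - a| < d.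
Proof.
move=> /andP[a0 a1] d0; exists (Num.min d (Num.min a (1 - a))).
  by rewrite !lt_min d0 a0 subr_gt0.
move=> y; rewrite !lt_min => /andP[-> /andP[]].
by rewrite !ltr_norml => /andP[h1 _] /andP[_ h2]; split=> //; lra.
Qed.

Lemma flow_cXt y : continuous (X ^~ y).
Proof. by apply: continuous_slice1; exact: flow_cX flowX. Qed.

Lemma flow_cXy t : continuous (X t).
Proof. by apply: continuous_slice2; exact: flow_cX flowX. Qed.

Lemma flow_cuy t : continuous (u t).
Proof. by apply: continuous_slice2; exact: flow_cu flowX. Qed.

Lemma flow_cgy t : continuous (g t).
Proof. by apply: continuous_slice2; exact: flow_cg flowX. Qed.

Lemma flow_cgt y : continuous (g ^~ y).
Proof. by apply: continuous_slice1; exact: flow_cg flowX. Qed.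

Lemma is_derive_scale (c a : R) : is_derive a (1 : R) (fun z => c * z) c.
Proof.
apply/is_derive_epsP => e e0; exists 1 => // y _ ya.
by rewrite -mulrBr mulfK ?subrr ?normr0 ?ltW// subr_eq0.
Qed.

Lemma is_derive_comb (A B : R -> R) (s k t a b : R) :
  is_derive t (1 : R) A a -> is_derive t (1 : R) B b ->
  is_derive t (1 : R) (fun r => s * (A r - B r - k)) (s * (a - b)).
Proof.
move=> dA dB; rewrite -[a - b]subr0.
exact: (@is_deriveZ _ _ _ _ s _ _ _ (is_deriveB (is_deriveB dA dB) (is_derive_cst k t (1 : R)))).
Qed.

(** X is compared with the stationary linear profile c y by [local_max_flux]; c > 0 supplies the
    positive slope required there. The sign s treats maxima and minima together. *)
Lemma flow_local_max (s c t a d : R) : s = 1 \/ s = -1 -> 0 < c -> 0 <= t ->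
  0 < a < 1 -> 0 < d ->
  (forall y, `|y - a| < d -> s * (X t y - c * y) <= s * (X t a - c * a)) ->
  s * g t a <= 0.
Proof.
move=> s1 c0 t0 a01 d0 maxa.
have [r r0 rP] := near01 a01 d0.
have dX y : `|y - a| < r -> is_derive y (1 : R) (X t) (u t y).
  by move=> /rP[y01 _]; exact: (flow_dy flowX).
have dc y : `|y - a| < r -> is_derive y (1 : R) (fun z => c * z) c.
  by move=> _; exact: is_derive_scale.
have cu := @flow_cuy t a.
have cc : {for a, continuous (fun=> c)} by exact: cvg_cst.
have dF := flow_dflux flowX t0 a01.
case: s1 maxa => -> maxa.
  rewrite mul1r; suff : 4 * g t a <= 0 by rewrite pmulr_rle0.
  apply: (local_max_flux r0 dX dc cu cc) => [||y /rP[_ /maxa]].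
  - by right.
  - by rewrite -[X in is_derive _ _ _ X]subr0; exact: is_deriveB dF (is_derive_cst (c ^+ 2) a (1 : R)).
  - by rewrite !mul1r.
rewrite mulN1r oppr_le0; suff : - (4 * g t a) <= 0 by rewrite oppr_le0 pmulr_rge0.
apply: (local_max_flux r0 dc dX cc cu) => [||y /rP[_ /maxa]].
- by left.
- by rewrite -[X in is_derive _ _ _ X]sub0r; exact: is_deriveB (is_derive_cst (c ^+ 2) a (1 : R)) dF.
by rewrite !mulN1r !opprB.
Qed.

Lemma le_at0 (f : R -> R) (M : R) : {for 0, continuous f} ->
  (forall t, 0 < t -> f t <= M) -> f 0 <= M.
Proof.
move=> cf fM; rewrite leNgt -subr_gt0; apply/negP => f0.
have cfM : {for 0, continuous (fun t => f t - M)}.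
  by apply: cvgB; [exact: cf|exact: cvg_cst].
have [d d0 /(_ (d / 2))] := cont_gt0_near cfM f0.
rewrite subr0 gtr0_norm ?divr_gt0// ltr_pdivrMr// ltr_pMr// ltr1n => /(_ isT).
by rewrite subr_gt0 ltNge fM// divr_gt0.
Qed.

Lemma flow_g_bnd t : 0 <= t -> g t 0 = 0 /\ g t 1 = 0.
Proof.
suff gt0 y : y = 0 \/ y = 1 -> forall t, 0 < t -> g t y = 0.
  rewrite le_eqVlt => /predU1P[<-|t0]; last by split; apply: gt0; [left| |right|].
  have g0 y : y = 0 \/ y = 1 -> g 0 y = 0.
    move=> y01; apply/eqP; rewrite eq_le; apply/andP; split.
      by apply: (le_at0 (f := g ^~ y)) => [|s s0]; [exact: flow_cgt|rewrite gt0].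
    rewrite -oppr_le0; apply: (le_at0 (f := fun t => - g t y)) => [|s s0].
      by apply: cvgN; exact: flow_cgt.
    by rewrite gt0// oppr0.
  by split; apply: g0; [left|right].
move=> y01 {}t t0.
have y01' : 0 <= y <= 1 by case: y01 => ->; rewrite ?lexx ?ler01.
have dg := flow_dt flowX t0 y01'.
have : is_derive t (1 : R) (X ^~ y) 0.
  apply: (@near_eq_is_derive _ _ _ (fun=> y)).
    near=> s; have s0 : 0 < s by near: s; exact: lt_nbhsr.
    by case: y01 => ->; [rewrite (flow_0 flowX)// ltW|rewrite (flow_1 flowX)// ltW].
exact: is_derive_unique.
Unshelve. all: by end_near. Qed.

Let triangle : set (R * R) := [set p | 0 <= p.2 /\ p.2 <= p.1 /\ p.1 <= 1].

Let compact_triangle : compact triangle.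
Proof.
have -> : triangle = (`[0, 1] `*` `[0, 1]) `&` [set p | p.2 <= p.1].
  apply/seteqP; split=> p; rewrite /triangle /= !in_itv /=.
    by move=> [h0 [h1 h2]]; split=> //; split; rewrite ?h0 ?h2/= ?(le_trans h0)// (le_trans h1).
  by move=> [[/andP[_ h1] /andP[h2 _]] h3].
apply: compact_closedI.
  by apply: compact_setX => //; exact: segment_compact.
rewrite (_ : [set _ | _] = (fun p => p.1 - p.2) @^-1` [set x | 0 <= x]); last first.
  by apply/seteqP; split=> p /=; rewrite subr_ge0.
apply: closed_comp; last exact: closed_ge.
by move=> p _; apply: cvgB; [exact: cvg_fst|exact: cvg_snd].
Qed.

(** Doubling of variables replaces an equation for u. At a positive maximum over the pairs b <= a
    the two points are distinct, so a and b are separately local extrema of X - c y and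
    [flow_local_max] applies to each; at the ends of the interval g vanishes. *)
Lemma flow_slope (s c : R) : s = 1 \/ s = -1 -> 0 < c ->
  (forall a b, 0 <= b -> b <= a -> a <= 1 -> s * (X 0 a - X 0 b - c * (a - b)) <= 0) ->
  forall t a b, 0 <= t -> 0 <= b -> b <= a -> a <= 1 ->
    s * (X t a - X t b - c * (a - b)) <= 0.
Proof.
move=> s1 c0 H0 t a b t0 b0 ba a1.
pose Z t (p : R * R) := s * (X t p.1 - X t p.2 - c * (p.1 - p.2)).
apply: (@maximum_principle R _ triangle Z t 1 _ compact_triangle _ _ _ t (a, b)) => //.
- move=> [r [x y]]; apply: cvgM; first exact: cvg_cst.
  apply: cvgB; last first.
    apply: cvgM; first exact: cvg_cst.
    apply: cvgB; (apply: cvg_comp; first exact: cvg_snd).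
      exact: cvg_fst.
    exact: cvg_snd.
  have cfst : continuous (fun q : R * (R * R) => q.1) by move=> ?; exact: cvg_fst.
  apply: cvgB; apply: (continuous_comp2 (flow_cX flowX) cfst) => q;
    apply: (@cvg_comp _ _ _ snd _ _ (nbhs q.2)); [exact: cvg_snd|exact: cvg_fst| |];
    exact: cvg_snd.
- by move=> [x y] [y0 [yx x1]]; exact: H0.
- move=> {t0 a b b0 ba a1}r [a b] /andP[r0 _] [/= b0 [ba a1]] /andP[Z0 _] Zmax.
  have {}r0' := ltW r0.
  have a0 : 0 <= a by exact: le_trans ba.
  have b1 : b <= 1 by exact: le_trans a1.
  have {}ba : b < a.
    rewrite lt_neqAle ba andbT; apply/eqP => abE.
    by move: Z0; rewrite /Z /= abE !subrr mulr0 subrr mulr0 ltxx.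
  exists (s * (g r a - g r b)).
    have dXa : is_derive r (1 : R) (X ^~ a) (g r a) by apply: (flow_dt flowX) => //; rewrite a0.
    have dXb : is_derive r (1 : R) (X ^~ b) (g r b) by apply: (flow_dt flowX) => //; rewrite b0.
    exact: is_derive_comb.
  have ab0 : 0 < a - b by rewrite subr_gt0.
  have ga : s * g r a <= 0.
    have [->|an1] := eqVneq a 1; first by rewrite (flow_g_bnd r0').2 mulr0.
    have a01 : 0 < a < 1 by rewrite (le_lt_trans b0)//= lt_neqAle an1.
    have d0 : 0 < Num.min (a - b) (1 - a) by rewrite lt_min ab0 subr_gt0; case/andP: a01.
    apply: (flow_local_max s1 c0 r0' a01 d0) => y.
    rewrite lt_min !ltr_norml => /andP[/andP[h1 _] /andP[_ h2]].
    have := Zmax (y, b); rewrite /Z /triangle /=.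
    have H : 0 <= b /\ b <= y /\ y <= 1 by split => //; lra.
    by move=> /(_ H); lra.
  have gb : - s * g r b <= 0.
    have [->|bn0] := eqVneq b 0; first by rewrite (flow_g_bnd r0').1 mulr0.
    have b01 : 0 < b < 1 by rewrite (lt_le_trans ba)// lt_neqAle eq_sym bn0 b0.
    have d0 : 0 < Num.min (a - b) b by rewrite lt_min ab0; case/andP: b01.
    have s1' : - s = 1 \/ - s = -1 by case: s1 => ->; [right|left; rewrite opprK].
    apply: (flow_local_max s1' c0 r0' b01 d0) => y.
    rewrite lt_min !ltr_norml => /andP[/andP[_ h1] /andP[h2 _]].
    have := Zmax (a, y); rewrite /Z /triangle /=.
    have H : 0 <= y /\ y <= a /\ a <= 1 by split => //; lra.
    by move=> /(_ H); lra.
  by lra.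
- by rewrite t0/=.
Qed.

End FlowBounds.

(** * Comparison of solutions: bounds on slopes, distances and speed *)

Section Comparison.
Context {R : realType}.

(** The barrier m + k t compensates a source: f is the flux divergence of the difference and D, its
    time derivative, may exceed f by k. A frozen profile is handled with k > 0, two solutions with k
    = 0. *)
Lemma flow_compare (A B uA uB D f : R -> R -> R) (k m : R) :
  0 <= k -> 0 <= m ->
  continuous (fun p : R * R => A p.1 p.2) ->
  continuous (fun p : R * R => B p.1 p.2) ->
  (forall t : R, 0 < t -> continuous (uA t)) ->
  (forall t : R, 0 < t -> continuous (uB t)) ->
  (forall t y : R, 0 < t -> 0 < y < 1 ->
     [/\ is_derive y (1 : R) (A t) (uA t y), is_derive y (1 : R) (B t) (uB t y),
         is_derive y (1 : R) (fun z => uA t z ^+ 2 - uB t z ^+ 2) (4 * f t y),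
         0 < uA t y \/ 0 < uB t y &
         is_derive t (1 : R) (fun s => A s y - B s y) (D t y) /\ D t y <= f t y + k]) ->
  (forall t : R, 0 < t -> A t 0 = B t 0 /\ A t 1 = B t 1) ->
  (forall y : R, 0 <= y <= 1 -> A 0 y - B 0 y <= m) ->
  forall t y : R, 0 <= t -> 0 <= y <= 1 -> A t y - B t y <= m + k * t.
Proof.
move=> k0 m0 cA cB cuA cuB H bnd init t y t0 y01.
pose Z t y := A t y - B t y - (m + k * t).
rewrite -subr_le0 -/(Z t y).
apply: (@maximum_principle R R `[0, 1]%classic Z t 1 _ _ _ _ _ t y) => //.
- exact: segment_compact.
- move=> p; apply: cvgB; first by apply: cvgB; [exact: cA|exact: cB].
  apply: cvgD; first exact: cvg_cst.
  by apply: cvgM; [exact: cvg_cst|exact: cvg_fst].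
- move=> z /=; rewrite in_itv/= => /init; rewrite /Z mulr0 addr0; lra.
- move=> r a /andP[r0 _] /=; rewrite in_itv/= => /andP[a0 a1] /andP[Z0 _] Zmax.
  have [c0 c1] := bnd _ r0.
  have kr : 0 <= k * r by rewrite mulr_ge0// ltW.
  have a01 : 0 < a < 1.
    rewrite !lt_neqAle a0 a1 !andbT; apply/andP; split; apply/eqP => aE.
      by move: Z0; rewrite /Z -aE c0; lra.
    by move: Z0; rewrite /Z aE c1; lra.
  have [dA dB df u0 [dD Dle]] := H _ _ r0 a01.
  have a10 : 0 < Num.min a (1 - a) by rewrite lt_min subr_gt0.
  have near01 z : `|z - a| < Num.min a (1 - a) -> 0 < z < 1.
    by rewrite lt_min !ltr_norml => /andP[/andP[h1 _] /andP[_ h2]]; lra.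
  exists (D r a - k).
    have dk : is_derive r (1 : R) (fun s => m + k * s) k.
      rewrite -[X in is_derive _ _ _ X]add0r.
      exact: is_deriveD (is_derive_cst m r (1 : R)) (is_derive_scale k r).
    exact: is_deriveB dD dk.
  suff : 4 * f r a <= 0 by lra.
  apply: (local_max_flux (A := A r) (B := B r) a10 _ _ (cuA _ r0 a) (cuB _ r0 a) u0 df).
  - by move=> z /near01 /(H _ _ r0)[h _ _ _ _]; exact: h.
  - by move=> z /near01 /(H _ _ r0)[_ h _ _ _]; exact: h.
  move=> z /near01/andP[z0 z1].
  have z01 : 0 <= z <= 1 by rewrite !ltW.
  have := Zmax z; rewrite /= in_itv/= z01 => /(_ isT).
  by rewrite /Z; lra.
- by rewrite t0 lexx.
Qed.

Variables (X u g : R -> R -> R) (c C G : R).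
Hypotheses (flowX : classical_flow X u g) (c0 : 0 < c) (C0 : 0 < C) (G0 : 0 <= G).
Hypothesis slope0 : forall y : R, 0 < y < 1 -> c <= u 0 y <= C.
Hypothesis g0 : forall y : R, 0 < y < 1 -> `|g 0 y| <= G.

Let slope_init (s k : R) : s = 1 \/ s = -1 -> (forall y : R, 0 < y < 1 -> s * u 0 y <= s * k) ->
  forall a b : R, 0 <= b -> b <= a -> a <= 1 -> s * (X 0 a - X 0 b - k * (a - b)) <= 0.
Proof.
move=> s1 H a b b0 ba a1.
move: ba; rewrite le_eqVlt => /predU1P[->|ba].
  by rewrite !subrr !mulr0 subrr mulr0.
have [] := @MVT R (X 0) (u 0) b a ba.
- move=> z; rewrite in_itv/= => /andP[bz za]; apply: (flow_dy flowX) => //.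
  by rewrite (le_lt_trans b0)//= (lt_le_trans za).
- by apply: continuous_subspaceT; exact: (flow_cXy flowX).
move=> z; rewrite in_itv/= => /andP[bz za] ->; rewrite -mulrBl mulrA.
rewrite pmulr_lle0 ?subr_gt0// mulrBr subr_le0; apply: H.
by rewrite (le_lt_trans b0)//= (lt_le_trans za).
Qed.

Lemma flow_slope_bounds (t a b : R) : 0 <= t -> 0 <= b -> b <= a -> a <= 1 ->
  c * (a - b) <= X t a - X t b <= C * (a - b).
Proof.
move=> t0 b0 ba a1.
have m1 : (-1 : R) = 1 \/ (-1 : R) = -1 by right.
have p1 : (1 : R) = 1 \/ (1 : R) = -1 by left.
have h1 y : 0 < y < 1 -> -1 * u 0 y <= -1 * c.
  by move=> /slope0/andP[? _]; rewrite !mulN1r lerN2.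
have h2 y : 0 < y < 1 -> 1 * u 0 y <= 1 * C.
  by move=> /slope0/andP[_ ?]; rewrite !mul1r.
have := flow_slope flowX m1 c0 (slope_init m1 h1) t0 b0 ba a1.
have := flow_slope flowX p1 C0 (slope_init p1 h2) t0 b0 ba a1.
by rewrite mul1r !mulN1r; lra.
Qed.

Lemma le_quot_derive (f : R -> R) a l k r : is_derive a (1 : R) f l -> 0 < r ->
  (forall y, a < y < a + r -> (f y - f a) / (y - a) <= k) -> l <= k.
Proof.
move=> /is_derive_epsP fl r0 H; apply/ler_addgt0Pr => e /fl[d d0 dP].
pose m := Num.min (r / 2) (d / 2).
have m0 : 0 < m by rewrite lt_min !divr_gt0.
have mr : m < r by rewrite gt_min ltr_pdivrMr// ltr_pMr// ltr1n.
have md : m < d by rewrite gt_min orbC ltr_pdivrMr// ltr_pMr// ltr1n.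
have := H (a + m); rewrite ltrDl m0 ltrD2l mr => /(_ isT).
have := dP (a + m); rewrite -(subr_eq0 (a + m)) addrAC subrr add0r gtr0_norm// md gt_eqF//.
by move=> /(_ isT isT) /ler_normlP[+ _]; lra.
Qed.

Lemma continuous_itv_le (f : R -> R) (k : R) : continuous f ->
  (forall y : R, 0 < y < 1 -> f y <= k) -> forall y, 0 <= y <= 1 -> f y <= k.
Proof.
move=> cf fk y y01; rewrite leNgt -subr_gt0; apply/negP => fy.
have cfk : {for y, continuous (fun x => f x - k)}.
  by apply: cvgB; [exact: cf|exact: cvg_cst].
have [d d0 dP] := cont_gt0_near cfk fy.
suff [z z01 /dP] : exists2 z, 0 < z < 1 & `|z - y| < d.
  by rewrite subr_gt0 ltNge fk.
(* The bound 1 / 4 keeps the perturbed point strictly inside the interval: it moves right from the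
   left half and left from the right half. *)
pose m := Num.min (d / 2) (1 / 4).
have m0 : 0 < m by rewrite lt_min !divr_gt0.
have md : m < d by rewrite gt_min ltr_pdivrMr// ltr_pMr// ltr1n.
have m4 : m <= 1 / 4 by rewrite ge_min lexx orbT.
have [y2|y2] := leP y (1 / 2).
  exists (y + m); first by move: y01; lra.
  by rewrite addrAC subrr add0r gtr0_norm.
exists (y - m); first by move: y01; lra.
by rewrite addrAC subrr add0r normrN gtr0_norm.
Qed.

Lemma flow_u_bounds (t y : R) : 0 <= t -> 0 <= y <= 1 -> c <= u t y <= C.
Proof.
move=> t0; have cu : continuous (u t) by exact: (flow_cuy flowX).
have H (z : R) : 0 < z < 1 -> c <= u t z <= C.
  move=> z01; have dX := flow_dy flowX t0 z01.
  have z10 : 0 < 1 - z by rewrite subr_gt0; case/andP: z01.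
  have sl w : z < w < z + (1 - z) -> c * (w - z) <= X t w - X t z <= C * (w - z).
    by move=> zw; apply: flow_slope_bounds => //; move: z01 zw; lra.
  apply/andP; split.
    rewrite -lerN2; apply: (le_quot_derive (is_deriveN dX) z10) => w zw.
    rewrite ler_pdivrMr ?subr_gt0 ?(andP zw).1//.
    by have := sl _ zw; rewrite !fctE; lra.
  apply: (le_quot_derive dX z10) => w zw.
  rewrite ler_pdivrMr ?subr_gt0 ?(andP zw).1//.
  by have := sl _ zw; lra.
move=> y01; apply/andP; split.
  rewrite -lerN2; apply: (continuous_itv_le (f := fun y => - u t y)) => //.
    by move=> z; apply: cvgN; exact: cu.
  by move=> z /H/andP[+ _]; rewrite lerN2.
by apply: continuous_itv_le y01 => // z /H/andP[].
Qed.

Lemma flow_dist0 (t y : R) : 0 <= t -> 0 <= y <= 1 -> `|X t y - X 0 y| <= G * t.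
Proof.
move=> t0 y01.
have cX0 : continuous (fun p : R * R => X 0 p.2).
  move=> p; apply: (@cvg_comp _ _ _ snd (X 0) _ (nbhs p.2)); first exact: cvg_snd.
  exact: (flow_cXy flowX).
have dg0 (z : R) : 0 < z < 1 -> - G <= g 0 z <= G by move=> /g0; rewrite ler_norml.
have u0 (r z : R) : 0 <= r -> 0 < z < 1 -> 0 < u r z.
  move=> r0 /andP[z0 z1].
  have /(flow_u_bounds r0)/andP[cu _] : 0 <= z <= 1 by rewrite !ltW.
  exact: lt_le_trans cu.
have dX (r z : R) : 0 < r -> 0 < z < 1 -> is_derive r (1 : R) (X ^~ z) (g r z).
  by move=> r0 /andP[z0 z1]; apply: (flow_dt flowX) => //; rewrite !ltW.
have := @flow_compare X (fun=> X 0) u (fun=> u 0) g (fun t y => g t y - g 0 y) G 0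
  G0 (lexx _) (flow_cX flowX) cX0.
have := @flow_compare (fun=> X 0) X (fun=> u 0) u (fun t y => - g t y)
  (fun t y => g 0 y - g t y) G 0 G0 (lexx _) cX0 (flow_cX flowX).
move=> H1 H2; rewrite ler_norml.
have F1 : forall z : R, 0 <= z <= 1 -> X 0 z - X 0 z <= 0 by move=> z _; rewrite subrr.
apply/andP; split.
  rewrite lerNl opprB -(add0r (G * t)); apply: H1 => //.
  - by move=> r _; exact: (flow_cuy flowX).
  - by move=> r _; exact: (flow_cuy flowX).
  - move=> r z r0 z01; have r0' := ltW r0; split.
    + exact: (flow_dy flowX).
    + exact: (flow_dy flowX).
    + by rewrite mulrBr; exact: is_deriveB (flow_dflux flowX (lexx _) z01) (flow_dflux flowX r0' z01).
    + by left; exact: u0.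
    split; last by have := dg0 _ z01; lra.
    by rewrite -sub0r; exact: is_deriveB (is_derive_cst (X 0 z) r (1 : R)) (dX _ _ r0 z01).
  - by move=> r r0; rewrite !(flow_0 flowX) ?(flow_1 flowX)// ltW.
rewrite -(add0r (G * t)); apply: H2 => //.
- by move=> r _; exact: (flow_cuy flowX).
- by move=> r _; exact: (flow_cuy flowX).
- move=> r z r0 z01; have r0' := ltW r0; split.
  + exact: (flow_dy flowX).
  + exact: (flow_dy flowX).
  + by rewrite mulrBr; exact: is_deriveB (flow_dflux flowX r0' z01) (flow_dflux flowX (lexx _) z01).
  + by left; exact: u0.
  split; last by have := dg0 _ z01; lra.
  by rewrite -[g r z]subr0; exact: is_deriveB (dX _ _ r0 z01) (is_derive_cst (X 0 z) r (1 : R)).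
- by move=> r r0; rewrite !(flow_0 flowX) ?(flow_1 flowX)// ltW.
Qed.

End Comparison.

Section Bounds.
Context {R : realType}.
Variables (X u g : R -> R -> R) (c C G : R).
Hypotheses (flowX : classical_flow X u g) (c0 : 0 < c) (C0 : 0 < C) (G0 : 0 <= G).
Hypothesis slope0 : forall y : R, 0 < y < 1 -> c <= u 0 y <= C.
Hypothesis g0 : forall y : R, 0 < y < 1 -> `|g 0 y| <= G.

Lemma is_derive_shift (f : R -> R) (t s l : R) : is_derive (t + s) (1 : R) f l ->
  is_derive t (1 : R) (fun r => f (r + s)) l.
Proof.
move/is_derive_epsP => fl; apply/is_derive_epsP => e /fl[d d0 dP].
exists d => // y yt ynt; have := dP (y + s); rewrite opprD addrACA subrr addr0.
by apply => //; rewrite (inj_eq (addIr s)).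
Qed.

(** Time translates of a solution are solutions, so comparison without source propagates the initial
    distance G s. This is the maximum principle for g in integrated form; [flow_g_bound] follows as
    s tends to 0. *)
Lemma flow_dist (t s y : R) : 0 <= t -> 0 <= s -> 0 <= y <= 1 ->
  `|X (t + s) y - X t y| <= G * s.
Proof.
move=> t0 s0 y01.
have Gs0 : 0 <= G * s by rewrite mulr_ge0.
have cXs : continuous (fun p : R * R => X (p.1 + s) p.2).
  apply: (continuous_comp2 (flow_cX flowX)) => p; last exact: cvg_snd.
  by apply: cvgD; [exact: cvg_fst|exact: cvg_cst].
have dX (r z : R) : 0 < r -> 0 < z < 1 -> is_derive r (1 : R) (X ^~ z) (g r z).
  by move=> r0 /andP[z0 z1]; apply: (flow_dt flowX) => //; rewrite !ltW.
have rs0 r : 0 < r -> 0 < r + s by move=> r0; rewrite ltr_wpDr.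
have dXs (r z : R) : 0 < r -> 0 < z < 1 ->
    is_derive r (1 : R) (fun q => X (q + s) z) (g (r + s) z).
  move=> /rs0 r0 z01; apply: (@is_derive_shift (X ^~ z)); exact: dX.
have u0 (r z : R) : 0 <= r -> 0 < z < 1 -> 0 < u r z.
  move=> r0 /andP[z0 z1].
  have /(flow_u_bounds flowX c0 C0 slope0 r0)/andP[cu _] : 0 <= z <= 1 by rewrite !ltW.
  exact: lt_le_trans cu.
have init (z : R) : 0 <= z <= 1 -> `|X s z - X 0 z| <= G * s.
  by move=> z01; exact: (flow_dist0 flowX c0 C0 G0 slope0 g0).
rewrite ler_norml; apply/andP; split.
  rewrite lerNl opprB -(addr0 (G * s)) -[X in _ <= _ + X](mul0r t).
  apply: (@flow_compare R X (fun t => X (t + s)) u (fun t => u (t + s))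
    (fun t y => g t y - g (t + s) y) (fun t y => g t y - g (t + s) y)) => //.
  - exact: flow_cX flowX.
  - by move=> r _; exact: (flow_cuy flowX).
  - by move=> r _; exact: (flow_cuy flowX).
  - move=> r z r0 z01; have r0' := ltW r0; have rs0' := ltW (rs0 _ r0); split.
    + exact: (flow_dy flowX).
    + exact: (flow_dy flowX).
    + by rewrite mulrBr; exact: is_deriveB (flow_dflux flowX r0' z01) (flow_dflux flowX rs0' z01).
    + by left; exact: u0.
    by split; [exact: is_deriveB (dX _ _ r0 z01) (dXs _ _ r0 z01)|rewrite addr0].
  - by move=> r r0; rewrite !(flow_0 flowX) ?(flow_1 flowX)// ltW// rs0.
  - by move=> z /init; rewrite add0r distrC => /ler_normlW.
rewrite -(addr0 (G * s)) -[X in _ <= _ + X](mul0r t).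
apply: (@flow_compare R (fun t => X (t + s)) X (fun t => u (t + s)) u
    (fun t y => g (t + s) y - g t y) (fun t y => g (t + s) y - g t y)) => //.
- exact: flow_cX flowX.
- by move=> r _; exact: (flow_cuy flowX).
- by move=> r _; exact: (flow_cuy flowX).
- move=> r z r0 z01; have r0' := ltW r0; have rs0' := ltW (rs0 _ r0); split.
  + exact: (flow_dy flowX).
  + exact: (flow_dy flowX).
  + by rewrite mulrBr; exact: is_deriveB (flow_dflux flowX rs0' z01) (flow_dflux flowX r0' z01).
  + by left; exact: u0.
  by split; [exact: is_deriveB (dXs _ _ r0 z01) (dX _ _ r0 z01)|rewrite addr0].
- by move=> r r0; rewrite !(flow_0 flowX) ?(flow_1 flowX)// ltW// rs0.
- by move=> z /init; rewrite add0r => /ler_normlW.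
Qed.

Lemma flow_g_bound (t y : R) : 0 <= t -> 0 <= y <= 1 -> `|g t y| <= G.
Proof.
move=> t0 y01.
suff H (r : R) : 0 < r -> `|g r y| <= G.
  move: t0; rewrite le_eqVlt => /predU1P[<-|/H//].
  apply: (le_at0 (f := fun r => `|g r y|)) => //.
  by apply: cvg_norm; exact: (flow_cgt flowX).
move=> r0; have dX := flow_dt flowX r0 y01.
have q (w : R) : r < w < r + 1 -> `|(X w y - X r y) / (w - r)| <= G.
  move=> /andP[rw _]; have wr : 0 < w - r by rewrite subr_gt0.
  rewrite normrM normfV (gtr0_norm wr) ler_pdivrMr//.
  have := @flow_dist r (w - r) y; rewrite (addrC r) subrK; apply => //; exact: ltW.
rewrite ler_norml lerNl; apply/andP; split.
  apply: (le_quot_derive (is_deriveN dX) (ltr01 : 0 < (1 : R))) => w /q.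
  rewrite !fctE ler_norml => /andP[+ _].
  by rewrite -opprD mulNr lerNl.
by apply: (le_quot_derive dX (ltr01 : 0 < (1 : R))) => w /q/ler_normlW.
Qed.

Lemma is_derive_root (f : R -> R) (a l : R) : continuous f -> 0 < f a ->
  is_derive a (1 : R) (fun x => f x ^+ 2) l -> is_derive a (1 : R) f (l / (2 * f a)).
Proof.
move=> cf fa df.
have fa2 : 0 < f a ^+ 2 by rewrite exprn_gt0.
have H := @is_derive1_comp _ Num.sqrt (fun x => f x ^+ 2) a _ _ (is_derive1_sqrt fa2) df.
have [d d0 dP] := cont_gt0_near (cf a) fa.
have E : is_derive a (1 : R) (Num.sqrt \o (fun x => f x ^+ 2)) (l / (2 * f a)).
  suff <- : (2 * Num.sqrt (f a ^+ 2))^-1 * l = l / (2 * f a) by [].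
  by rewrite sqrtr_sqr gtr0_norm// mulrC.
apply: near_eq_is_derive E.
apply/nbhs_ballP; exists d => //= y; rewrite -ball_normE /= distrC => /dP fy.
by rewrite sqrtr_sqr gtr0_norm.
Qed.

(** As u is positive, it is the square root of its differentiable square. Hence X is twice
    differentiable in space. *)
Lemma flow_du (t y : R) : 0 <= t -> 0 < y < 1 ->
  is_derive y (1 : R) (u t) (2 * g t y / u t y).
Proof.
move=> t0 y01.
have y01' : 0 <= y <= 1 by case/andP: y01 => *; rewrite !ltW.
have /andP[u0 _] := flow_u_bounds flowX c0 C0 slope0 t0 y01'.
have {}u0 := lt_le_trans c0 u0.
have -> : 2 * g t y / u t y = 4 * g t y / (2 * u t y).
  by field; rewrite gt_eqF.
by apply: is_derive_root => //; [exact: (flow_cuy flowX)|exact: (flow_dflux flowX)].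
Qed.

End Bounds.

(** * Discrete energy inequalities *)

Section Sums.
Context {R : realType}.
Implicit Types (a F x v : nat -> R).

(** As 0.-1 = 0, the term j = 0 of the last sum vanishes; the same convention governs the fine grid
    backward differences below. *)
Lemma sum_by_parts (M : nat) a F : (0 < M)%N ->
  \sum_(0 <= j < M) F j * (a j.+1 - a j) =
  a M * F M.-1 - a 0%N * F 0%N - \sum_(0 <= j < M) a j * (F j - F j.-1).
Proof.
case: M => // M _; elim: M => [|M IH].
  by rewrite !big_nat1 /=; ring.
by rewrite big_nat_recr//= IH [in RHS]big_nat_recr//=; ring.
Qed.

Lemma sum_by_parts0 (M : nat) a F : (0 < M)%N -> a 0%N = 0 -> a M = 0 ->
  \sum_(0 <= j < M) F j * (a j.+1 - a j) = - \sum_(0 <= j < M) a j * (F j - F j.-1).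
Proof. by move=> M0 a0 aM; rewrite sum_by_parts// a0 aM !mul0r subr0 sub0r. Qed.

Lemma weighted_cauchy_schwarz (m n : nat) v x : (forall j, 0 <= v j) ->
  (\sum_(m <= j < n) v j * x j) ^+ 2 <=
  (\sum_(m <= j < n) v j) * \sum_(m <= j < n) v j * x j ^+ 2.
Proof.
move=> v0; have [nm|mn] := leqP n m; first by rewrite !big_geq// mulr0 expr0n.
have {mn}[k ->] : exists k, n = (m + k)%N by exists (n - m)%N; rewrite subnKC// ltnW.
elim: k => [|k IH]; first by rewrite addn0 !big_geq// mulr0 expr0n.
rewrite addnS !big_nat_recr ?leq_addr//=.
move: IH; set A := \sum_(m <= j < m + k) v j; set S := \sum_(m <= j < m + k) v j * x j.
set Q := \sum_(m <= j < m + k) v j * x j ^+ 2 => IH.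
have A0 : 0 <= A by apply: sumr_ge0.
have Q0 : 0 <= Q by apply: sumr_ge0 => i _; rewrite mulr_ge0// sqr_ge0.
have V0 := v0 (m + k)%N.
move: (v (m + k)%N) (x (m + k)%N) V0 => V y V0.
suff : 0 <= V * (A * y ^+ 2 + Q - 2 * S * y).
  move: IH; clear; rewrite !expr2 => H H'.
  have -> : (A + V) * (Q + V * (y * y)) = A * Q + V * V * y * y + V * (A * (y * y) + Q) by ring.
  have -> : (S + V * y) * (S + V * y) = S * S + V * V * y * y + V * (2 * S * y) by ring.
  by move: H'; rewrite mulrBr; lra.
rewrite mulr_ge0//.
(* If the total weight A vanishes, the induction hypothesis forces S = 0; otherwise multiply by A
   and complete the square. *)
move: A0; rewrite le_eqVlt => /predU1P[AE|A0].
  have /eqP : S ^+ 2 = 0.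
    by apply/le_anti; rewrite sqr_ge0 andbT (le_trans IH)// -AE mul0r.
  by rewrite expf_eq0/= => /eqP ->; rewrite -AE !(mul0r, mulr0) subr0 add0r.
rewrite -(pmulr_rge0 _ A0).
have -> : A * (A * y ^+ 2 + Q - 2 * S * y) = (A * y - S) ^+ 2 + (A * Q - S ^+ 2) by ring.
by rewrite addr_ge0 ?sqr_ge0 ?subr_ge0.
Qed.

Lemma sum_sqr_le (m n : nat) x :
  (\sum_(m <= j < n) x j) ^+ 2 <= (n - m)%:R * \sum_(m <= j < n) x j ^+ 2.
Proof.
have := @weighted_cauchy_schwarz m n (fun=> 1) x (fun=> ler01).
under eq_bigr do rewrite mul1r.
under [X in _ * X]eq_bigr do rewrite mul1r.
by rewrite big_const_nat iter_addr addr0.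
Qed.

(** The entry x 0 may occur twice on the left because 0.-1 = 0, hence the factor 2. *)
Lemma sum_pred_le (M : nat) x : (forall j, 0 <= x j) ->
  \sum_(0 <= j < M) x j.-1 <= 2 * \sum_(0 <= j < M) x j.
Proof.
move=> x0; case: M => [|M]; first by rewrite !big_geq// mulr0.
rewrite big_nat_recl//= mulrDl mul1r lerD//.
  rewrite big_nat_recl//= lerDl; apply: sumr_ge0 => *; exact: x0.
by rewrite [leRHS]big_nat_recr//= lerDl x0.
Qed.

Lemma sum_cells (c : nat -> nat) (n : nat) x : (forall i, c i <= c i.+1)%N ->
  \sum_(0 <= i < n) \sum_(c i <= j < c i.+1) x j = \sum_(c 0%N <= j < c n) x j.
Proof.
move=> cS; elim: n => [|n IH]; first by rewrite !big_geq.
have c0n : (c 0 <= c n)%N by elim: n {IH} => // n /leq_trans; apply.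
by rewrite big_nat_recr//= IH -big_cat_nat.
Qed.

End Sums.

(** * Energy inequalities for the difference of two solutions on the fine grid *)

Section FineEnergy.
Context {R : realType}.
Variables (M : nat) (c G B eps : R) (p om pt wt w kap f : nat -> R).
Hypotheses (M0 : (0 < M)%N) (c0 : 0 < c) (G0 : 0 <= G) (B0 : 0 <= B).
Local Notation m := (M%:R : R).
(** Dictionary: p and om are the mean and the difference of the slopes of two profiles, w and wt
    their nodal difference and its time derivative, pt the time derivative of their nodal mean, kap
    a consistency error, f a source. Y is the discrete (p om)' / 2, and Y 0 = 0 since 0.-1 = 0. *)
Let Y j := m / 2 * (p j * om j - p j.-1 * om j.-1).
Let Z j := m * (om j - om j.-1).
Hypothesis pc : forall j, (j < M)%N -> c <= p j.
Hypothesis pB : forall j, (j < M)%N -> `|m * (p j - p j.-1)| <= B.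

(** Discrete product rule: as p >= c, the flux difference Y controls the second difference Z up to
    the variation of p. *)
Let ZE j : (j < M)%N -> `|Z j| <= (4 * `|Y j| + B * `|om j + om j.-1|) / (2 * c).
Proof.
move=> jM; have j1 : (j.-1 < M)%N by apply: leq_ltn_trans jM; exact: leq_pred.
have p1 := pc jM; have p2 := pc j1.
rewrite ler_pdivlMr ?mulr_gt0//.
apply: (@le_trans _ _ `|(p j + p j.-1) * Z j|).
  rewrite [leRHS]normrM [leLHS]mulrC ler_wpM2r// ger0_norm ?addr_ge0 ?(le_trans (ltW c0))//; lra.
have -> : (p j + p j.-1) * Z j = 4 * Y j - m * (p j - p j.-1) * (om j + om j.-1).
  by rewrite /Z /Y; field.
apply: (le_trans (ler_normB _ _)); rewrite !normrM [ `|4| ]ger0_norm//.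
by rewrite lerD2l -normrM ler_wpM2r// pB.
Qed.

Let s2 j : (om j + om j.-1) ^+ 2 <= 2 * (om j ^+ 2 + om j.-1 ^+ 2).
Proof.
rewrite -subr_ge0; have -> : 2 * (om j ^+ 2 + om j.-1 ^+ 2) - (om j + om j.-1) ^+ 2
  = (om j - om j.-1) ^+ 2 by ring.
exact: sqr_ge0.
Qed.

Let sum_s2 : \sum_(0 <= j < M) (om j + om j.-1) ^+ 2 <= 6 / c * \sum_(0 <= j < M) p j * om j ^+ 2.
Proof.
apply: (@le_trans _ _ (6 * \sum_(0 <= j < M) om j ^+ 2)); last first.
  rewrite -mulrA ler_wpM2l// mulr_sumr ler_sum_nat// => j /= jM.
  rewrite mulrA ler_peMl ?sqr_ge0// mulrC ler_pdivlMr// mul1r; exact: pc.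
apply: (@le_trans _ _ (2 * (\sum_(0 <= j < M) om j ^+ 2 + \sum_(0 <= j < M) om j.-1 ^+ 2))).
  by rewrite -big_split mulr_sumr ler_sum_nat.
have := @sum_pred_le R M (fun j => om j ^+ 2) (fun=> sqr_ge0 _).
by lra.
Qed.

Lemma fine_Z_le : \sum_(0 <= j < M) Z j ^+ 2 <=
  8 / c ^+ 2 * (\sum_(0 <= j < M) Y j ^+ 2) +
  3 * B ^+ 2 / c ^+ 3 * \sum_(0 <= j < M) p j * om j ^+ 2.
Proof.
apply: (@le_trans _ _ (\sum_(0 <= j < M)
   (8 / c ^+ 2 * Y j ^+ 2 + B ^+ 2 / (2 * c ^+ 2) * (om j + om j.-1) ^+ 2))).
  rewrite ler_sum_nat// => j /= jM.
  have := ZE jM; rewrite -(real_normK (num_real (Z j))) -(real_normK (num_real (Y j))).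
  rewrite -(real_normK (num_real (om j + om j.-1))) => H.
  apply: (@le_trans _ _ (((4 * `|Y j| + B * `|om j + om j.-1|) / (2 * c)) ^+ 2)).
    by rewrite ler_sqr ?nnegrE// (le_trans _ H).
  move: (normr_ge0 (Y j)) (normr_ge0 (om j + om j.-1)).
  move: `|Y j| `|om j + om j.-1| => y s y0 s0; rewrite -subr_ge0.
  have -> : 8 / c ^+ 2 * y ^+ 2 + B ^+ 2 / (2 * c ^+ 2) * s ^+ 2 -
     ((4 * y + B * s) / (2 * c)) ^+ 2 = ((4 * y - B * s) / (2 * c)) ^+ 2.
    by field; rewrite gt_eqF.
  exact: sqr_ge0.
rewrite big_split -!mulr_sumr lerD2l.
apply: (le_trans (ler_wpM2l _ sum_s2)).
  by rewrite mulr_ge0 ?sqr_ge0// invr_ge0 mulr_ge0// sqr_ge0.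
by rewrite mulrA le_eqVlt; apply/orP; left; apply/eqP; congr (_ * _); field; rewrite gt_eqF.
Qed.

Hypothesis ptG : forall j, (j < M)%N -> `|pt j| <= G.
Hypothesis eps0 : 0 <= eps.
Hypothesis kape : forall j, (0 < j < M)%N -> `|kap j| <= eps.
Hypothesis wtE : forall j, (0 < j < M)%N -> wt j = Y j + kap j + f j.
Hypotheses (pt0 : pt 0%N = 0) (ptM : pt M = 0) (wt0 : wt 0%N = 0) (wtM : wt M = 0).
Hypotheses (f0 : f 0%N = 0) (fM : f M = 0).

Let Y0 : Y 0 = 0. Proof. by rewrite /Y subrr mulr0. Qed.

(** Both sums are integrated by parts. Out of the dissipation - 4 Y^2, one Y^2 pays for the
    trilinear term pt (om j + om j.-1) Z, by [ZE] and an exact square, and one for the consistency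
    error. The source is put back in difference form because a Lipschitz bound will be used for
    it. *)
Lemma fine_Q_le :
  \sum_(0 <= j < M) (m * (pt j.+1 - pt j) * om j ^+ 2 +
     2 * p j * om j * (m * (wt j.+1 - wt j))) <=
  - 2 * (\sum_(0 <= j < M) Y j ^+ 2)
  + 6 * (G ^+ 2 / c ^+ 2 + G * B / (2 * c)) / c * (\sum_(0 <= j < M) p j * om j ^+ 2)
  + 4 * m * eps ^+ 2
  + 2 * m * \sum_(0 <= j < M) (f j.+1 - f j) * (p j * om j).
Proof.
rewrite big_split /=.
have -> : \sum_(0 <= j < M) m * (pt j.+1 - pt j) * om j ^+ 2 =
    - \sum_(0 <= j < M) pt j * (om j + om j.-1) * Z j.
  under eq_bigr do rewrite mulrAC mulrC mulrC.
  rewrite (sum_by_parts0 (fun j => m * om j ^+ 2))//; congr (- _).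
  by apply: eq_bigr => j _; rewrite /Z; ring.
have -> : \sum_(0 <= j < M) 2 * p j * om j * (m * (wt j.+1 - wt j)) =
    - \sum_(0 <= j < M) 4 * wt j * Y j.
  under eq_bigr do rewrite mulrA.
  rewrite (sum_by_parts0 (fun j => 2 * p j * om j * m))//; congr (- _).
  by apply: eq_bigr => j _; rewrite /Y; field.
have -> : \sum_(0 <= j < M) (f j.+1 - f j) * (p j * om j) =
    - (2 / m * \sum_(0 <= j < M) f j * Y j).
  under eq_bigr do rewrite mulrC.
  rewrite (sum_by_parts0 (fun j => p j * om j))//; congr (- _).
  rewrite mulr_sumr; apply: eq_bigr => j _; rewrite /Y; field.
  by rewrite pnatr_eq0 -lt0n.
have -> : 2 * m * - (2 / m * (\sum_(0 <= j < M) f j * Y j)) =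
    - \sum_(0 <= j < M) 4 * f j * Y j.
  rewrite mulrN; congr (- _); rewrite mulrA mulr_sumr; apply: eq_bigr => j _; field.
  by rewrite pnatr_eq0 -lt0n.
have -> : 4 * m * eps ^+ 2 = \sum_(0 <= j < M) 4 * eps ^+ 2.
  by rewrite big_const_nat iter_addr addr0 subn0 -mulr_natr; ring.
have H : \sum_(0 <= j < M) (- (pt j * (om j + om j.-1) * Z j) - 4 * wt j * Y j + 4 * f j * Y j)
   <= \sum_(0 <= j < M) (- 2 * Y j ^+ 2 + 4 * eps ^+ 2 +
        (G ^+ 2 / c ^+ 2 + G * B / (2 * c)) * (om j + om j.-1) ^+ 2).
  rewrite ler_sum_nat// => j /= jM.
  have H1 : - (pt j * (om j + om j.-1) * Z j) <=
     Y j ^+ 2 + (G ^+ 2 / c ^+ 2 + G * B / (2 * c)) * (om j + om j.-1) ^+ 2.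
    apply: (le_trans (ler_norm _)); rewrite normrN (normrM _ (Z j)) (normrM (pt j)).
    rewrite -(real_normK (num_real (Y j))) -(real_normK (num_real (om j + om j.-1))).
    have := ZE jM; have := ptG jM.
    move: (normr_ge0 (Y j)) (normr_ge0 (om j + om j.-1)) (normr_ge0 (Z j)) (normr_ge0 (pt j)).
    move: `|Y j| `|om j + om j.-1| `|Z j| `|pt j| => y s z q y0 s0 z0 q0 qG zy.
    apply: (@le_trans _ _ (G * s * ((4 * y + B * s) / (2 * c)))).
      by apply: (ler_pM _ z0 _ zy); [rewrite mulr_ge0|rewrite ler_wpM2r].
    rewrite -subr_ge0.
    have -> : y ^+ 2 + (G ^+ 2 / c ^+ 2 + G * B / (2 * c)) * s ^+ 2
      - G * s * ((4 * y + B * s) / (2 * c)) = (y - G / c * s) ^+ 2.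
      by field; rewrite gt_eqF.
    exact: sqr_ge0.
  have H2 : - 4 * wt j * Y j + 4 * f j * Y j <= -3 * Y j ^+ 2 + 4 * eps ^+ 2.
    case: j jM {H1} => [|j] jM.
      by rewrite Y0 expr0n !mulr0 !add0r mulr_ge0// sqr_ge0.
    rewrite wtE//; have := kape (jM : (0 < j.+1 < M)%N).
    rewrite -ler_sqr ?nnegrE//.
    rewrite (real_normK (num_real _)) => ke.
    have : 0 <= (Y j.+1 + 2 * kap j.+1) ^+ 2 by exact: sqr_ge0.
    have -> : (Y j.+1 + 2 * kap j.+1) ^+ 2 = Y j.+1 ^+ 2 + 4 * kap j.+1 ^+ 2 + 4 * kap j.+1 * Y j.+1 by ring.
    have -> : - 4 * (Y j.+1 + kap j.+1 + f j.+1) * Y j.+1 + 4 * f j.+1 * Y j.+1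
      = - 4 * Y j.+1 ^+ 2 - 4 * kap j.+1 * Y j.+1 by ring.
    by move: ke; lra.
  by move: H1 H2; lra.
move: H; rewrite !big_split /= !sumrN -!mulr_sumr.
have C0 : 0 <= G ^+ 2 / c ^+ 2 + G * B / (2 * c).
  have := ltW c0 => c0'.
  by rewrite addr_ge0// !mulr_ge0 ?sqr_ge0 ?invr_ge0 ?mulr_ge0 ?sqr_ge0.
have : (G ^+ 2 / c ^+ 2 + G * B / (2 * c)) * (\sum_(0 <= j < M) (om j + om j.-1) ^+ 2) <=
    6 * (G ^+ 2 / c ^+ 2 + G * B / (2 * c)) / c * (\sum_(0 <= j < M) p j * om j ^+ 2).
  apply: (le_trans (ler_wpM2l C0 sum_s2)).
  set S := \sum_(_ <= _ < _) _; rewrite le_eqVlt; apply/orP; left; apply/eqP; ring.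
by lra.
Qed.

Hypotheses (w0 : w 0%N = 0) (wM : w M = 0).
Hypothesis omE : forall j, om j = m * (w j.+1 - w j).

Lemma fine_poincare : c * \sum_(0 <= j < M) w j ^+ 2 <= \sum_(0 <= j < M) p j * om j ^+ 2.
Proof.
have m0 : 0 < m by rewrite ltr0n.
have wE j : m * w j = \sum_(0 <= i < j) om i.
  elim: j => [|j IH]; first by rewrite big_geq// w0 mulr0.
  by rewrite big_nat_recr//= -IH omE; ring.
have sQ : c * (\sum_(0 <= j < M) om j ^+ 2) <= \sum_(0 <= j < M) p j * om j ^+ 2.
  by rewrite mulr_sumr ler_sum_nat// => j /= jM; rewrite ler_wpM2r ?sqr_ge0// pc.
apply: le_trans sQ; rewrite ler_wpM2l ?(ltW c0)//.
have wj j : (j < M)%N -> w j ^+ 2 <= m^-1 * \sum_(0 <= i < M) om i ^+ 2.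
  move=> jM; rewrite -(ler_pM2l (exprn_gt0 2 m0)) -exprMn wE.
  apply: (le_trans (sum_sqr_le _ _ _)); rewrite subn0 expr2 mulrA mulfK ?gt_eqF//.
  apply: ler_pM => //; first by apply: sumr_ge0 => i _; exact: sqr_ge0.
    by rewrite ler_nat ltnW.
  rewrite [leRHS](@big_cat_nat _ _ _ j)//=; last exact: ltnW.
  by rewrite lerDl sumr_ge0// => i _; exact: sqr_ge0.
apply: (@le_trans _ _ (\sum_(0 <= j < M) (m^-1 * \sum_(0 <= i < M) om i ^+ 2))).
  by rewrite ler_sum_nat.
rewrite big_const_nat iter_addr addr0 subn0; set S := \sum_(_ <= _ < _) _.
by rewrite -[_ *+ M]mulr_natr mulrAC mulVf ?gt_eqF// mul1r.
Qed.

(** The energy of om is the dissipation of the square sum of w; this is what later absorbs the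
    growth term of [fine_Q_le]. *)
Lemma fine_W_eq : (forall j, f j = 0) ->
  \sum_(0 <= j < M) 2 * w j * wt j <=
  - (\sum_(0 <= j < M) p j * om j ^+ 2) + 2 * eps * \sum_(0 <= j < M) `|w j|.
Proof.
move=> f00.
have -> : - (\sum_(0 <= j < M) p j * om j ^+ 2) = \sum_(0 <= j < M) 2 * w j * Y j.
  under eq_bigr => j _ do rewrite expr2 {2}omE mulrA (mulrA _ m).
  rewrite (sum_by_parts0 (fun j => p j * om j * m))// opprK.
  by apply: eq_bigr => j _; rewrite /Y; field.
rewrite mulr_sumr -big_split ler_sum_nat// => j /= jM.
case: j jM => [|j] jM; first by rewrite w0 normr0 !(mulr0, mul0r) addr0.
rewrite wtE// f00 addr0 mulrDr lerD2l.
apply: (le_trans (ler_norm _)); rewrite !normrM ger0_norm// -mulrA -[leRHS]mulrA ler_wpM2l//.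
by rewrite mulrC ler_wpM2r// kape.
Qed.

End FineEnergy.

(** * Energy inequality for the error at the N points *)

Section CoarseEnergy.
Context {R : realType}.
Variables (N : nat) (c : R) (e a b g r f del : nat -> R).
Hypotheses (N0 : (0 < N)%N) (c0 : 0 < c).
Local Notation n := (N%:R : R).
Hypotheses (e0 : e 0%N = - e 1%N) (eN : e N.+1 = - e N).
Hypothesis abE : forall i, (i <= N)%N -> a i - b i = n * (e i.+1 - e i).
Hypothesis abc : forall i, (i <= N)%N -> 2 * c <= a i + b i.
Hypothesis gE : forall i, (1 <= i <= N)%N -> g i = r i + n * (f i - f i.-1).
Hypothesis fE : forall i, (i <= N)%N -> f i = b i ^+ 2 / 4 + del i.

(* The end points carry half weights because the reflected ghost points double
   the first and the last gap. *)
Let v (i : nat) : R := if (i == 0%N) || (i == N) then 2^-1 else 1.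

Let v0 i : 0 <= v i. Proof. by rewrite /v; case: ifP. Qed.

Let v1 i : v i <= 1. Proof. by rewrite /v; case: ifP => // _; rewrite invf_le1// ler1n. Qed.

Let n0 : 0 < n. Proof. by rewrite ltr0n. Qed.

Let eE i : (1 <= i <= N)%N -> n * e i = \sum_(0 <= k < i) v k * (a k - b k).
Proof.
elim: i => // -[|i] IH /andP[_ iN].
  by rewrite big_nat1 /v eqxx/= abE// e0; field.
have vi : v i.+1 = 1 by rewrite /v /= ltn_eqF.
have ab := abE (ltnW iN).
have IH' := IH (ltnW iN).
rewrite big_nat_recr//= -IH' vi ab; ring.
Qed.

Let poincare : \sum_(1 <= i < N.+1) e i ^+ 2 <= \sum_(0 <= i < N.+1) v i * (a i - b i) ^+ 2.
Proof.
set S := \sum_(0 <= i < N.+1) _.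
have S0 (m1 m2 : nat) : 0 <= \sum_(m1 <= i < m2) v i * (a i - b i) ^+ 2.
  by apply: sumr_ge0 => i _; rewrite mulr_ge0 ?sqr_ge0.
have ei i : (1 <= i < N.+1)%N -> e i ^+ 2 <= n^-1 * S.
  move=> iN; rewrite -(ler_pM2l (exprn_gt0 2 n0)) -exprMn eE//.
  apply: (le_trans (weighted_cauchy_schwarz _ _ _ v0)).
  rewrite expr2 mulrA mulfK ?gt_eqF//; apply: ler_pM => //.
  - by apply: sumr_ge0.
  - apply: (@le_trans _ _ (\sum_(0 <= k < i) 1)); first by apply: ler_sum.
    by rewrite big_const_nat iter_addr addr0 subn0 ler_nat -ltnS; case/andP: iN.
  have iN1 : (i <= N.+1)%N by apply: ltnW; case/andP: iN.
  rewrite /S [leRHS](@big_cat_nat _ _ _ i)//=.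
  by rewrite lerDl.
apply: (@le_trans _ _ (\sum_(1 <= i < N.+1) n^-1 * S)); first exact: ler_sum_nat.
rewrite big_const_nat iter_addr addr0 subn1 /= -[_ *+ N]mulr_natr mulrAC mulVf ?gt_eqF//.
by rewrite mul1r.
Qed.

(** No boundary term survives: by antisymmetry e 1 is half of the first increment of e, and e N is
    minus half of the last one, which accounts for the weights 1 / 2 in v. *)
Lemma coarse_by_parts (F : nat -> R) :
  \sum_(1 <= i < N.+1) e i * (F i - F i.-1) =
  - (n^-1 * \sum_(0 <= i < N.+1) v i * (a i - b i) * F i).
Proof.
have -> : \sum_(1 <= i < N.+1) e i * (F i - F i.-1) =
    e N * F N - e 1%N * F 0%N - \sum_(1 <= i < N) (e i.+1 - e i) * F i.
  case: N N0 => // k _; elim: k => [|k IH].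
    by rewrite big_nat1 big_geq//=; ring.
  by rewrite big_nat_recr//= IH [in RHS]big_nat_recr//=; ring.
rewrite mulr_sumr big_nat_recr//= [X in _ = - (X + _)]big_ltn// /v !eqxx orbT /=.
rewrite !abE// eN e0.
have -> : \sum_(1 <= i < N) n^-1 * ((if (i == 0%N) || (i == N) then 2^-1 else 1) * (a i - b i) * F i)
  = \sum_(1 <= i < N) (e i.+1 - e i) * F i.
  apply: eq_big_nat => i /andP[i1 iN].
  rewrite gtn_eqF// ltn_eqF//= abE ?(ltnW iN)// mul1r mulrA mulrA mulVf ?gt_eqF//.
  by rewrite mul1r.
by field; rewrite gt_eqF.
Qed.

(** The square is monotone: (a - b)(a^2 - b^2) = (a + b)(a - b)^2 >= 2 c (a - b)^2. Half of the
    resulting dissipation absorbs the flux defect del; the other half becomes c / 2 times the square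
    sum of e by [poincare], and half of that absorbs the cell defect r. *)
Lemma coarse_energy :
  2 / n * (\sum_(1 <= i < N.+1) e i * (n / 4 * (a i ^+ 2 - a i.-1 ^+ 2) - g i)) <=
  n^-1 * (- (c / 4) * (\sum_(1 <= i < N.+1) e i ^+ 2)
     + 2 / c * (\sum_(0 <= i < N.+1) del i ^+ 2)
     + 4 / c * (\sum_(1 <= i < N.+1) r i ^+ 2)).
Proof.
pose F i := (a i ^+ 2 - b i ^+ 2) / 4 - del i.
have -> : \sum_(1 <= i < N.+1) e i * (n / 4 * (a i ^+ 2 - a i.-1 ^+ 2) - g i) =
    n * (\sum_(1 <= i < N.+1) e i * (F i - F i.-1)) - \sum_(1 <= i < N.+1) e i * r i.
  rewrite mulr_sumr -sumrB; apply: eq_big_nat => i /andP[i1 iN].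
  have iN1 : (i.-1 <= N)%N by rewrite (leq_trans (leq_pred _)).
  by rewrite gE ?i1// !fE// /F; field.
rewrite coarse_by_parts.
have H1 : - 2 * (\sum_(0 <= i < N.+1) v i * (a i - b i) * F i) <=
   - (c / 2) * (\sum_(0 <= i < N.+1) v i * (a i - b i) ^+ 2)
   + 2 / c * \sum_(0 <= i < N.+1) del i ^+ 2.
  rewrite !mulr_sumr -big_split ler_sum_nat// => i /= iN.
  have H : -2 * (a i - b i) * F i <= - (c / 2) * (a i - b i) ^+ 2 + 2 / c * del i ^+ 2.
    rewrite /F; have := abc iN; move: (a i) (b i) (del i) => x y d xy.
    have s0 := sqr_ge0 (x - y).
    have : 0 <= (c / 2) * ((x - y) - (2 / c) * d) ^+ 2.
      by rewrite mulr_ge0 ?sqr_ge0// divr_ge0// ltW.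
    have -> : (c / 2) * ((x - y) - (2 / c) * d) ^+ 2 =
       c / 2 * (x - y) ^+ 2 + 2 / c * d ^+ 2 - 2 * (x - y) * d.
      by field; rewrite gt_eqF.
    have : 2 * c * (x - y) ^+ 2 <= (x + y) * (x - y) ^+ 2 by rewrite ler_wpM2r.
    have -> : (x + y) * (x - y) ^+ 2 = (x - y) * (x ^+ 2 - y ^+ 2) by ring.
    have -> : -2 * (x - y) * ((x ^+ 2 - y ^+ 2) / 4 - d) =
      - (1 / 2) * ((x - y) * (x ^+ 2 - y ^+ 2)) + 2 * (x - y) * d by field.
    by lra.
  have := ler_wpM2l (v0 i) H.
  have d0 : 0 <= 2 / c * del i ^+ 2 by rewrite mulr_ge0 ?sqr_ge0// divr_ge0// ltW.
  have : v i * (2 / c * del i ^+ 2) <= 2 / c * del i ^+ 2 by rewrite ler_piMl.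
  by lra.
have H2 : - 2 * (\sum_(1 <= i < N.+1) e i * r i) <=
    c / 4 * (\sum_(1 <= i < N.+1) e i ^+ 2) + 4 / c * (\sum_(1 <= i < N.+1) r i ^+ 2).
  rewrite !mulr_sumr -big_split ler_sum_nat// => i /= iN.
  rewrite -subr_ge0.
  have -> : c / 4 * e i ^+ 2 + 4 / c * r i ^+ 2 - -2 * (e i * r i) =
     c / 4 * (e i + 4 / c * r i) ^+ 2 by field; rewrite gt_eqF.
  by rewrite mulr_ge0 ?sqr_ge0// divr_ge0// ltW.
have H3 := ler_wpM2l (divr_ge0 (ltW c0) (ler0n _ 2)) poincare.
have -> : forall S T : R, 2 / n * (n * - (n^-1 * S) - T) = n^-1 * (- 2 * S - 2 * T).
  by move=> S T; field; rewrite gt_eqF.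
rewrite ler_wpM2l ?invr_ge0 ?(ltW n0)//.
by move: H1 H2 H3; lra.
Qed.

End CoarseEnergy.

(** * Consistency of finite differences *)

Section Slices.
Context {R : realType}.

(** On the compact set of pairs of points whose values differ by at least e, the distance of the two
    points has a positive minimum; half of it serves as d. *)
Lemma uniform_continuity (f : R -> R -> R) (T e : R) : 0 <= T -> 0 < e ->
  continuous (fun p : R * R => f p.1 p.2) ->
  exists2 d, 0 < d & forall t t' y y', 0 <= t <= T -> 0 <= t' <= T ->
    0 <= y <= 1 -> 0 <= y' <= 1 -> `|t - t'| < d -> `|y - y'| < d ->
    `|f t y - f t' y'| < e.
Proof.
move=> T0 e0 cf.
pose K : set (R * R) := `[0, T] `*` `[0, 1].
have cK : compact K by apply: compact_setX; exact: segment_compact.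
pose h (q : (R * R) * (R * R)) := `|f q.1.1 q.1.2 - f q.2.1 q.2.2|.
pose dist (q : (R * R) * (R * R)) := `|q.1.1 - q.2.1| + `|q.1.2 - q.2.2|.
have c1 : continuous (fun q : (R * R) * (R * R) => q.1) by move=> ?; exact: cvg_fst.
have c2 : continuous (fun q : (R * R) * (R * R) => q.2) by move=> ?; exact: cvg_snd.
have c11 : continuous (fun q : (R * R) * (R * R) => q.1.1).
  by move=> q; apply: (@cvg_comp _ _ _ fst fst _ (nbhs q.1)); [exact: c1|exact: cvg_fst].
have c12 : continuous (fun q : (R * R) * (R * R) => q.1.2).
  by move=> q; apply: (@cvg_comp _ _ _ fst snd _ (nbhs q.1)); [exact: c1|exact: cvg_snd].
have c21 : continuous (fun q : (R * R) * (R * R) => q.2.1).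
  by move=> q; apply: (@cvg_comp _ _ _ snd fst _ (nbhs q.2)); [exact: c2|exact: cvg_fst].
have c22 : continuous (fun q : (R * R) * (R * R) => q.2.2).
  by move=> q; apply: (@cvg_comp _ _ _ snd snd _ (nbhs q.2)); [exact: c2|exact: cvg_snd].
have ch : continuous h.
  move=> q; apply: cvg_norm; apply: cvgB.
    exact: (continuous_comp2 cf c11 c12).
  exact: (continuous_comp2 cf c21 c22).
have cd : continuous dist.
  by move=> q; apply: cvgD; apply: cvg_norm; apply: cvgB;
    [exact: c11|exact: c21|exact: c12|exact: c22].
pose S := (K `*` K) `&` [set q | e <= h q].
have cS : compact S.
  apply: compact_closedI; first exact: compact_setX.
  have -> : [set q | e <= h q] = h @^-1` [set x | e <= x] by [].
  by apply: closed_comp; [move=> q _; exact: ch|exact: closed_ge].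
have [S0|S0] := pselect (S !=set0); last first.
  exists 1 => // t t' y y' tT t'T y1 y'1 _ _; rewrite ltNge; apply/negP => H.
  apply: S0; exists ((t, y), (t', y')).
  by split => //=; split; split => //=; rewrite in_itv.
have [[[t t'] [y y']]] := compact_EVT_min S0 cS (continuous_subspaceT cd).
rewrite inE => -[_ /= Sh] Smin.
exists (dist ((t, t'), (y, y')) / 2) => [|s s' z z' sT s'T z1 z'1 sd zd].
  rewrite divr_gt0// lt_neqAle eq_sym addr_ge0// andbT.
  rewrite paddr_eq0// !normr_eq0 !subr_eq0 /=; apply/negP => /andP[/eqP tE /eqP t'E].
  by move: Sh; rewrite /h /= tE t'E subrr normr0 leNgt e0.
rewrite ltNge; apply/negP => H.
have HS : S ((s, z), (s', z')) by split => //=; split; split => //=; rewrite in_itv.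
have := Smin ((s, z), (s', z')); rewrite inE => /(_ HS).
by move: sd zd; rewrite /dist /=; lra.
Qed.

Lemma MVT01 (f df : R -> R) (a b : R) : 0 <= a -> a < b -> b <= 1 ->
  continuous f -> (forall y : R, 0 < y < 1 -> is_derive y (1 : R) f (df y)) ->
  exists2 z, a < z < b & f b - f a = df z * (b - a).
Proof.
move=> a0 ab b1 cf dff.
have [||z] := @MVT R f df a b ab; last by rewrite in_itv; exists z.
- move=> z; rewrite in_itv/= => /andP[az zb]; apply: dff.
  by rewrite (le_lt_trans a0)//= (lt_le_trans zb).
- exact: continuous_subspaceT.
Qed.

Lemma is_derive_refl (f : R -> R) (m s l : R) : is_derive (m - s) (1 : R) f l ->
  is_derive s (1 : R) (fun r => f (m - r)) (- l).
Proof.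
move/is_derive_epsP => fl; apply/is_derive_epsP => e /fl[d d0 dP].
exists d => // y; rewrite distrC => ys yns; have := dP (m - y).
have -> : m - y - (m - s) = s - y by ring.
rewrite (inj_eq (addrI m)) eqr_opp => /(_ ys yns).
by rewrite -[y - s]opprB invrN mulrN -opprD normrN.
Qed.

Section Symmetric.
Variables (f df : R -> R) (m tau : R).
Hypotheses (tau0 : 0 < tau) (m0 : 0 <= m - tau) (m1 : m + tau <= 1).
Hypothesis cf : continuous f.
Hypothesis dff : forall y : R, 0 < y < 1 -> is_derive y (1 : R) f (df y).

Let cp : continuous (fun s => f (m + s)).
Proof. by move=> s; apply: cvg_comp; last exact: cf; apply: cvgD; [exact: cvg_cst|exact: cvg_id]. Qed.

Let cm : continuous (fun s => f (m - s)).
Proof. by move=> s; apply: cvg_comp; last exact: cf; apply: cvgB; [exact: cvg_cst|exact: cvg_id]. Qed.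

Let dp s : 0 < s < tau -> is_derive s (1 : R) (fun s => f (m + s)) (df (m + s)).
Proof.
move=> s1; have -> : (fun s => f (m + s)) = (fun s => f (s + m)).
  by apply/funext => r; rewrite addrC.
by apply: is_derive_shift; rewrite addrC; apply: dff; move: m0 m1; lra.
Qed.

Let dm s : 0 < s < tau -> is_derive s (1 : R) (fun s => f (m - s)) (- df (m - s)).
Proof. by move=> s1; apply: is_derive_refl; apply: dff; move: m0 m1; lra. Qed.

Lemma MVT_sym_sub : exists2 s, 0 < s < tau &
  f (m + tau) - f (m - tau) = tau * (df (m + s) + df (m - s)).
Proof.
have [||s] := @MVT R (fun s => f (m + s) - f (m - s)) (fun s => df (m + s) + df (m - s)) 0 tau tau0.
- move=> s; rewrite in_itv/= => s1; rewrite -[df (m - s)]opprK.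
  exact: is_deriveB (dp s1) (dm s1).
- by apply: continuous_subspaceT => s; apply: cvgB; [exact: cp|exact: cm].
rewrite in_itv/= => s1; rewrite addr0 subr0 subrr !subr0 mulrC.
by exists s.
Qed.

(* With [k = 0] this is the mean value theorem for the symmetric second
   difference; the correction by [k] gives the second order Taylor remainder. *)
Lemma MVT_sym_add k : exists2 s, 0 < s < tau &
  f (m + tau) + f (m - tau) - 2 * f m - tau ^+ 2 * k =
  tau * (df (m + s) - df (m - s) - 2 * s * k).
Proof.
have [||s] := @MVT R (fun s => f (m + s) + f (m - s) - k * s ^+ 2)
  (fun s => df (m + s) - df (m - s) - 2 * s * k) 0 tau tau0.
- move=> s; rewrite in_itv/= => s1.
  have dk : is_derive s (1 : R) (fun s => k * s ^+ 2) (2 * s * k).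
    have H : is_derive s (1 : R) (fun s : R => s ^+ 2) (2 * s).
      apply/is_derive_epsP => e e0; exists e => // y ys yns.
      have -> : (y ^+ 2 - s ^+ 2) / (y - s) - 2 * s = y - s by field; rewrite subr_eq0.
      exact: ltW.
    by rewrite [2 * s * k]mulrC; exact: is_deriveZ.
  exact: is_deriveB (is_deriveD (dp s1) (dm s1)) dk.
- apply: continuous_subspaceT => s; apply: cvgB; first by apply: cvgD; [exact: cp|exact: cm].
  by apply: cvgM; [exact: cvg_cst|exact: exprn_continuous].
rewrite in_itv/= => s1; rewrite addr0 !subr0 expr0n mulr0 subr0 => E.
by exists s => //; rewrite [RHS]mulrC -E; ring.
Qed.

End Symmetric.

End Slices.

Section Consistency.
Context {R : realType}.
Variables (X u g : R -> R) (c C G : R).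
Hypotheses (c0 : 0 < c) (G0 : 0 <= G).
Hypotheses (cX : continuous X) (cu : continuous u).
Hypothesis dX : forall y : R, 0 < y < 1 -> is_derive y (1 : R) X (u y).
Hypothesis du : forall y : R, 0 < y < 1 -> is_derive y (1 : R) u (2 * g y / u y).
Hypothesis dF : forall y : R, 0 < y < 1 -> is_derive y (1 : R) (fun z => u z ^+ 2) (4 * g y).
Hypothesis ub : forall y : R, 0 <= y <= 1 -> c <= u y <= C.
Hypothesis gb : forall y : R, 0 <= y <= 1 -> `|g y| <= G.

(** The derivative of u, that is, the second space derivative of X. *)
Let phi (y : R) : R := 2 * g y / u y.

Let u0 (y : R) : 0 <= y <= 1 -> 0 < u y.
Proof. by move=> /ub/andP[+ _]; exact: lt_le_trans. Qed.

Let phi_bound (y : R) : 0 <= y <= 1 -> `|phi y| <= 2 * G / c.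
Proof.
move=> y01; have uy := u0 y01; have /andP[cy _] := ub y01.
rewrite /phi normrM normfV (gtr0_norm uy) normrM ger0_norm//.
apply: ler_pM; rewrite ?invr_ge0 ?(ltW uy)//.
  by rewrite ler_wpM2l// gb.
by rewrite lef_pV2 ?posrE.
Qed.

Lemma slice_u_lip (y z : R) : 0 <= y <= 1 -> 0 <= z <= 1 ->
  `|u y - u z| <= 2 * G / c * `|y - z|.
Proof.
wlog yz : y z / z < y.
  move=> H y01 z01; have [yz|zy|->] := ltgtP z y; first exact: H.
    by rewrite distrC [`|y - z|]distrC; exact: H.
  by rewrite !subrr !normr0 mulr0.
move=> y01 z01.
have [||w w1 ->] := MVT01 _ yz _ cu du; rewrite ?(andP z01).1 ?(andP y01).2//.
by rewrite normrM ler_wpM2r// phi_bound//; move: y01 z01 w1; lra.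
Qed.

Let phi_osc (y z : R) : 0 <= y <= 1 -> 0 <= z <= 1 ->
  `|phi y - phi z| <= 2 / c * `|g y - g z| + 4 * G ^+ 2 / c ^+ 3 * `|y - z|.
Proof.
move=> y01 z01; have uy := u0 y01; have uz := u0 z01.
have /andP[cy _] := ub y01; have /andP[cz _] := ub z01.
have -> : phi y - phi z = 2 * (g y - g z) / u y + 2 * g z * (u z - u y) / (u y * u z).
  by rewrite /phi; field; rewrite !gt_eqF.
apply: (le_trans (ler_normD _ _)); apply: lerD.
  rewrite !normrM normfV (gtr0_norm uy) ger0_norm// mulrAC ler_wpM2r//.
  by rewrite ler_wpM2l// lef_pV2 ?posrE.
rewrite !normrM normfV (@ger0_norm _ 2)// [ `|_ * _| ]gtr0_norm ?mulr_gt0//.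
have -> : 4 * G ^+ 2 / c ^+ 3 * `|y - z| = 2 * G * (2 * G / c * `|y - z|) / (c * c).
  by field; rewrite gt_eqF.
apply: ler_pM; rewrite ?mulr_ge0 ?invr_ge0 ?mulr_ge0 ?(ltW uy) ?(ltW uz)//.
  apply: ler_pM; rewrite ?mulr_ge0//; first by rewrite ler_wpM2l// gb.
  by rewrite [ `|y - z|]distrC; exact: slice_u_lip.
rewrite lef_pV2 ?posrE ?mulr_gt0//; apply: ler_pM => //; exact: ltW.
Qed.

Section Fine.
Variables (M : nat) (eps : R).
Hypothesis M0 : (0 < M)%N.
Local Notation m := (M%:R : R).
Hypothesis ge : forall y z : R, 0 <= y <= 1 -> 0 <= z <= 1 -> `|y - z| <= m^-1 ->
  `|g y - g z| <= eps.
Let al (j : nat) : R := m * (X (j.+1%:R / m) - X (j%:R / m)).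

Let m0 : 0 < m. Proof. by rewrite ltr0n. Qed.

Let node (j : nat) : (j <= M)%N -> 0 <= j%:R / m <= 1.
Proof. by move=> jM; rewrite divr_ge0//= ler_pdivrMr// mul1r ler_nat. Qed.

Let nodeS (j : nat) : j.+1%:R / m = j%:R / m + m^-1.
Proof. by rewrite -natr1 mulrDl mul1r. Qed.

Lemma fine_slope j : (j < M)%N -> c <= al j <= C.
Proof.
move=> jM; have /andP[n0 _] := node (ltnW jM); have /andP[_ n1] := node jM.
have mi : 0 < m^-1 by rewrite invr_gt0.
have jj : j%:R / m < j.+1%:R / m by rewrite nodeS ltrDl.
have [w w1 E] := MVT01 n0 jj n1 cX dX.
rewrite /al E nodeS addrAC subrr add0r mulrC mulfVK ?gt_eqF//.
by apply: ub; move: w1 n0 n1; lra.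
Qed.

Let around (j : nat) : (0 < j < M)%N ->
  [/\ j.+1%:R / m = j%:R / m + m^-1, j.-1%:R / m = j%:R / m - m^-1,
      0 <= j%:R / m - m^-1 & j%:R / m + m^-1 <= 1].
Proof.
case: j => // j /andP[_ jM].
have /andP[_ n1] := node jM; have /andP[n0 _] := node (ltnW (ltnW jM)).
by split; rewrite -?nodeS//= nodeS addrK.
Qed.

Lemma fine_second (j : nat) : (j < M)%N -> `|m * (al j - al j.-1)| <= 4 * G / c.
Proof.
have K0 : 0 <= 4 * G / c by rewrite divr_ge0 ?mulr_ge0// ltW.
case: j => [_|j jM]; first by rewrite subrr mulr0 normr0.
have [E1 E2 n0 n1] := around (jM : (0 < j.+1 < M)%N).
have mi : 0 < m^-1 by rewrite invr_gt0.
have [s s1 E] := MVT_sym_add mi n0 n1 cX dX 0.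
have -> : al j.+1 - al j.+1.-1 = m * (m^-1 * (u (j.+1%:R / m + s) - u (j.+1%:R / m - s))).
  rewrite /al E1; move: E; rewrite !mulr0 !subr0 => <-.
  by rewrite -E2; ring.
rewrite mulVKf ?gt_eqF// normrM gtr0_norm//.
have := @slice_u_lip (j.+1%:R / m + s) (j.+1%:R / m - s).
have -> : j.+1%:R / m + s - (j.+1%:R / m - s) = 2 * s by ring.
have s0 : 0 < s by case/andP: s1.
rewrite (@gtr0_norm _ (2 * s)) ?mulr_gt0// => H.
apply: (le_trans (ler_wpM2l (ltW m0) (H _ _))); try by move: s1 n0 n1; lra.
have -> : m * (2 * G / c * (2 * s)) = (4 * G / c) * (m * s) by ring.
rewrite ler_piMr// mulrC -ler_pdivlMr// mul1r ltW//; by case/andP: s1.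
Qed.

(** The comparison is made factor by factor: the flux difference is (al j + al j.-1) m (al j - al
    j.-1) / 4, and g is 2 u phi / 4. Since g is merely continuous, the error is measured by its
    oscillation eps, made small later by refining the grid. *)
Lemma fine_consistency (j : nat) : (0 < j < M)%N ->
  `|g (j%:R / m) - m / 4 * (al j ^+ 2 - al j.-1 ^+ 2)| <=
  (2 * G ^+ 2 / c ^+ 2 + 2 * C / c + 4 * C * G ^+ 2 / c ^+ 3) * (eps + m^-1).
Proof.
move=> jM; have [E1 E2 n0 n1] := around jM.
have jM' : (j < M)%N by case/andP: jM.
have j1M : (j.-1 < M)%N by rewrite (leq_ltn_trans (leq_pred _)).
have jS : j.-1.+1 = j by rewrite prednK//; case/andP: jM.
set y := j%:R / m in E1 E2 n0 n1 *.
have mi : 0 < m^-1 by rewrite invr_gt0.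
have y01 : 0 <= y <= 1 by move: n0 n1 mi; lra.
have C0 : 0 <= C by have /andP[] := ub y01; move: c0; lra.
have [s s1 Es] := MVT_sym_sub mi n0 n1 cX dX.
have [q q1 Eq] := MVT_sym_add mi n0 n1 cX dX (phi y).
have q0 : 0 < q by case/andP: q1.
have nq0 : 0 <= y - q by move: n0 q1; lra.
have nq1 : y + q <= 1 by move: n1 q1; lra.
have [p p1 Ep] := MVT_sym_sub q0 nq0 nq1 cu du.
have A1 : al j + al j.-1 = u (y + s) + u (y - s).
  have : m * (m^-1 * (u (y + s) + u (y - s))) = u (y + s) + u (y - s).
    by rewrite mulrA mulfV ?mul1r// gt_eqF.
  by rewrite -Es => <-; rewrite /al jS E1 E2 -/y; ring.
have A2 : m * (al j - al j.-1) - phi y = m * q * (phi (y + p) + phi (y - p) - 2 * phi y).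
  have : m * (al j - al j.-1) - phi y =
    m ^+ 2 * (X (y + m^-1) + X (y - m^-1) - 2 * X y - m^-1 ^+ 2 * phi y).
    by rewrite /al jS E1 E2 -/y; field; rewrite gt_eqF.
  by rewrite Eq Ep => ->; rewrite /phi; field; rewrite !gt_eqF//; apply: u0 => //; move: p1 nq0 nq1 y01; lra.
have B1 : `|2 * u y - (al j + al j.-1)| <= 4 * G / c * m^-1.
  rewrite A1; have -> : 2 * u y - (u (y + s) + u (y - s)) = (u y - u (y + s)) + (u y - u (y - s)) by ring.
  apply: (le_trans (ler_normD _ _)).
  have ys : 0 <= y + s <= 1 by move: s1 n0 n1; lra.
  have ys' : 0 <= y - s <= 1 by move: s1 n0 n1; lra.
  have := slice_u_lip y01 ys; have := slice_u_lip y01 ys'.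
  have -> : y - (y - s) = s by ring. have -> : y - (y + s) = - s by ring.
  rewrite normrN (@gtr0_norm _ s); last by case/andP: s1.
  have : 2 * G / c * s <= 2 * G / c * m^-1.
    by rewrite ler_wpM2l ?divr_ge0 ?mulr_ge0// ltW//; case/andP: s1.
  by lra.
have B2 : `|m * (al j - al j.-1) - phi y| <= 2 * (2 / c * eps + 4 * G ^+ 2 / c ^+ 3 * m^-1).
  rewrite A2.
  have -> : phi (y + p) + phi (y - p) - 2 * phi y = (phi (y + p) - phi y) + (phi (y - p) - phi y) by ring.
  have mq : 0 <= m * q <= 1.
    rewrite mulr_ge0 ?(ltW m0) ?(ltW q0)//= mulrC -ler_pdivlMr// mul1r; by case/andP: q1 => _ /ltW.
  have pm : p <= m^-1 by move: p1 q1; lra.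
  have yp : 0 <= y + p <= 1 by move: p1 nq0 nq1; lra.
  have yp' : 0 <= y - p <= 1 by move: p1 nq0 nq1; lra.
  have p0 : 0 < p by case/andP: p1.
  have d1 : `|y + p - y| <= m^-1 by rewrite addrAC subrr add0r gtr0_norm.
  have d2 : `|y - p - y| <= m^-1 by rewrite addrAC subrr add0r normrN gtr0_norm.
  have K1 : 0 <= 2 / c by rewrite divr_ge0// ltW.
  have K2 : 0 <= 4 * G ^+ 2 / c ^+ 3 by rewrite divr_ge0 ?mulr_ge0 ?sqr_ge0 ?exprn_ge0// ltW.
  have H1 := phi_osc yp y01; have H2 := phi_osc yp' y01.
  have H3 := ler_wpM2l K1 (ge yp y01 d1); have H4 := ler_wpM2l K1 (ge yp' y01 d2).
  have H5 := ler_wpM2l K2 d1; have H6 := ler_wpM2l K2 d2.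
  rewrite normrM ger0_norm; last by case/andP: mq.
  apply: (@le_trans _ _ `|phi (y + p) - phi y + (phi (y - p) - phi y)|).
    by rewrite ler_piMl//; case/andP: mq.
  by apply: (le_trans (ler_normD _ _)); move: H1 H2 H3 H4 H5 H6; lra.
have -> : g y - m / 4 * (al j ^+ 2 - al j.-1 ^+ 2) =
  (2 * u y - (al j + al j.-1)) * phi y / 4
  - (al j + al j.-1) * (m * (al j - al j.-1) - phi y) / 4.
  by rewrite /phi; field; rewrite gt_eqF// u0.
apply: (le_trans (ler_normB _ _)).
rewrite 2![in X in X + _]normrM 2![in X in _ + X]normrM [ `|4^-1| ]gtr0_norm//.
have Hp := phi_bound y01.
have S2 : `|al j + al j.-1| <= 2 * C.
  have /andP[a1 a2] := fine_slope jM'; have /andP[a3 a4] := fine_slope j1M.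
  by rewrite ger0_norm; move: a1 a2 a3 a4 c0; lra.
have e0 : 0 <= eps by apply: le_trans (ge y01 y01 _) => //; rewrite subrr normr0 ltW.
have P1 := ler_pM (normr_ge0 _) (normr_ge0 _) B1 Hp.
have P2 := ler_pM (normr_ge0 _) (normr_ge0 _) S2 B2.
have ci : 0 < c^-1 by rewrite invr_gt0.
have Q1 : 0 <= 2 * G ^+ 2 / c ^+ 2 by rewrite divr_ge0 ?mulr_ge0 ?exprn_ge0// ltW.
have Q2 : 0 <= 2 * C / c by rewrite divr_ge0 ?mulr_ge0// ltW.
have Q3 : 0 <= 4 * C * G ^+ 2 / c ^+ 3 by rewrite divr_ge0 ?mulr_ge0 ?exprn_ge0// ltW.
have := mulr_ge0 Q1 e0; have := mulr_ge0 Q2 (ltW mi); have := mulr_ge0 Q3 e0.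
have : 4 * G / c * m^-1 * (2 * G / c) = 4 * (2 * G ^+ 2 / c ^+ 2 * m^-1) by field; rewrite !gt_eqF.
have : 2 * C * (2 * (2 / c * eps + 4 * G ^+ 2 / c ^+ 3 * m^-1)) =
   4 * (2 * C / c * eps + 4 * C * G ^+ 2 / c ^+ 3 * m^-1) by field; rewrite !gt_eqF.
by move: P1 P2; lra.
Qed.

End Fine.

Section Coarse.
Variable N : nat.
Hypothesis N0 : (0 < N)%N.
Local Notation n := (N%:R : R).
Let n0 : 0 < n. Proof. by rewrite ltr0n. Qed.

Let tau0 : 0 < n^-1 / 2. Proof. by rewrite divr_gt0// invr_gt0. Qed.

Let nodeN (i : nat) : (i <= N)%N -> 0 <= i%:R / n <= 1.
Proof. by move=> iN; rewrite divr_ge0//= ler_pdivrMr// mul1r ler_nat. Qed.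

(** The flux difference is the mean of g over a cell. The symmetric mean value theorem for u^2
    replaces it by the mean of g at two points symmetric about the centre, which leaves a second
    difference of g. *)
Lemma coarse_r (i : nat) : (1 <= i <= N)%N ->
  exists2 s, 0 < s < n^-1 / 2 &
  g ((i%:R - 2^-1) / n) - n * (u (i%:R / n) ^+ 2 / 4 - u (i.-1%:R / n) ^+ 2 / 4)
  = - ((g ((i%:R - 2^-1) / n + s) + g ((i%:R - 2^-1) / n - s)
        - 2 * g ((i%:R - 2^-1) / n)) / 2).
Proof.
case: i => // i /andP[_ iN]; set y := (i.+1%:R - 2^-1) / n.
have E1 : i.+1%:R / n = y + n^-1 / 2 by rewrite /y; field; rewrite gt_eqF.
have E2 : i.+1.-1%:R / n = y - n^-1 / 2 by rewrite /y -natr1 /=; field; rewrite gt_eqF.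
have /andP[_ y1] := nodeN iN; have /andP[y0 _] := nodeN (ltnW iN).
rewrite E1 in y1; rewrite -[i]/(i.+1.-1) E2 in y0.
have cF : continuous (fun z => u z ^+ 2).
  by move=> z; apply: (@cvg_comp _ _ _ u (fun z => z ^+ 2) _ (nbhs (u z)));
    [exact: cu|exact: exprn_continuous].
have [s s1 E] := MVT_sym_sub tau0 y0 y1 cF dF.
exists s => //; rewrite E1 E2 -mulrBl E; field; by rewrite gt_eqF.
Qed.

Hypotheses (g00 : g 0 = 0) (g10 : g 1 = 0) (X00 : X 0 = 0) (X11 : X 1 = 1).

Let b (i : nat) : R := n * (ghost_extend N (fun i => X ((i%:R - 2^-1) / n)) i.+1
   - ghost_extend N (fun i => X ((i%:R - 2^-1) / n)) i).

(** At an interior interface the symmetry of the gap turns the error into 1 / n times an oscillation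
    of phi. At the two ends the reflected gap is a one-sided quotient, but g vanishes there, hence
    so does phi, and the error has the same form. *)
Lemma coarse_b (i : nat) : (i <= N)%N -> c <= b i <= C /\
  exists s1 s2, [/\ 0 <= s1 <= 1, 0 <= s2 <= 1,
    `|s1 - i%:R / n| <= n^-1 / 2, `|s2 - i%:R / n| <= n^-1 / 2 &
    `|b i - u (i%:R / n)| <= n^-1 * (2 / c * `|g s1 - g s2| + 4 * G ^+ 2 / c ^+ 3 * n^-1)].
Proof.
move=> iN.
have n1 : 1 <= n by rewrite ler1n.
have hn : n^-1 <= 1 by rewrite invf_le1.
have hn0 : 0 < n^-1 by rewrite invr_gt0.
have K1 : 0 <= 2 / c by rewrite divr_ge0// ltW.
have K2 : 0 <= 4 * G ^+ 2 / c ^+ 3 by rewrite divr_ge0 ?mulr_ge0 ?sqr_ge0 ?exprn_ge0// ltW.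
have [i0|i0] := posnP i.
  have bE : b i = 2 * n * X (n^-1 / 2).
    rewrite /b i0 /ghost_extend /= eqSS eq_sym gtn_eqF//.
    have -> : (1 - 2^-1) / n = n^-1 / 2 by field; rewrite gt_eqF.
    ring.
  have [|s s1 Es] := MVT01 (lexx 0) tau0 _ cX dX; first by move: hn; lra.
  have s0 : 0 < s by case/andP: s1.
  have [|q q1 Eq] := MVT01 (lexx 0) s0 _ cu du; first by move: s1 hn; lra.
  have bE2 : b i = u s.
    by rewrite bE -[X _]subr0 -X00 Es subr0; field; rewrite gt_eqF.
  split; first by rewrite bE2; apply: ub; move: s1 hn; lra.
  have E0 : i%:R / n = 0 by rewrite i0 mul0r.
  exists q, 0; rewrite E0 !subr0 normr0; split; rewrite ?lexx ?ler01 ?(ltW tau0)//.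
  - by move: q1 s1 hn; lra.
  - by rewrite gtr0_norm; move: q1 s1; lra.
  rewrite bE2 Eq subr0 -/(phi q) normrM mulrC (gtr0_norm s0).
  have q01 : 0 <= q <= 1 by move: q1 s1 hn; lra.
  have z01 : 0 <= (0 : R) <= 1 by rewrite lexx ler01.
  have := phi_osc q01 z01; rewrite {1 2}/phi g00 mulr0 mul0r subr0 subr0 => H.
  apply: ler_pM => //; [exact: ltW|by move: s1 hn0; lra|].
  apply: (le_trans H); rewrite subr0 lerD2l ler_wpM2l//.
  by rewrite gtr0_norm; move: q1 s1; lra.
have [iE|iN'] := eqVneq i N.
  have bE : b i = 2 * n * (X 1 - X (1 - n^-1 / 2)).
    rewrite /b iE /ghost_extend /= eqxx gtn_eqF// ltn_eqF// X11.
    have -> : (n - 2^-1) / n = 1 - n^-1 / 2 by field; rewrite gt_eqF.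
    by ring.
  have E1 : i%:R / n = 1 by rewrite iE mulfV// gt_eqF.
  have [| |s s1 Es] := MVT01 _ _ (lexx 1) cX dX (a := 1 - n^-1 / 2);
    [by move: hn; lra|by move: hn0; lra|].
  have [| |q q1 Eq] := MVT01 _ _ (lexx 1) cu du (a := s);
    [by move: s1 hn; lra|by move: s1; lra|].
  have bE2 : b i = u s.
    by rewrite bE Es; field; rewrite gt_eqF.
  split; first by rewrite bE2; apply: ub; move: s1 hn; lra.
  exists q, 1; rewrite E1 subrr normr0; split; rewrite ?lexx ?ler01 ?(ltW tau0)//.
  - by move: q1 s1 hn; lra.
  - by rewrite ler0_norm; move: q1 s1; lra.
  rewrite bE2 distrC Eq -/(phi q) normrM mulrC (@gtr0_norm _ (1 - s)); last by move: s1; lra.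
  have q01 : 0 <= q <= 1 by move: q1 s1 hn; lra.
  have z01 : 0 <= (1 : R) <= 1 by rewrite lexx ler01.
  have := phi_osc q01 z01; rewrite {1 2}/phi g10 mulr0 mul0r subr0 => H.
  apply: ler_pM => //; [by move: s1; lra|by move: s1 hn0; lra|].
  apply: (le_trans H); rewrite lerD2l ler_wpM2l//.
  by rewrite ler0_norm; move: q1 s1; lra.
have {iN'}iN' : (i < N)%N by rewrite ltn_neqAle iN'.
set y := i%:R / n.
have bE : b i = n * (X (y + n^-1 / 2) - X (y - n^-1 / 2)).
  have h1 : (i == 0%N) = false by rewrite gtn_eqF.
  have h2 : (i == N) = false by rewrite ltn_eqF.
  have h3 : (i == N.+1) = false by rewrite ltn_eqF// ltnW.
  rewrite /b /ghost_extend /= eqSS h1 h2 h3.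
  rewrite -natr1 /y; congr (n * (X _ - X _)); field; by rewrite gt_eqF.
have yy : n^-1 <= y <= 1 - n^-1.
  rewrite /y -[X in X <= _ <= _]mul1r ler_pM2r// ler1n i0/=.
  rewrite ler_pdivrMr// mulrBl mul1r mulVf ?gt_eqF// lerBrDr natr1.
  by rewrite ler_nat.
have y0 : 0 <= y - n^-1 / 2 by move: yy hn0; lra.
have y1 : y + n^-1 / 2 <= 1 by move: yy hn0; lra.
have [s s1 Es] := MVT_sym_sub tau0 y0 y1 cX dX.
have s0 : 0 < s by case/andP: s1.
have bE2 : b i = (u (y + s) + u (y - s)) / 2 by rewrite bE Es; field; rewrite gt_eqF.
split.
  have /ub : 0 <= y + s <= 1 by move: s1 y0 y1; lra.
  have /ub : 0 <= y - s <= 1 by move: s1 y0 y1; lra.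
  by rewrite bE2; lra.
have ys0 : 0 <= y - s by move: s1 y0; lra.
have ys1 : y + s <= 1 by move: s1 y1; lra.
have [q q1 Eq] := MVT_sym_add s0 ys0 ys1 cu du 0.
have q0 : 0 < q by case/andP: q1.
have p01 : 0 <= y + q <= 1 by move: q1 ys0 ys1; lra.
have p01' : 0 <= y - q <= 1 by move: q1 ys0 ys1; lra.
exists (y + q), (y - q); split => //.
- by rewrite addrAC subrr add0r gtr0_norm//; move: q1 s1; lra.
- by rewrite addrAC subrr add0r normrN gtr0_norm//; move: q1 s1; lra.
have -> : b i - u y = s / 2 * (phi (y + q) - phi (y - q)).
  have -> : b i - u y = (u (y + s) + u (y - s) - 2 * u y - s ^+ 2 * 0) / 2.
    by rewrite bE2; field.
  by rewrite Eq /phi; field; rewrite !gt_eqF//; exact: u0.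
rewrite normrM (@gtr0_norm _ (s / 2)) ?divr_gt0//.
apply: ler_pM => //; [by rewrite divr_ge0// ltW|by move: s1 hn0; lra|].
apply: (le_trans (phi_osc p01 p01')); rewrite lerD2l ler_wpM2l//.
have -> : y + q - (y - q) = 2 * q by ring.
by rewrite gtr0_norm; move: q1 s1; lra.
Qed.

Lemma coarse_delta (i : nat) : (i <= N)%N ->
  exists s1 s2, [/\ 0 <= s1 <= 1, 0 <= s2 <= 1,
    `|s1 - i%:R / n| <= n^-1 / 2, `|s2 - i%:R / n| <= n^-1 / 2 &
    (u (i%:R / n) ^+ 2 / 4 - b i ^+ 2 / 4) ^+ 2 <=
      (2 * C ^+ 2 / c ^+ 2 + 8 * C ^+ 2 * G ^+ 4 / c ^+ 6) *
        (n ^- 2 * ((g s1 - g s2) ^+ 2 + n ^- 2))].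
Proof.
move=> iN; have [/andP[b1 b2] [s1 [s2 [h1 h2 h3 h4 h5]]]] := coarse_b iN.
exists s1, s2; split => //.
have /andP[u1 u2] := ub (nodeN iN).
move: h5; set q := u _; set d := g s1 - g s2; set w := b i => h5.
have -> : (q ^+ 2 / 4 - w ^+ 2 / 4) ^+ 2 = ((q + w) / 4) ^+ 2 * (w - q) ^+ 2 by field.
have H1 : ((q + w) / 4) ^+ 2 <= C ^+ 2 / 4.
  have -> : C ^+ 2 / 4 = (C / 2) ^+ 2 by field.
  by rewrite ler_sqr ?nnegrE; move: u1 u2 b1 b2 c0; rewrite -/q -/w; lra.
have H2 : (w - q) ^+ 2 <= n ^- 2 * (8 / c ^+ 2 * d ^+ 2 + 32 * G ^+ 4 / c ^+ 6 * n ^- 2).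
  rewrite -(real_normK (num_real (w - q))) -(real_normK (num_real d)).
  apply: (@le_trans _ _ ((n^-1 * (2 / c * `|d| + 4 * G ^+ 2 / c ^+ 3 / n)) ^+ 2)).
    by rewrite ler_sqr ?nnegrE// (le_trans _ h5).
  rewrite -subr_ge0.
  have -> : n ^- 2 * (8 / c ^+ 2 * `|d| ^+ 2 + 32 * G ^+ 4 / c ^+ 6 * n ^- 2) -
    (n^-1 * (2 / c * `|d| + 4 * G ^+ 2 / c ^+ 3 / n)) ^+ 2 =
    (n^-1 * (2 / c * `|d| - 4 * G ^+ 2 / c ^+ 3 / n)) ^+ 2.
    by field; rewrite !gt_eqF.
  exact: sqr_ge0.
apply: (le_trans (ler_pM (sqr_ge0 _) (sqr_ge0 _) H1 H2)).
have C0 : 0 <= C by move: u1 u2 c0; lra.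
have K1 : 0 <= 2 * C ^+ 2 / c ^+ 2 by rewrite divr_ge0 ?mulr_ge0 ?exprn_ge0// ltW.
have K2 : 0 <= 8 * C ^+ 2 * G ^+ 4 / c ^+ 6.
  by rewrite divr_ge0 ?mulr_ge0 ?sqr_ge0 ?exprn_ge0// ltW.
have i2 : 0 <= n ^- 2 by rewrite invr_ge0 exprn_ge0.
have -> : C ^+ 2 / 4 * (n ^- 2 * (8 / c ^+ 2 * d ^+ 2 + 32 * G ^+ 4 / c ^+ 6 / n ^+ 2)) =
  n ^- 2 * (2 * C ^+ 2 / c ^+ 2 * d ^+ 2 + 8 * C ^+ 2 * G ^+ 4 / c ^+ 6 * n ^- 2).
  by field; rewrite !gt_eqF.
rewrite [leRHS]mulrCA ler_wpM2l//.
have := mulr_ge0 K1 i2; have := mulr_ge0 K2 (sqr_ge0 d); lra.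
Qed.

End Coarse.

End Consistency.

(** * Evolution of the discrete energies *)

Section TimeDerivatives.
Context {R : realType}.

Lemma is_derive_sum_nat (a b : nat) (F : R -> nat -> R) (dF : nat -> R) (t : R) :
  (forall j, (a <= j < b)%N -> is_derive t (1 : R) (F ^~ j) (dF j)) ->
  is_derive t (1 : R) (fun r => \sum_(a <= j < b) F r j) (\sum_(a <= j < b) dF j).
Proof.
move=> H; have [ba|ab] := leqP b a.
  rewrite big_geq//; have -> : (fun r => \sum_(a <= j < b) F r j) = (fun=> 0).
    by apply/funext => r; rewrite big_geq.
  exact: is_derive_cst.
have {ab}[k kE] : exists k, b = (a + k)%N by exists (b - a)%N; rewrite subnKC// ltnW.
rewrite {}kE in H *; elim: k H => [|k IH] H.
  rewrite addn0 big_geq//; have -> : (fun r => \sum_(a <= j < a) F r j) = (fun=> 0).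
    by apply/funext => r; rewrite big_geq.
  exact: is_derive_cst.
rewrite addnS big_nat_recr ?leq_addr//=.
have -> : (fun r => \sum_(a <= j < (a + k).+1) F r j) =
   (fun r => \sum_(a <= j < a + k) F r j + F r (a + k)%N).
  by apply/funext => r; rewrite big_nat_recr ?leq_addr.
apply: is_deriveD.
  by apply: IH => j /andP[aj jk]; apply: H; rewrite aj addnS ltnS ltnW.
by apply: H; rewrite leq_addr addnS ltnS leqnn.
Qed.

Lemma continuous_sum_nat (a b : nat) (F : R -> nat -> R) :
  (forall j, (a <= j < b)%N -> continuous (F ^~ j)) ->
  continuous (fun r => \sum_(a <= j < b) F r j).
Proof.
move=> H; have [ba|ab] := leqP b a.
  have -> : (fun r => \sum_(a <= j < b) F r j) = (fun=> 0).
    by apply/funext => r; rewrite big_geq.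
  by move=> ?; exact: cvg_cst.
have {ab}[k kE] : exists k, b = (a + k)%N by exists (b - a)%N; rewrite subnKC// ltnW.
rewrite {}kE in H *; elim: k H => [|k IH] H.
  have -> : (fun r => \sum_(a <= j < a + 0) F r j) = (fun=> 0).
    by apply/funext => r; rewrite addn0 big_geq.
  by move=> ?; exact: cvg_cst.
have -> : (fun r => \sum_(a <= j < a + k.+1) F r j) =
   (fun r => \sum_(a <= j < a + k) F r j + F r (a + k)%N).
  by apply/funext => r; rewrite addnS big_nat_recr ?leq_addr.
move=> r; apply: cvgD.
  by apply: IH => j /andP[aj jk]; apply: H; rewrite aj addnS ltnS ltnW.
by apply: H; rewrite leq_addr addnS ltnS leqnn.
Qed.

(** Integrating factor. Both signs of a occur: a > 0 for the decay of the error, a < 0 for the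
    growth over a short initial time. *)
Lemma gronwall (f df : R -> R) (a b T : R) : 0 <= T -> a != 0 -> continuous f ->
  (forall t, 0 < t < T -> is_derive t (1 : R) f (df t)) ->
  (forall t, 0 < t < T -> df t <= - a * f t + b) ->
  f T <= expR (- a * T) * f 0 + b / a * (1 - expR (- a * T)).
Proof.
move=> T0 a0 cf dff dfle.
pose h t := expR (a * t) * (f t - b / a).
have dh t : 0 < t < T -> is_derive t (1 : R) h (expR (a * t) * (a * f t - b + df t)).
  move=> tT.
  have de : is_derive t (1 : R) (fun t => expR (a * t)) (expR (a * t) * a).
    exact: (@is_derive1_comp R expR (fun t => a * t) t _ _ (is_derive_expR _) (is_derive_scale a t)).
  have df' : is_derive t (1 : R) (fun t => f t - b / a) (df t).
    by rewrite -[df t]subr0; exact: is_deriveB (dff _ tT) (is_derive_cst (b / a) t (1 : R)).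
  have := is_deriveM de df'.
  suff -> : expR (a * t) *: df t + (f t - b / a) *: (expR (a * t) * a) =
    expR (a * t) * (a * f t - b + df t) by [].
  by rewrite /GRing.scale /=; field.
have ch : continuous h.
  move=> t; apply: cvgM.
    apply: (@cvg_comp _ _ _ (fun t => a * t) expR _ (nbhs (a * t))); last exact: continuous_expR.
    by apply: cvgM; [exact: cvg_cst|exact: cvg_id].
  by apply: cvgB; [exact: cf|exact: cvg_cst].
have hT : h T <= h 0.
  move: T0; rewrite le_eqVlt => /predU1P[<-//|T0].
  have dh' z : z \in `]0, T[%R -> is_derive z (1 : R) h (expR (a * z) * (a * f z - b + df z)).
    by rewrite in_itv/=; exact: dh.
  have [z] := MVT T0 dh' (continuous_subspaceT ch).
  rewrite in_itv/= => zT E; rewrite -subr_le0 E subr0 mulr_le0_ge0 ?(ltW T0)//.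
  rewrite mulr_ge0_le0 ?expR_ge0//; have := dfle _ zT; lra.
move: hT; rewrite /h mulr0 expR0 mul1r -(ler_pM2l (expR_gt0 (- a * T))) mulrA -expRD.
by rewrite mulNr addNr expR0 mul1r; lra.
Qed.

End TimeDerivatives.

Section FineFlow.
Context {R : realType}.
Variables (X u g : R -> R -> R) (c C G : R).
Hypotheses (flowX : classical_flow X u g) (c0 : 0 < c) (C0 : 0 < C) (G0 : 0 <= G).
Hypothesis slope0 : forall y : R, 0 < y < 1 -> c <= u 0 y <= C.
Hypothesis g0 : forall y : R, 0 < y < 1 -> `|g 0 y| <= G.

Variables (M : nat) (eps T1 : R).
Hypotheses (M0 : (0 < M)%N) (eps0 : 0 <= eps).
Local Notation m := (M%:R : R).
Local Notation node j := (j%:R / m).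

Definition slope (A : R -> R) (j : nat) : R := m * (A (node j.+1) - A (node j)).

Hypothesis kappa_le : forall t (j : nat), 0 <= t <= T1 -> (0 < j < M)%N ->
  `|g t (node j) - m / 4 * (slope (X t) j ^+ 2 - slope (X t) j.-1 ^+ 2)| <= eps.

Definition mean_slope (A B : R -> R) j := (slope A j + slope B j) / 2.
Definition dslope (A B : R -> R) j := slope A j - slope B j.
(** For A = X (t + s) and B = X t, division by m s^2 makes the four sums discrete versions of the
    integrals of u (g')^2, g^2, ((u g')' / 2)^2 and (g'')^2. *)
Definition fineQ (A B : R -> R) := \sum_(0 <= j < M) mean_slope A B j * dslope A B j ^+ 2.
Definition fineW (A B : R -> R) := \sum_(0 <= j < M) (A (node j) - B (node j)) ^+ 2.
Definition fineY (A B : R -> R) := \sum_(0 <= j < M)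
  (m / 2 * (mean_slope A B j * dslope A B j - mean_slope A B j.-1 * dslope A B j.-1)) ^+ 2.
Definition fineZ (A B : R -> R) := \sum_(0 <= j < M)
  (m * (dslope A B j - dslope A B j.-1)) ^+ 2.

(** Coefficient of the energy in [fine_Q_le], with the bound B = 4 G / c of [slope_second]. *)
Definition rate : R := 6 * (G ^+ 2 / c ^+ 2 + G * (4 * G / c) / (2 * c)) / c.

Let node01 (j : nat) : (j <= M)%N -> 0 <= node j <= 1.
Proof. by move=> jM; rewrite divr_ge0//= ler_pdivrMr ?ltr0n// mul1r ler_nat. Qed.

Let ub t (y : R) : 0 <= t -> 0 <= y <= 1 -> c <= u t y <= C.
Proof. by move=> t0 y01; exact: (flow_u_bounds flowX c0 C0 slope0). Qed.

Let gb t (y : R) : 0 <= t -> 0 <= y <= 1 -> `|g t y| <= G.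
Proof. by move=> t0 y01; exact: (flow_g_bound flowX c0 C0 G0 slope0 g0). Qed.

Lemma slope_bounds (t : R) j : 0 <= t -> (j < M)%N -> c <= slope (X t) j <= C.
Proof.
move=> t0 jM; apply: (@fine_slope R (X t) (u t)) => //.
- exact: (flow_cXy flowX).
- by move=> y y01; exact: (flow_dy flowX).
- by move=> y; exact: ub.
Qed.

Lemma slope_second (t : R) j : 0 <= t -> (j < M)%N ->
  `|m * (slope (X t) j - slope (X t) j.-1)| <= 4 * G / c.
Proof.
move=> t0 jM; apply: (@fine_second R (X t) (u t) (g t) c C G) => //.
- exact: (flow_cXy flowX).
- exact: (flow_cuy flowX).
- by move=> y y01; exact: (flow_dy flowX).
- by move=> y y01; exact: (flow_du flowX c0 C0 slope0).
- by move=> y; exact: ub.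
- by move=> y; exact: gb.
Qed.

Section TwoTimes.
Variables (ta tb : R).
Hypotheses (ta0 : 0 <= ta <= T1) (tb0 : 0 <= tb <= T1).
Local Notation A := (X ta).
Local Notation B := (X tb).

Let ta1 : 0 <= ta. Proof. by case/andP: ta0. Qed.
Let tb1 : 0 <= tb. Proof. by case/andP: tb0. Qed.

Lemma mean_slope_ge j : (j < M)%N -> c <= mean_slope A B j <= C.
Proof.
move=> jM; have := slope_bounds ta1 jM; have := slope_bounds tb1 jM.
by rewrite /mean_slope; lra.
Qed.

Lemma mean_slope_diff j : (j < M)%N ->
  `|m * (mean_slope A B j - mean_slope A B j.-1)| <= 4 * G / c.
Proof.
move=> jM; have := slope_second ta1 jM; have := slope_second tb1 jM.
have -> : m * (mean_slope A B j - mean_slope A B j.-1) =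
  (m * (slope A j - slope A j.-1) + m * (slope B j - slope B j.-1)) / 2.
  by rewrite /mean_slope; field.
rewrite !ler_norml; lra.
Qed.

(** Bt is the velocity actually given to the second profile: g tb if it moves with the flow, 0 if it
    is frozen; the source g tb - Bt makes up for the discrepancy. The consistency errors of the two
    profiles add up to 2 eps, whence 16 = 4 * 2^2. *)
Lemma fineQ_derive_le (Bt pt wt : nat -> R) : (forall j, (j <= M)%N -> `|Bt j| <= G) ->
  Bt 0%N = 0 -> Bt M = 0 ->
  (forall j, pt j = (g ta (node j) + Bt j) / 2) ->
  (forall j, wt j = g ta (node j) - Bt j) ->
  \sum_(0 <= j < M) (m * (pt j.+1 - pt j) * dslope A B j ^+ 2 +
     2 * mean_slope A B j * dslope A B j * (m * (wt j.+1 - wt j))) <=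
  - 2 * fineY A B + rate * fineQ A B + 16 * m * eps ^+ 2
  + 2 * m * \sum_(0 <= j < M) (g tb (node j.+1) - Bt j.+1 - (g tb (node j) - Bt j)) *
      (mean_slope A B j * dslope A B j).
Proof.
move=> BtG Bt0 BtM ptE wtE.
have gn0 t : 0 <= t -> g t (node 0%N) = 0.
  by move=> t0; rewrite mul0r (flow_g_bnd flowX t0).1.
have gnM t : 0 <= t -> g t (node M) = 0.
  by move=> t0; rewrite mulfV ?pnatr_eq0 -?lt0n// (flow_g_bnd flowX t0).2.
have K0 : 0 <= 4 * G / c by rewrite divr_ge0 ?mulr_ge0// ltW.
pose kap j := (g ta (node j) - m / 4 * (slope A j ^+ 2 - slope A j.-1 ^+ 2))
  - (g tb (node j) - m / 4 * (slope B j ^+ 2 - slope B j.-1 ^+ 2)).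
have -> : 16 * m * eps ^+ 2 = 4 * m * (2 * eps) ^+ 2 by ring.
apply: (@fine_Q_le R M c G (4 * G / c) (2 * eps) _ _ pt wt kap
   (fun j => g tb (node j) - Bt j)) => //.
- by move=> j /mean_slope_ge/andP[].
- exact: mean_slope_diff.
- move=> j /ltnW jM; rewrite ptE normrM (@ger0_norm _ 2^-1)// ler_pdivrMr//.
  apply: (le_trans (ler_normD _ _)).
  by have := gb ta1 (node01 jM); have := BtG _ jM; lra.
- by rewrite mulr_ge0.
- move=> j jM; apply: (le_trans (ler_normB _ _)).
  by have := kappa_le ta0 jM; have := kappa_le tb0 jM; lra.
- by move=> j jM; rewrite wtE /kap /mean_slope /dslope; field.
- by rewrite ptE gn0// Bt0 addr0 mul0r.
- by rewrite ptE gnM// BtM addr0 mul0r.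
- by rewrite wtE gn0// Bt0 subr0.
- by rewrite wtE gnM// BtM subr0.
- by rewrite gn0// Bt0 subr0.
- by rewrite gnM// BtM subr0.
Qed.

Lemma fineZ_le : fineZ A B <= 8 / c ^+ 2 * fineY A B +
  3 * (4 * G / c) ^+ 2 / c ^+ 3 * fineQ A B.
Proof.
apply: fine_Z_le => //.
- by move=> j /mean_slope_ge/andP[].
- exact: mean_slope_diff.
Qed.

Lemma fine_dslope_le : c * \sum_(0 <= j < M) dslope A B j ^+ 2 <= fineQ A B.
Proof.
rewrite mulr_sumr ler_sum_nat// => j /= /mean_slope_ge/andP[+ _].
by move=> h; rewrite ler_wpM2r ?sqr_ge0.
Qed.

Lemma fineW_le : c * fineW A B <= fineQ A B.
Proof.
apply: (@fine_poincare R M c _ _ (fun j => A (node j) - B (node j))) => //.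
- by move=> j /mean_slope_ge/andP[].
- by rewrite mul0r !(flow_0 flowX)// subrr.
- by move=> j; rewrite /dslope /slope; ring.
Qed.

Lemma fineW_derive_le :
  \sum_(0 <= j < M) 2 * (A (node j) - B (node j)) * (g ta (node j) - g tb (node j)) <=
  - fineQ A B + 4 * eps * \sum_(0 <= j < M) `|A (node j) - B (node j)|.
Proof.
pose kap j := (g ta (node j) - m / 4 * (slope A j ^+ 2 - slope A j.-1 ^+ 2))
  - (g tb (node j) - m / 4 * (slope B j ^+ 2 - slope B j.-1 ^+ 2)).
have -> : 4 * eps = 2 * (2 * eps) by ring.
apply: (@fine_W_eq R M (2 * eps) (mean_slope A B) (dslope A B)
  (fun j => g ta (node j) - g tb (node j)) (fun j => A (node j) - B (node j)) kap (fun=> 0)) => //.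
- move=> j jM; apply: (le_trans (ler_normB _ _)).
  by have := kappa_le ta0 jM; have := kappa_le tb0 jM; lra.
- by move=> j jM; rewrite /kap /mean_slope /dslope; field.
- by rewrite mul0r !(flow_0 flowX)// subrr.
- by rewrite mulfV ?pnatr_eq0 -?lt0n// !(flow_1 flowX)// subrr.
- by move=> j; rewrite /dslope /slope; ring.
Qed.

End TwoTimes.

Let is_derive_slope (A : R -> R -> R) (dA : nat -> R) (t : R) j : (j < M)%N ->
  (forall i, (i <= M)%N -> is_derive t (1 : R) (A ^~ (node i)) (dA i)) ->
  is_derive t (1 : R) (fun r => slope (A r) j) (m * (dA j.+1 - dA j)).
Proof.
move=> jM dAE; rewrite /slope.
exact: (@is_deriveZ _ _ _ _ m _ _ _ (is_deriveB (dAE _ jM) (dAE _ (ltnW jM)))).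
Qed.

Lemma is_derive_sqr (f : R -> R) (df t : R) : is_derive t (1 : R) f df ->
  is_derive t (1 : R) (fun r => f r ^+ 2) (2 * f t * df).
Proof.
move=> dff; have := is_deriveM dff dff.
suff -> : f t *: df + f t *: df = 2 * f t * df by [].
by rewrite /GRing.scale /=; ring.
Qed.

Lemma is_derive_fineQ (A B : R -> R -> R) (dA dB : nat -> R) (t : R) :
  (forall j, (j <= M)%N -> is_derive t (1 : R) (A ^~ (node j)) (dA j)) ->
  (forall j, (j <= M)%N -> is_derive t (1 : R) (B ^~ (node j)) (dB j)) ->
  is_derive t (1 : R) (fun r => fineQ (A r) (B r))
   (\sum_(0 <= j < M) (m * ((dA j.+1 + dB j.+1) / 2 - (dA j + dB j) / 2) * dslope (A t) (B t) j ^+ 2 +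
     2 * mean_slope (A t) (B t) j * dslope (A t) (B t) j *
       (m * ((dA j.+1 - dB j.+1) - (dA j - dB j))))).
Proof.
move=> dAE dBE; apply: is_derive_sum_nat => j /andP[_ jM].
have a1 := is_derive_slope jM dAE; have b1 := is_derive_slope jM dBE.
have p1 : is_derive t (1 : R) (fun r => mean_slope (A r) (B r) j)
    (m * ((dA j.+1 + dB j.+1) / 2 - (dA j + dB j) / 2)).
  have := @is_deriveZ _ _ _ _ 2^-1 _ _ _ (is_deriveD a1 b1).
  have -> : 2^-1 *: (m * (dA j.+1 - dA j) + m * (dB j.+1 - dB j)) =
    m * ((dA j.+1 + dB j.+1) / 2 - (dA j + dB j) / 2).
    by rewrite /GRing.scale /=; field.
  by congr (is_derive _ _ _ _); apply/funext => r; rewrite /mean_slope mulrC.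
have w1 : is_derive t (1 : R) (fun r => dslope (A r) (B r) j)
    (m * (dA j.+1 - dB j.+1 - (dA j - dB j))).
  have := is_deriveB a1 b1.
  by have -> : m * (dA j.+1 - dA j) - m * (dB j.+1 - dB j) =
    m * (dA j.+1 - dB j.+1 - (dA j - dB j)) by ring.
have := is_deriveM p1 (is_derive_sqr w1).
suff -> : mean_slope (A t) (B t) j *: (2 * dslope (A t) (B t) j * (m * (dA j.+1 - dB j.+1 - (dA j - dB j)))) +
   dslope (A t) (B t) j ^+ 2 *: (m * ((dA j.+1 + dB j.+1) / 2 - (dA j + dB j) / 2)) =
   m * ((dA j.+1 + dB j.+1) / 2 - (dA j + dB j) / 2) * dslope (A t) (B t) j ^+ 2 +
     2 * mean_slope (A t) (B t) j * dslope (A t) (B t) j *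
       (m * ((dA j.+1 - dB j.+1) - (dA j - dB j))) by [].
by rewrite /GRing.scale /=; ring.
Qed.

Lemma is_derive_fineW (A B : R -> R -> R) (dA dB : nat -> R) (t : R) :
  (forall j, (j <= M)%N -> is_derive t (1 : R) (A ^~ (node j)) (dA j)) ->
  (forall j, (j <= M)%N -> is_derive t (1 : R) (B ^~ (node j)) (dB j)) ->
  is_derive t (1 : R) (fun r => fineW (A r) (B r))
   (\sum_(0 <= j < M) 2 * (A t (node j) - B t (node j)) * (dA j - dB j)).
Proof.
move=> dAE dBE; apply: is_derive_sum_nat => j /andP[_ /ltnW jM].
exact: is_derive_sqr (is_deriveB (dAE _ jM) (dBE _ jM)).
Qed.

Lemma continuous_fineQ (A B : R -> R -> R) : (forall y, continuous (A ^~ y)) ->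
  (forall y, continuous (B ^~ y)) -> continuous (fun r => fineQ (A r) (B r)).
Proof.
move=> cA cB; apply: continuous_sum_nat => j _.
have cs (D : R -> R -> R) : (forall y, continuous (D ^~ y)) -> continuous (fun r => slope (D r) j).
  by move=> cD r; apply: cvgM; [exact: cvg_cst|apply: cvgB; exact: cD].
move=> r; apply: cvgM.
  by apply: cvgM; [apply: cvgD; exact: cs|exact: cvg_cst].
by apply: cvgM; apply: cvgB; exact: cs.
Qed.

Lemma continuous_fineW (A B : R -> R -> R) : (forall y, continuous (A ^~ y)) ->
  (forall y, continuous (B ^~ y)) -> continuous (fun r => fineW (A r) (B r)).
Proof.
move=> cA cB; apply: continuous_sum_nat => j _ r.
by apply: cvgM; apply: cvgB; [exact: cA|exact: cB|exact: cA|exact: cB].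
Qed.

Lemma rate_ge0 : 0 <= rate.
Proof.
have := ltW c0 => c0'; rewrite /rate.
have h1 : 0 <= G ^+ 2 / c ^+ 2 by apply: divr_ge0; exact: exprn_ge0.
have h2 : 0 <= 4 * G / c by apply: divr_ge0 => //; exact: mulr_ge0.
have h3 : 0 <= G * (4 * G / c) / (2 * c) by apply: divr_ge0; exact: mulr_ge0.
by apply: divr_ge0 => //; apply: mulr_ge0 => //; exact: addr_ge0.
Qed.

Variable l : R.
Hypotheses (l0 : 0 <= l) (glip : forall y z : R, 0 <= y <= 1 -> 0 <= z <= 1 ->
  `|g 0 y - g 0 z| <= l * `|y - z|).

Lemma fineQ_init (s : R) : 0 < s <= 1 -> s <= T1 -> eps <= s ->
  fineQ (X s) (X 0) <= m * (expR (rate + 1) * (16 + C * l ^+ 2) * s ^+ 2).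
Proof.
move=> /andP[s0 s1] sT es.
have m0 : 0 < m by rewrite ltr0n.
have cX0 y : continuous ((fun=> X 0) ^~ y : R -> R) by move=> ?; exact: cvg_cst.
have k0 : 0 < rate + s^-1 by rewrite ltr_wpDl ?invr_gt0// rate_ge0.
pose df (t : R) := \sum_(0 <= j < M) (m * ((g t (node j.+1) + 0) / 2 - (g t (node j) + 0) / 2) * dslope (X t) (X 0) j ^+ 2 +
     2 * mean_slope (X t) (X 0) j * dslope (X t) (X 0) j *
       (m * ((g t (node j.+1) - 0) - (g t (node j) - 0)))).
(* Young's inequality with weight s absorbs the source at the price of the extra rate 1 / s, which
   over a time s costs only a factor exp 1. *)
have := @gronwall R (fun t => fineQ (X t) (X 0)) df (- (rate + s^-1))
  (m * (16 * eps ^+ 2 + C * l ^+ 2 * s)) s (ltW s0).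
rewrite oppr_eq0 gt_eqF// => /(_ isT) H.
have {}H := H (continuous_fineQ (flow_cXt flowX) cX0).
apply: le_trans (H _ _) _.
- move=> {H} t /andP[t0 _]; apply: is_derive_fineQ => j jM.
    exact: (flow_dt flowX t0 (node01 jM)).
  exact: is_derive_cst.
- move=> {H} t /andP[t0 ts].
  have tT : 0 <= t <= T1 by rewrite ltW//= (le_trans (ltW ts)).
  have oT : 0 <= (0 : R) <= T1 by rewrite lexx/= (le_trans (ltW s0)).
  have H1 := @fineQ_derive_le t 0 tT oT (fun=> 0) (fun j => (g t (node j) + 0) / 2)
     (fun j => g t (node j) - 0) (fun _ _ => _) erefl erefl (fun=> erefl) (fun=> erefl).
  apply: (le_trans (H1 _)) => {H1}; first by rewrite normr0.
  have Y0 : 0 <= fineY (X t) (X 0) by apply: sumr_ge0 => j _; exact: sqr_ge0.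
  suff : 2 * m * (\sum_(0 <= j < M) (g 0 (node j.+1) - 0 - (g 0 (node j) - 0)) *
      (mean_slope (X t) (X 0) j * dslope (X t) (X 0) j)) <=
      m * (C * l ^+ 2 * s) + s^-1 * fineQ (X t) (X 0) by move: Y0; rewrite opprK; lra.
  have -> : m * (C * l ^+ 2 * s) = \sum_(0 <= j < M) C * l ^+ 2 * s.
    by rewrite big_const_nat iter_addr addr0 subn0 -[RHS]mulr_natl.
  rewrite !mulr_sumr -big_split ler_sum_nat// => j /= jM.
  have /andP[p1 p2] := mean_slope_ge tT oT jM.
  have gl := glip (node01 jM) (node01 (ltnW jM)).
  have nn : node j.+1 - node j = m^-1 by rewrite -mulrBl -natr1 addrAC subrr add0r mul1r.
  rewrite nn (@gtr0_norm _ m^-1) ?invr_gt0// in gl.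
  rewrite !subr0.
  move: (mean_slope _ _ _) (dslope _ _ _) p1 p2 => p w p1 p2.
  have p0 : 0 <= p by move: p1 c0; lra.
  apply: (@le_trans _ _ (p * (2 * l * `|w|))).
    apply: (le_trans (ler_norm _)); rewrite !normrM (ger0_norm p0) (@ger0_norm _ 2)// (gtr0_norm m0).
    have -> : 2 * m * (`|g 0 (node j.+1) - g 0 (node j)| * (p * `|w|)) =
      (m * `|g 0 (node j.+1) - g 0 (node j)|) * (2 * p * `|w|) by ring.
    have -> : p * (2 * l * `|w|) = l * (2 * p * `|w|) by ring.
    rewrite ler_wpM2r ?mulr_ge0//.
    by rewrite mulrC -ler_pdivlMr.
  apply: (@le_trans _ _ (p * (l ^+ 2 * s + s^-1 * w ^+ 2))).
    rewrite ler_wpM2l// -subr_ge0 -(real_normK (num_real w)).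
    have -> : l ^+ 2 * s + s^-1 * `|w| ^+ 2 - 2 * l * `|w| = s * (l - s^-1 * `|w|) ^+ 2.
      by field; rewrite gt_eqF.
    by rewrite mulr_ge0 ?sqr_ge0// ltW.
  rewrite mulrDr; apply: lerD; last by rewrite mulrCA.
  by rewrite -mulrA ler_wpM2r// mulr_ge0 ?sqr_ge0// ltW.
move: H => _.
have -> : fineQ (X 0) (X 0) = 0.
  by rewrite /fineQ big1_seq// => j _; rewrite /dslope subrr expr0n mulr0.
rewrite mulr0 add0r opprK.
have E1 : (rate + s^-1) * s <= rate + 1.
  by rewrite mulrDl mulVf ?gt_eqF// lerD2r ler_piMr// rate_ge0.
have E2 : expR ((rate + s^-1) * s) <= expR (rate + 1) by rewrite ler_expR.
have E3 : (rate + s^-1)^-1 <= s.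
  by rewrite -[leRHS]invrK lef_pV2 ?posrE ?invr_gt0// lerDr rate_ge0.
have b0 : 0 <= m * (16 * eps ^+ 2 + C * l ^+ 2 * s).
  by rewrite mulr_ge0// ?addr_ge0// !mulr_ge0 ?sqr_ge0// ltW.
have -> : m * (16 * eps ^+ 2 + C * l ^+ 2 * s) / - (rate + s^-1) * (1 - expR ((rate + s^-1) * s)) =
  m * (16 * eps ^+ 2 + C * l ^+ 2 * s) * ((rate + s^-1)^-1 * (expR ((rate + s^-1) * s) - 1)).
  by field; rewrite !gt_eqF//= (_ : rate * s + 1 = (rate + s^-1) * s) ?mulr_gt0// mulrDl mulVf ?gt_eqF.
have E4 : (rate + s^-1)^-1 * (expR ((rate + s^-1) * s) - 1) <= s * expR (rate + 1).
  apply: ler_pM => //; first by rewrite invr_ge0 ltW.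
    by rewrite subr_ge0 -expR0 ler_expR mulr_ge0// ltW.
  by move: E2; lra.
apply: (le_trans (ler_wpM2l b0 E4)).
have -> : m * (16 * eps ^+ 2 + C * l ^+ 2 * s) * (s * expR (rate + 1)) =
  m * (expR (rate + 1) * ((16 * eps ^+ 2 + C * l ^+ 2 * s) * s)) by ring.
rewrite ler_pM2l// -[leRHS]mulrA ler_wpM2l ?expR_ge0//.
have : eps ^+ 2 * s <= s ^+ 2.
  apply: (@le_trans _ _ (s ^+ 2 * 1)); last by rewrite mulr1.
  apply: ler_pM => //; rewrite ?sqr_ge0 ?(ltW s0)// ler_sqr ?nnegrE//; exact: ltW.
by lra.
Qed.

End FineFlow.

(** * From fine grid differences to the consistency defects at the N points *)

Section GridDifferences.
Context {R : realType}.
Variables (W om : nat -> R) (m : R).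
Hypotheses (m0 : 0 < m) (omE : forall j, om j = m * (W j.+1 - W j)).

(** Enlarging the step from j to j + 1 adds a difference of om between the two ends, which
    telescopes into unit second differences. The sum is always bounded by the one over the whole
    window of radius k. *)
Lemma second_difference_le (a k j : nat) : (j <= k)%N ->
  `|W (a + k + j)%N + W (a + k - j)%N - 2 * W (a + k)%N| <=
  j%:R / m ^+ 2 * \sum_(a <= i < a + k + k) `|m * (om i - om i.-1)|.
Proof.
elim: j => [|j IH] jk.
  rewrite addn0 subn0 mul0r mul0r; have -> : W (a + k)%N + W (a + k)%N - 2 * W (a + k)%N = 0 by ring.
  by rewrite normr0.
have {IH} := IH (ltnW jk).
set S := \sum_(_ <= _ < _) _ => IH.
have -> : W (a + k + j.+1)%N + W (a + k - j.+1)%N - 2 * W (a + k)%N =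
   (W (a + k + j)%N + W (a + k - j)%N - 2 * W (a + k)%N) +
   m^-1 * (om (a + k + j)%N - om (a + k - j).-1).
  have -> : (a + k - j).-1 = (a + k - j.+1)%N by rewrite subnS.
  rewrite !omE; have -> : (a + k - j.+1).+1 = (a + k - j)%N.
    by rewrite -subSn ?subSS// (leq_trans jk)// leq_addl.
  by rewrite addnS; field; rewrite gt_eqF.
apply: (le_trans (ler_normD _ _)).
have -> : j.+1%:R / m ^+ 2 * S = j%:R / m ^+ 2 * S + m ^- 2 * S by rewrite -natr1; ring.
apply: lerD => //.
have jak : (j < a + k)%N by rewrite (leq_trans jk)// leq_addl.
have -> : m^-1 * (om (a + k + j)%N - om (a + k - j).-1) =
   m ^- 2 * \sum_(a + k - j <= i < (a + k + j).+1) m * (om i - om i.-1).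
  rewrite -mulr_sumr.
  have -> : \sum_(a + k - j <= i < (a + k + j).+1) (om i - om i.-1) =
     om (a + k + j)%N - om (a + k - j).-1.
    have := @telescope_sumr R (a + k - j) (a + k + j).+1 (fun i => om i.-1).
    by move=> -> //; rewrite (leq_trans (leq_subr _ _))// ltnW// ltnS leq_addr.
  by field; rewrite gt_eqF.
rewrite normrM gtr0_norm ?invr_gt0 ?exprn_gt0// ler_wpM2l ?invr_ge0 ?exprn_ge0 ?(ltW m0)//.
apply: (le_trans (ler_norm_sum _ _ _)).
have h1 : (a <= a + k - j)%N by rewrite -addnBA ?leq_addr// ltnW.
have h2 : (a + k - j <= (a + k + j).+1)%N by rewrite (leq_trans (leq_subr _ _))// ltnW// ltnS leq_addr.
have h3 : ((a + k + j).+1 <= a + k + k)%N by rewrite -addnS leq_add2l.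
rewrite /S [leRHS](@big_cat_nat _ _ _ (a + k - j))//=; last exact: leq_trans h3.
rewrite [X in _ <= _ + X](@big_cat_nat _ _ _ (a + k + j).+1)//=.
have s0 (p q : nat) : 0 <= \sum_(p <= i < q) `|m * (om i - om i.-1)| by apply: sumr_ge0.
by have := s0 a (a + k - j)%N; have := s0 (a + k + j).+1 (a + k + k)%N; lra.
Qed.

Lemma difference_le (a b i j : nat) : (a <= i <= b)%N -> (a <= j <= b)%N ->
  `|W i - W j| <= m^-1 * \sum_(a <= q < b) `|om q|.
Proof.
wlog ij : i j / (j <= i)%N.
  move=> H; have [ij|ij] := leqP j i; first exact: H.
  by move=> hi hj; rewrite distrC; apply: H => //; exact: ltnW.
move=> /andP[ai ib] /andP[aj jb].
have -> : W i - W j = m^-1 * \sum_(j <= q < i) om q.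
  have -> : \sum_(j <= q < i) om q = m * \sum_(j <= q < i) (W q.+1 - W q).
    by rewrite mulr_sumr; apply: eq_bigr.
  by rewrite telescope_sumr// mulKf// gt_eqF.
rewrite normrM gtr0_norm ?invr_gt0// ler_wpM2l ?invr_ge0 ?(ltW m0)//.
apply: (le_trans (ler_norm_sum _ _ _)).
rewrite [leRHS](@big_cat_nat _ _ _ j)//= [X in _ <= _ + X](@big_cat_nat _ _ _ i)//=.
have s0 (p q : nat) : 0 <= \sum_(p <= r < q) `|om r| by apply: sumr_ge0.
by have := s0 a j; have := s0 i b; lra.
Qed.

End GridDifferences.

Section Cells.

(** The fine grid has 2 N k meshes. The cell from 2 i k to 2 (i + 1) k is centred at the node of
    theta_(i+1); the dual cell from (2 i - 1) k to (2 i + 1) k is centred at the interface i / N.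
    For i = 0 the truncated subtraction 2 * 0 - 1 = 0 cuts the dual cell at the boundary, as [minn]
    does on the right. *)
Lemma cell_succ (i k : nat) : (2 * i * k + k + k = 2 * i.+1 * k)%N.
Proof. nia. Qed.

Lemma dual_cell_succ (i k : nat) : (2 * i * k + k = (2 * i.+1 - 1) * k)%N.
Proof. by rewrite mulnS add2n subn1 /= mulSn addnC. Qed.

Lemma dual_cell_left (i k : nat) : ((2 * i - 1) * k <= 2 * i * k)%N.
Proof. by rewrite leq_mul2r leq_subr orbT. Qed.

Lemma dual_cell_mono (i k : nat) : ((2 * i - 1) * k <= (2 * i.+1 - 1) * k)%N.
Proof. by rewrite -dual_cell_succ (leq_trans (dual_cell_left i k)) ?leq_addr. Qed.

Lemma dual_cell_size (i k M : nat) :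
  (minn ((2 * i.+1 - 1) * k) M - minn ((2 * i - 1) * k) M <= 2 * k)%N.
Proof.
have : ((2 * i.+1 - 1) * k <= (2 * i - 1) * k + 2 * k)%N.
  by rewrite -mulnDl leq_mul2r; apply/orP; right; lia.
rewrite /minn; case: ifP; case: ifP; lia.
Qed.

Lemma minn_mono (a b M : nat) : (a <= b)%N -> (minn a M <= minn b M)%N.
Proof. rewrite /minn; case: ifP; case: ifP; lia. Qed.

Lemma dual_cell_last (N k : nat) : minn ((2 * N.+1 - 1) * k) (2 * N * k) = (2 * N * k)%N.
Proof. by apply/minn_idPr; rewrite -dual_cell_succ leq_addr. Qed.

End Cells.

Section Defects.
Context {R : realType}.
Variables (X u g W : R -> R) (c C G s eta : R).
Hypotheses (c0 : 0 < c) (G0 : 0 <= G) (s0 : 0 < s).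
Hypotheses (cX : continuous X) (cu : continuous u).
Hypothesis dX : forall y : R, 0 < y < 1 -> is_derive y (1 : R) X (u y).
Hypothesis du : forall y : R, 0 < y < 1 -> is_derive y (1 : R) u (2 * g y / u y).
Hypothesis dF : forall y : R, 0 < y < 1 -> is_derive y (1 : R) (fun z => u z ^+ 2) (4 * g y).
Hypothesis ub : forall y : R, 0 <= y <= 1 -> c <= u y <= C.
Hypothesis gb : forall y : R, 0 <= y <= 1 -> `|g y| <= G.
Hypotheses (g00 : g 0 = 0) (g10 : g 1 = 0) (X00 : X 0 = 0) (X11 : X 1 = 1).
Variables (N k : nat).
Hypotheses (N0 : (0 < N)%N) (k0 : (0 < k)%N).
Local Notation M := (2 * N * k)%N.
Local Notation m := (M%:R : R).
Local Notation n := (N%:R : R).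
Local Notation node j := (j%:R / m).
Let om (j : nat) : R := m * (W (node j.+1) - W (node j)).
Hypothesis gW : forall y : R, 0 <= y <= 1 -> `|g y - W y / s| <= eta.
Hypothesis ge : forall y z : R, 0 <= y <= 1 -> 0 <= z <= 1 -> `|y - z| <= m^-1 ->
  `|g y - g z| <= eta.

Let n0 : 0 < n. Proof. by rewrite ltr0n. Qed.
Let kr0 : 0 < (k%:R : R). Proof. by rewrite ltr0n. Qed.
Let mE : m = 2 * n * k%:R. Proof. by rewrite !natrM. Qed.
Let m0 : 0 < m. Proof. by rewrite mE !mulr_gt0. Qed.
Let nE : n^-1 / 2 = k%:R / m. Proof. by rewrite mE; field; rewrite !gt_eqF. Qed.

Let node01 (j : nat) : (j <= M)%N -> 0 <= node j <= 1.
Proof. by move=> jM; rewrite divr_ge0//= ler_pdivrMr// mul1r ler_nat. Qed.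

Let defect_r (i : nat) : R := g ((i%:R - 2^-1) / n) - n * (u (i%:R / n) ^+ 2 / 4 - u (i.-1%:R / n) ^+ 2 / 4).

(** The intermediate point is rounded down to the grid and g is replaced by W / s, which costs at
    most 6 eta before halving. The remaining second difference of W has radius at most k, and
    Cauchy-Schwarz over the 2 k meshes of the cell yields the factor n^-3 m^-1. *)
Let defect_r_le (i : nat) : (i < N)%N ->
  defect_r i.+1 ^+ 2 <= (8 * n ^+ 3)^-1 * (m^-1 * \sum_(2 * i * k <= j < 2 * i.+1 * k)
      (m * (om j - om j.-1)) ^+ 2) / s ^+ 2 + 18 * eta ^+ 2.
Proof.
move=> iN.
have iN' : (1 <= i.+1 <= N)%N by [].
have [t /andP[t0 t1] E] := coarse_r cu dF N0 iN'.
set y := (i.+1%:R - 2^-1) / n in E.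
pose a := (2 * i * k)%N.
have ak2 : (a + k + k)%N = (2 * i.+1 * k)%N by rewrite /a cell_succ.
have akM : (a + k + k <= M)%N by rewrite ak2 leq_mul2r leq_mul2l iN !orbT.
have yE : y = node (a + k)%N.
  by rewrite /y /a natrD !natrM -[i.+1%:R]natr1; field; rewrite !gt_eqF.
pose l := Num.trunc (t * m).
have /andP[l1 l2] : l%:R <= t * m < l.+1%:R by apply: truncn_itv; rewrite mulr_ge0// ltW.
have lk : (l <= k)%N.
  rewrite -ltnS -(ltr_nat R); apply: (le_lt_trans l1).
  apply: (lt_le_trans (_ : _ < k%:R)); last by rewrite ler_nat.
  by rewrite -ltr_pdivlMr// -nE.
have lE1 : node (a + k + l)%N = y + l%:R / m by rewrite natrD mulrDl -yE.
have lE2 : node (a + k - l)%N = y - l%:R / m.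
  by rewrite natrB ?(leq_trans lk) ?leq_addl// mulrBl -yE.
have lt1 : l%:R / m <= t by rewrite ler_pdivrMr.
have lt2 : t - l%:R / m <= m^-1.
  by rewrite lerBlDr -[X in X + _]mul1r -mulrDl ler_pdivlMr// addrC natr1 ltW.
have lm0 : 0 <= l%:R / m by rewrite divr_ge0// ltW.
have b1 : 0 <= y - n^-1 / 2.
  by rewrite yE nE -mulrBl -natrB ?leq_addl// addnK divr_ge0// ltW.
have b2 : y + n^-1 / 2 <= 1.
  by rewrite yE nE -mulrDl -natrD ler_pdivrMr// mul1r ler_nat.
have y01 : 0 <= y <= 1 by move: b1 b2 t0 t1; lra.
have yt1 : 0 <= y + t <= 1 by move: b1 b2 t0 t1; lra.
have yt2 : 0 <= y - t <= 1 by move: b1 b2 t0 t1; lra.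
have yl1 : 0 <= y + l%:R / m <= 1 by move: b1 b2 t0 t1 lm0 lt1; lra.
have yl2 : 0 <= y - l%:R / m <= 1 by move: b1 b2 t0 t1 lm0 lt1; lra.
pose D := W (y + l%:R / m) + W (y - l%:R / m) - 2 * W y.
have rD : `|defect_r i.+1| <= `|D| / (2 * s) + 3 * eta.
  rewrite /defect_r -/y E normrN normrM (@gtr0_norm _ 2^-1)//.
  have h1 : `|g (y + t) - g (y + l%:R / m)| <= eta.
    apply: ge => //; have -> : y + t - (y + l%:R / m) = t - l%:R / m by ring.
    by rewrite ger0_norm ?subr_ge0.
  have h2 : `|g (y - t) - g (y - l%:R / m)| <= eta.
    apply: ge => //; have -> : y - t - (y - l%:R / m) = - (t - l%:R / m) by ring.
    by rewrite normrN ger0_norm ?subr_ge0.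
  have h3 := gW yl1; have h4 := gW yl2; have h5 := gW y01.
  have DE : `|D| / s = `|D / s| by rewrite normrM (@gtr0_norm _ s^-1) ?invr_gt0.
  have -> : `|D| / (2 * s) = `|D / s| / 2 by rewrite -DE; field; rewrite gt_eqF.
  have -> : g (y + t) + g (y - t) - 2 * g y = (g (y + t) - g (y + l%:R / m)) +
     (g (y - t) - g (y - l%:R / m)) + (g (y + l%:R / m) - W (y + l%:R / m) / s)
     + (g (y - l%:R / m) - W (y - l%:R / m) / s) - 2 * (g y - W y / s) + D / s.
    by rewrite /D; field; rewrite gt_eqF.
  move: h1 h2 h3 h4 h5.
  move: (g (y + t) - _) (g (y - t) - _) (g (y + _) - _ / s) (g (y - _) - _ / s) (g y - _) (D / s).
  move=> p1 p2 p3 p4 p5 p6 h1 h2 h3 h4 h5.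
  have := ler_normD (p1 + p2 + p3 + p4 - 2 * p5) p6.
  have := ler_normB (p1 + p2 + p3 + p4) (2 * p5).
  have := ler_normD (p1 + p2 + p3) p4; have := ler_normD (p1 + p2) p3.
  have := ler_normD p1 p2; rewrite (normrM 2) (@ger0_norm _ 2)//.
  by lra.
have Dle : D ^+ 2 <= (4 * n ^+ 3)^-1 * (m^-1 * \sum_(2 * i * k <= j < 2 * i.+1 * k)
      (m * (om j - om j.-1)) ^+ 2).
  rewrite -ak2 -/a.
  have := @second_difference_le R (fun j => W (node j)) om m m0 (fun=> erefl) a k l lk.
  rewrite lE1 lE2 -yE -/D => Dle.
  rewrite -(real_normK (num_real D)).
  set S := \sum_(_ <= _ < _) _ in Dle.
  have S0 : 0 <= S by apply: sumr_ge0.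
  apply: (@le_trans _ _ ((k%:R / m ^+ 2 * S) ^+ 2)).
    rewrite ler_sqr ?nnegrE ?mulr_ge0 ?invr_ge0 ?exprn_ge0 ?(ltW m0)//.
    apply: (le_trans Dle); rewrite ler_wpM2r// ler_wpM2r ?invr_ge0 ?exprn_ge0 ?(ltW m0)//.
    by rewrite ler_nat.
  rewrite exprMn.
  have := @sum_sqr_le R a (a + k + k) (fun j => `|m * (om j - om j.-1)|).
  rewrite -/S -addnA addKn.
  under [X in _ <= _ * X]eq_bigr do rewrite (real_normK (num_real _)).
  rewrite addnA => SS.
  apply: (le_trans (ler_wpM2l (sqr_ge0 _) SS)).
  set Q := \sum_(_ <= _ < _) _.
  by rewrite natrD le_eqVlt; apply/orP; left; apply/eqP; rewrite mE; field; rewrite !gt_eqF.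
rewrite -(real_normK (num_real (defect_r i.+1))).
apply: (@le_trans _ _ ((`|D| / (2 * s) + 3 * eta) ^+ 2)).
  by rewrite ler_sqr ?nnegrE// (le_trans _ rD).
apply: (@le_trans _ _ (D ^+ 2 / (2 * s ^+ 2) + 18 * eta ^+ 2)).
  rewrite -(real_normK (num_real D)) -subr_ge0.
  have -> : `|D| ^+ 2 / (2 * s ^+ 2) + 18 * eta ^+ 2 - (`|D| / (2 * s) + 3 * eta) ^+ 2 =
    (`|D| / (2 * s) - 3 * eta) ^+ 2 by field; rewrite gt_eqF.
  exact: sqr_ge0.
rewrite lerD2r.
have s2 : 0 <= (2 * s ^+ 2)^-1 by rewrite invr_ge0 mulr_ge0 ?exprn_ge0// ltW.
apply: (le_trans (ler_wpM2r s2 Dle)).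
set Q := \sum_(_ <= _ < _) _.
by rewrite le_eqVlt; apply/orP; left; apply/eqP; field; rewrite !gt_eqF.
Qed.

Lemma sum_defect_r : \sum_(1 <= i < N.+1) defect_r i ^+ 2 <=
  (8 * n ^+ 3)^-1 * (m^-1 * \sum_(0 <= j < M) (m * (om j - om j.-1)) ^+ 2) / s ^+ 2
  + 18 * n * eta ^+ 2.
Proof.
rewrite big_add1 /=.
apply: (le_trans (ler_sum_nat (fun i (Hi : (0 <= i < N)%N) => defect_r_le Hi))).
rewrite big_split /= -mulr_suml -mulr_sumr -mulr_sumr.
rewrite (sum_cells (c := fun i => (2 * i * k)%N)); last first.
  by move=> i; rewrite leq_mul2r leq_mul2l leqnSn !orbT.
rewrite muln0 mul0n lerD2l big_const_nat iter_addr addr0 subn0 -mulr_natr.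
by rewrite le_eqVlt; apply/orP; left; apply/eqP; ring.
Qed.

Let b (i : nat) : R := n * (ghost_extend N (fun i => X ((i%:R - 2^-1) / n)) i.+1
   - ghost_extend N (fun i => X ((i%:R - 2^-1) / n)) i).

Let Kd : R := 2 * C ^+ 2 / c ^+ 2 + 8 * C ^+ 2 * G ^+ 4 / c ^+ 6.

Let cell (i : nat) := minn ((2 * i - 1) * k) M.

Let left_node (i : nat) (y : R) : (i <= N)%N -> 0 <= y <= 1 -> `|y - i%:R / n| <= n^-1 / 2 ->
  exists j : nat, [/\ (cell i <= j <= cell i.+1)%N, (j <= M)%N & `|y - node j| <= m^-1].
Proof.
move=> iN /andP[y0 y1]; rewrite ler_norml => /andP[yl yu].
pose j := Num.trunc (y * m).
have /andP[j1 j2] : j%:R <= y * m < j.+1%:R by apply: truncn_itv; rewrite mulr_ge0// ltW.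
have jM : (j <= M)%N.
  by rewrite -(ler_nat R) (le_trans j1)// ler_piMl// ltW.
have im : i%:R / n * m = (2 * i * k)%:R by rewrite !natrM; field; rewrite gt_eqF.
have hm : n^-1 / 2 * m = k%:R by rewrite nE mulfVK// gt_eqF.
exists j; split => //.
  apply/andP; split.
    rewrite geq_min; apply/orP; left.
    case: i iN yl im {yu} => [|i] iN yl im; first by rewrite muln0 sub0n mul0n.
    rewrite -ltnS -(ltr_nat R); apply: le_lt_trans j2.
    have : (i.+1%:R / n - n^-1 / 2) * m <= y * m by rewrite ler_wpM2r ?(ltW m0)//; lra.
    rewrite mulrBl im hm; apply: le_trans.
    rewrite -natrB; last by rewrite leq_pmull.
    by rewrite ler_nat mulnBl mul1n.
  rewrite leq_min jM andbT -(ler_nat R) (le_trans j1)//.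
  have : y * m <= (i%:R / n + n^-1 / 2) * m by rewrite ler_wpM2r ?(ltW m0)//; lra.
  by move=> /le_trans; apply; rewrite mulrDl im hm -natrD ler_nat dual_cell_succ.
rewrite ger0_norm ?subr_ge0 ?ler_pdivrMr// lerBlDr.
by rewrite -[X in X + _]mul1r -mulrDl ler_pdivlMr// addrC natr1 ltW.
Qed.

Let defect_d (i : nat) : R := u (i%:R / n) ^+ 2 / 4 - b i ^+ 2 / 4.

Let Kd0 : 0 <= Kd.
Proof.
have z01 : 0 <= (0 : R) <= 1 by rewrite lexx ler01.
have C0 : 0 <= C by have := ub z01; move: c0; lra.
have c0' := ltW c0.
rewrite /Kd; apply: addr_ge0; apply: divr_ge0; rewrite ?exprn_ge0//.
  by apply: mulr_ge0 => //; exact: exprn_ge0.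
by apply: mulr_ge0; last exact: exprn_ge0; apply: mulr_ge0 => //; exact: exprn_ge0.
Qed.

(** Once rounded, the two points of [coarse_delta] are nodes of one dual cell, so the oscillation of
    g reduces to a sum of at most 2 k increments of W. The term 4 eta collects the rounding and the
    time quotient at both points. *)
Let defect_d_le (i : nat) : (i <= N)%N ->
  defect_d i ^+ 2 <= Kd * (n ^- 2 * (2 * n^-1 * (m^-1 * \sum_(cell i <= j < cell i.+1) om j ^+ 2) / s ^+ 2
     + 32 * eta ^+ 2 + n ^- 2)).
Proof.
move=> iN.
have [p [q [p01 q01 pi qi H]]] := coarse_delta c0 G0 cX cu dX du ub gb N0 g00 g10 X00 X11 iN.
apply: (le_trans H); rewrite ler_wpM2l// ler_wpM2l ?invr_ge0 ?exprn_ge0 ?(ltW n0)// lerD2r.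
have [i1 [i1c i1M pi1]] := left_node iN p01 pi.
have [i2 [i2c i2M qi2]] := left_node iN q01 qi.
have v1 := node01 i1M; have v2 := node01 i2M.
have h1 := ge p01 v1 pi1; have h2 := ge q01 v2 qi2.
have h3 := gW v1; have h4 := gW v2.
have := difference_le (W := fun j => W (node j)) m0 (fun=> erefl) i1c i2c.
set D := W (node i1) - W (node i2); set S := \sum_(_ <= _ < _) _ => DS.
have S0 : 0 <= S by apply: sumr_ge0.
have DE : `|D / s| = `|D| / s by rewrite normrM (@gtr0_norm _ s^-1) ?invr_gt0.
have gD : `|g p - g q| <= `|D| / s + 4 * eta.
  rewrite -DE.
  have -> : g p - g q = (g p - g (node i1)) - (g q - g (node i2)) +
    (g (node i1) - W (node i1) / s) - (g (node i2) - W (node i2) / s) + D / s.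
    by rewrite /D; field; rewrite gt_eqF.
  move: h1 h2 h3 h4.
  move: (g p - _) (g q - _) (g (node i1) - _ / s) (g (node i2) - _ / s) (D / s) => p1 p2 p3 p4 p5 h1 h2 h3 h4.
  have := ler_normD (p1 - p2 + p3 - p4) p5; have := ler_normB (p1 - p2 + p3) p4.
  have := ler_normD (p1 - p2) p3; have := ler_normB p1 p2; lra.
have SS : S ^+ 2 <= 2 * k%:R * \sum_(cell i <= j < cell i.+1) om j ^+ 2.
  apply: (le_trans (sum_sqr_le _ _ _)).
  under [X in _ * X <= _]eq_bigr do rewrite (real_normK (num_real _)).
  rewrite ler_wpM2r//; first by apply: sumr_ge0 => j _; exact: sqr_ge0.
  by rewrite -natrM ler_nat dual_cell_size.
rewrite -(real_normK (num_real (g p - g q))).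
apply: (@le_trans _ _ ((`|D| / s + 4 * eta) ^+ 2)).
  by rewrite ler_sqr ?nnegrE// (le_trans _ gD).
apply: (@le_trans _ _ (2 * D ^+ 2 / s ^+ 2 + 32 * eta ^+ 2)).
  rewrite -(real_normK (num_real D)) -subr_ge0.
  have -> : 2 * `|D| ^+ 2 / s ^+ 2 + 32 * eta ^+ 2 - (`|D| / s + 4 * eta) ^+ 2 =
    (`|D| / s - 4 * eta) ^+ 2 by field; rewrite gt_eqF.
  exact: sqr_ge0.
rewrite lerD2r ler_wpM2r ?invr_ge0 ?exprn_ge0 ?(ltW s0)// -mulrA ler_wpM2l//.
rewrite -(real_normK (num_real D)).
apply: (@le_trans _ _ ((m^-1 * S) ^+ 2)).
  by rewrite ler_sqr ?nnegrE ?mulr_ge0 ?invr_ge0 ?(ltW m0).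
rewrite exprMn; apply: (le_trans (ler_wpM2l (sqr_ge0 _) SS)).
set Q := \sum_(_ <= _ < _) _.
by rewrite le_eqVlt; apply/orP; left; apply/eqP; rewrite mE; field; rewrite !gt_eqF.
Qed.

Lemma sum_defect_d : \sum_(0 <= i < N.+1) defect_d i ^+ 2 <=
  Kd * (n ^- 2 * (2 * n^-1 * (m^-1 * \sum_(0 <= j < M) om j ^+ 2) / s ^+ 2
     + (n + 1) * (32 * eta ^+ 2 + n ^- 2))).
Proof.
apply: (le_trans (ler_sum_nat (fun i (Hi : (0 <= i < N.+1)%N) => defect_d_le Hi))).
rewrite -mulr_sumr -mulr_sumr ler_wpM2l// ler_wpM2l ?invr_ge0 ?exprn_ge0 ?(ltW n0)//.
under eq_bigr do rewrite -addrA.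
rewrite big_split /= -mulr_suml -mulr_sumr -mulr_sumr sum_cells; last first.
  by move=> i; apply: minn_mono; exact: dual_cell_mono.
have -> : cell 0 = 0%N by rewrite /cell muln0 sub0n mul0n min0n.
have -> : cell N.+1 = M by exact: dual_cell_last.
rewrite lerD2l big_const_nat iter_addr addr0 subn0 -[_ *+ _]mulr_natl natr1.
exact: lexx.
Qed.

End Defects.

Section Arithmetic.
Context {R : realType}.
Implicit Types (n m s c K e Y Q Z O S D V B : R).

Lemma defect_arith n m s c K e Y Q Z O S D V B : 1 <= n -> 0 < m -> 0 < s -> 0 < c ->
  0 <= K -> 0 < e <= 1 -> 0 <= Y -> 0 <= Q -> 0 <= B ->
  D <= K * (n ^- 2 * (2 * n^-1 * (m^-1 * O) / s ^+ 2 + (n + 1) * (32 * e ^+ 2 + n ^- 2))) ->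
  V <= (8 * n ^+ 3)^-1 * (m^-1 * Z) / s ^+ 2 + 18 * n * e ^+ 2 ->
  Z <= 8 / c ^+ 2 * Y + B * Q -> c * O <= Q ->
  n^-1 * (- (c / 4) * S + 2 / c * D + 4 / c * V) <= - (c / 4) * (n^-1 * S)
   + n ^- 4 * (8 / c ^+ 2 / (2 * c) + B / (2 * c) + 4 * K / c ^+ 2) * (m^-1 * (Y + Q)) / s ^+ 2
   + 4 * K / c * n ^- 4 + (72 / c + 128 * K / c) * e.
Proof.
move=> n1 m0 s0 c0 K0 /andP[e0 e1] Y0 Q0 B0 HD HV HZ HO.
have n0 : 0 < n by exact: lt_le_trans n1.
have h0 : 0 < n^-1 by rewrite invr_gt0.
have h1 : n^-1 <= 1 by rewrite invf_le1.
have ci : 0 < c^-1 by rewrite invr_gt0.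
have e2 : e ^+ 2 <= e by rewrite expr2 ler_piMr// ltW.
have e2' : 0 <= e ^+ 2 by exact: sqr_ge0.
have w0 : 0 <= n ^- 4 * m^-1 / s ^+ 2.
  by rewrite !mulr_ge0 ?invr_ge0 ?exprn_ge0 ?(ltW n0) ?(ltW m0) ?(ltW s0).
have HV' : n^-1 * (4 / c * V) <= n ^- 4 * m^-1 / s ^+ 2 * (8 / c ^+ 2 / (2 * c) * Y + B / (2 * c) * Q) + 72 / c * e.
  apply: (@le_trans _ _ (n^-1 * (4 / c * ((8 * n ^+ 3)^-1 * (m^-1 * (8 / c ^+ 2 * Y + B * Q)) / s ^+ 2 + 18 * n * e ^+ 2)))).
    rewrite ler_pM2l// ler_wpM2l ?divr_ge0 ?(ltW c0)//; apply: (le_trans HV); rewrite lerD2r.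
    rewrite ler_wpM2r ?invr_ge0 ?exprn_ge0 ?(ltW s0)// ler_wpM2l//.
      by rewrite invr_ge0 mulr_ge0// exprn_ge0// ltW.
    by rewrite ler_pM2l ?invr_gt0.
  have -> : n^-1 * (4 / c * ((8 * n ^+ 3)^-1 * (m^-1 * (8 / c ^+ 2 * Y + B * Q)) / s ^+ 2 + 18 * n * e ^+ 2)) =
    n ^- 4 * m^-1 / s ^+ 2 * (8 / c ^+ 2 / (2 * c) * Y + B / (2 * c) * Q) + 72 / c * e ^+ 2.
    by field; rewrite !gt_eqF.
  by rewrite lerD2l ler_wpM2l// divr_ge0// ltW.
have O' : O <= Q / c by rewrite ler_pdivlMr// mulrC.
have HD' : n^-1 * (2 / c * D) <= n ^- 4 * m^-1 / s ^+ 2 * (4 * K / c ^+ 2 * Q) + 128 * K / c * e + 4 * K / c * n ^- 4.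
  apply: (@le_trans _ _ (n^-1 * (2 / c * (K * (n ^- 2 * (2 * n^-1 * (m^-1 * (Q / c)) / s ^+ 2 + (n + 1) * (32 * e ^+ 2 + n ^- 2))))))).
    rewrite ler_pM2l// ler_wpM2l ?divr_ge0 ?(ltW c0)//; apply: (le_trans HD).
    rewrite ler_wpM2l// ler_wpM2l ?invr_ge0 ?exprn_ge0 ?(ltW n0)// lerD2r.
    rewrite ler_wpM2r ?invr_ge0 ?exprn_ge0 ?(ltW s0)// ler_wpM2l ?mulr_ge0 ?(ltW h0)//.
    by rewrite ler_pM2l ?invr_gt0.
  have -> : n^-1 * (2 / c * (K * (n ^- 2 * (2 * n^-1 * (m^-1 * (Q / c)) / s ^+ 2 + (n + 1) * (32 * e ^+ 2 + n ^- 2)))))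
    = n ^- 4 * m^-1 / s ^+ 2 * (4 * K / c ^+ 2 * Q) +
      2 / c * K * (n ^- 2 * (1 + n^-1) * (32 * e ^+ 2 + n ^- 2)).
    by field; rewrite !gt_eqF.
  have i2 : n ^- 2 <= 1 by rewrite invf_le1 ?exprn_gt0// exprn_ege1.
  have i20 : 0 <= n ^- 2 by rewrite invr_ge0 exprn_ge0// ltW.
  have -> : n ^- 4 = n ^- 2 * n ^- 2 by field; rewrite gt_eqF.
  have H : n ^- 2 * (1 + n^-1) * (32 * e ^+ 2 + n ^- 2) <= 64 * e + 2 * (n ^- 2 * n ^- 2).
    apply: (@le_trans _ _ (n ^- 2 * 2 * (32 * e ^+ 2 + n ^- 2))).
      have p0 : 0 <= 32 * e ^+ 2 + n ^- 2 by move: e2' i20; lra.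
      by rewrite (ler_wpM2r p0)// ler_wpM2l//; move: h1; lra.
    have : n ^- 2 * e ^+ 2 <= e by apply: le_trans e2; rewrite ler_piMl.
    by lra.
  have K2 : 0 <= 2 / c * K by rewrite mulr_ge0// divr_ge0// ltW.
  have := ler_wpM2l K2 H.
  have -> : 2 / c * K * (64 * e + 2 * (n ^- 2 * n ^- 2)) = 128 * K / c * e + 4 * K / c * (n ^- 2 * n ^- 2) by ring.
  by lra.
have HR : n ^- 4 * m^-1 / s ^+ 2 * (8 / c ^+ 2 / (2 * c) * Y + B / (2 * c) * Q) +
    n ^- 4 * m^-1 / s ^+ 2 * (4 * K / c ^+ 2 * Q) <=
    n ^- 4 * (8 / c ^+ 2 / (2 * c) + B / (2 * c) + 4 * K / c ^+ 2) * (m^-1 * (Y + Q)) / s ^+ 2.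
  have -> : n ^- 4 * (8 / c ^+ 2 / (2 * c) + B / (2 * c) + 4 * K / c ^+ 2) * (m^-1 * (Y + Q)) / s ^+ 2 =
    n ^- 4 * m^-1 / s ^+ 2 * ((8 / c ^+ 2 / (2 * c) + B / (2 * c) + 4 * K / c ^+ 2) * (Y + Q)) by ring.
  rewrite -mulrDr ler_wpM2l//.
  have a0 : 0 <= 8 / c ^+ 2 / (2 * c) by rewrite !divr_ge0 ?exprn_ge0 ?mulr_ge0 ?(ltW c0).
  have b0 : 0 <= B / (2 * c) by rewrite divr_ge0 ?mulr_ge0 ?(ltW c0).
  have k0 : 0 <= 4 * K / c ^+ 2 by rewrite divr_ge0 ?exprn_ge0 ?mulr_ge0 ?(ltW c0).
  have := mulr_ge0 a0 Q0; have := mulr_ge0 b0 Y0; have := mulr_ge0 k0 Y0.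
  by lra.
have -> : n^-1 * (- (c / 4) * S + 2 / c * D + 4 / c * V) =
  - (c / 4) * (n^-1 * S) + n^-1 * (2 / c * D) + n^-1 * (4 / c * V) by ring.
by move: HV' HD' HR; lra.
Qed.

(** With the weight z = 2 r1 w / (m s^2) of P, the bad term of dE is z (Y + Q) / 2, while P
    contributes - z (2 Y + Q). Half of the Q part cancels the bad term, the other half dominates q z
    P because P <= Kp Q and q <= 1 / (2 Kp). *)
Lemma lyapunov_arith c Kp r1 r2 r3 r5 w m s e E dE Y Q P dP q : 0 < c -> 1 <= Kp -> 0 < m -> 0 < s ->
  0 <= w <= 1 -> 0 <= r1 -> 0 <= r5 -> 0 <= e -> 0 <= E -> 0 <= Y -> 0 <= P -> P <= Kp * Q ->
  q = Num.min (c / 4) (2 * Kp)^-1 ->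
  dE <= - (c / 4) * E + w * r1 * (m^-1 * (Y + Q)) / s ^+ 2 + r2 * w + r3 * e ->
  dP <= - 2 * Y - Q + m * (s ^+ 2 * e * r5) ->
  dE + 2 * r1 * w * m^-1 / s ^+ 2 * dP <=
  - q * (E + 2 * r1 * w * m^-1 / s ^+ 2 * P) + (r2 * w + (r3 + 2 * r1 * r5) * e).
Proof.
move=> c0 K1 m0 s0 /andP[w0 w1] r10 r50 e0 E0 Y0 P0 PQ qE HE HP.
have Kp0 : 0 < Kp by exact: lt_le_trans K1.
have z0 : 0 <= r1 * w * m^-1 / s ^+ 2.
  by rewrite !mulr_ge0 ?invr_ge0 ?exprn_ge0 ?(ltW m0) ?(ltW s0).
have q1 : q * E <= c / 4 * E by rewrite ler_wpM2r// qE ge_min lexx.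
have q2 : q * (2 * P) <= Q.
  apply: (@le_trans _ _ ((2 * Kp)^-1 * (2 * P))).
    by rewrite ler_wpM2r ?mulr_ge0// qE ge_min lexx orbT.
  by rewrite ler_pdivrMl ?mulr_gt0//; move: PQ; lra.
have H1 := ler_wpM2l z0 q2.
have H2 := ler_wpM2l (mulr_ge0 (ler0n _ 2) z0) HP.
have H3 := mulr_ge0 z0 Y0.
have -> : 2 * r1 * w * m^-1 / s ^+ 2 * dP = 2 * (r1 * w * m^-1 / s ^+ 2) * dP by ring.
have -> : 2 * r1 * w * m^-1 / s ^+ 2 * P = 2 * (r1 * w * m^-1 / s ^+ 2) * P by ring.
have E1 : w * r1 * (m^-1 * (Y + Q)) / s ^+ 2 = (r1 * w * m^-1 / s ^+ 2) * (Y + Q) by ring.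
have E2 : 2 * (r1 * w * m^-1 / s ^+ 2) * (m * (s ^+ 2 * e * r5)) = w * (2 * r1 * r5 * e).
  by field; rewrite !gt_eqF.
have H4 : w * (2 * r1 * r5 * e) <= 2 * r1 * r5 * e by rewrite ler_piMl ?mulr_ge0.
move: HE H2; rewrite E1 [in X in _ -> X -> _]mulrDr E2.
move: z0 H1 H3; set z := r1 * w * m^-1 / s ^+ 2 => z0 H1 H3.
by move: H4 q1; lra.
Qed.

(** The powers of m and s cancel: the initial energy of order m s^2 meets the weight 1 / (m s^2). *)
Lemma initial_arith (r1 kp ki n m s : R) : 0 < n -> 0 < m -> 0 < s ->
  2 * r1 * n ^- 4 * m^-1 / s ^+ 2 * (kp * (m * (ki * s ^+ 2))) = 2 * r1 * kp * ki * n ^- 4.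
Proof. by move=> n0 m0 s0; field; rewrite !gt_eqF. Qed.

End Arithmetic.

(** * Lyapunov functional for the error *)

Section Lyapunov.
Context {R : realType}.
Variables (X u g : R -> R -> R) (c C G l : R).
Hypotheses (flowX : classical_flow X u g) (c0 : 0 < c) (C0 : 0 < C) (G0 : 0 <= G).
Hypothesis slope0 : forall y : R, 0 < y < 1 -> c <= u 0 y <= C.
Hypothesis g0 : forall y : R, 0 < y < 1 -> `|g 0 y| <= G.
Hypotheses (l0 : 0 <= l) (glip : forall y z : R, 0 <= y <= 1 -> 0 <= z <= 1 ->
  `|g 0 y - g 0 z| <= l * `|y - z|).

Variables (N : nat) (x : R -> nat -> R).
Hypothesis N0 : (0 < N)%N.
Local Notation n := (N%:R : R).
Let theta (i : nat) : R := (i%:R - 2^-1) / n.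
Let a (t : R) (i : nat) := n * (ghost_extend N (x t) i.+1 - ghost_extend N (x t) i).
Hypothesis cx : forall i, continuous (x ^~ i).
Hypothesis dx : forall (t : R) i, 0 < t -> (1 <= i <= N)%N ->
  is_derive t (1 : R) (x ^~ i) (n / 4 * (a t i ^+ 2 - a t i.-1 ^+ 2)).
Hypothesis ac : forall (t : R) i, 0 <= t -> (i <= N)%N -> c <= a t i.

(** Origin of the constants: [Kdefect] is that of [coarse_delta], [Kinitial] that of [fineQ_init];
    [Kflux], [Kgrid] and [Kosc] are produced by [defect_arith], [Ktime] by the grid errors in the
    derivative of P, and [Kpoincare] by bounding P by Q alone. *)
Definition Kdefect : R := 2 * C ^+ 2 / c ^+ 2 + 8 * C ^+ 2 * G ^+ 4 / c ^+ 6.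
Let r := rate c G.
Definition Kpoincare : R := 1 + (rate c G + 1) / c.
Definition Kinitial : R := expR (rate c G + 1) * (16 + C * l ^+ 2).
Definition Kflux : R := 8 / c ^+ 2 / (2 * c) + 3 * (4 * G / c) ^+ 2 / c ^+ 3 / (2 * c) + 4 * Kdefect / c ^+ 2.
Definition Kgrid : R := 4 * Kdefect / c.
Definition Kosc : R := 72 / c + 128 * Kdefect / c.
Definition Ktime : R := 16 + 4 * (rate c G + 1) * G.
(** The first entry is the rate left in [coarse_energy], the second is the rate of P in
    [lyapunov_arith]. *)
Definition decay : R := Num.min (c / 4) (2 * Kpoincare)^-1.
(** The first summand is the initial value of the weighted P, the second the consistency error
    accumulated against the rate [decay]. *)
Definition Kerr : R := 2 * Kflux * Kpoincare * Kinitial + Kgrid / decay.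

Let E (t : R) := n^-1 * \sum_(1 <= i < N.+1) (x t i - X t (theta i)) ^+ 2.

Let n0 : 0 < n. Proof. by rewrite ltr0n. Qed.
Let n1 : 1 <= n. Proof. by rewrite ler1n. Qed.
Let r0 : 0 <= rate c G. Proof. exact: rate_ge0. Qed.
Let Kd0 : 0 <= Kdefect.
Proof.
have c0' := ltW c0; have C0' := ltW C0.
rewrite /Kdefect; apply: addr_ge0; apply: divr_ge0; rewrite ?exprn_ge0//.
  by apply: mulr_ge0 => //; exact: exprn_ge0.
by apply: mulr_ge0; last exact: exprn_ge0; apply: mulr_ge0 => //; exact: exprn_ge0.
Qed.
Let KP1 : 1 <= Kpoincare.
Proof. by rewrite /Kpoincare lerDl divr_ge0 ?addr_ge0// ltW. Qed.
Let R10 : 0 <= Kflux.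
Proof.
have c0' := ltW c0.
have d0 : 0 <= 2 * c by exact: mulr_ge0.
have h1 : 0 <= 8 / c ^+ 2 by apply: divr_ge0 => //; exact: exprn_ge0.
have h2 : 0 <= 3 * (4 * G / c) ^+ 2 / c ^+ 3.
  by apply: divr_ge0; [apply: mulr_ge0 => //; exact: sqr_ge0|exact: exprn_ge0].
have h3 : 0 <= 4 * Kdefect / c ^+ 2 by apply: divr_ge0; [exact: mulr_ge0|exact: exprn_ge0].
rewrite /Kflux; apply: addr_ge0 => //; apply: addr_ge0; exact: divr_ge0.
Qed.
Let R20 : 0 <= Kgrid. Proof. by rewrite /Kgrid divr_ge0 ?mulr_ge0// ltW. Qed.
Let R50 : 0 <= Ktime. Proof. by rewrite /Ktime addr_ge0// ?mulr_ge0// ?addr_ge0. Qed.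
Let R30 : 0 <= Kosc.
Proof. by have c0' := ltW c0; rewrite /Kosc addr_ge0// divr_ge0// mulr_ge0. Qed.

Lemma decay_gt0 : 0 < decay.
Proof.
rewrite /decay lt_min divr_gt0//= invr_gt0 mulr_gt0//; exact: lt_le_trans KP1.
Qed.

Let theta01 i : (1 <= i <= N)%N -> 0 <= theta i <= 1.
Proof.
move=> /andP[i1 iN]; rewrite /theta divr_ge0 ?(ltW n0)//=.
  rewrite ler_pdivrMr// mul1r; have : i%:R <= n by rewrite ler_nat.
  by lra.
have : (1 : R) <= i%:R by rewrite ler1n.
by lra.
Qed.

Let ub (t : R) (y : R) : 0 <= t -> 0 <= y <= 1 -> c <= u t y <= C.
Proof. by move=> t0 y01; exact: (flow_u_bounds flowX c0 C0 slope0). Qed.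

Let gb (t : R) (y : R) : 0 <= t -> 0 <= y <= 1 -> `|g t y| <= G.
Proof. by move=> t0 y01; exact: (flow_g_bound flowX c0 C0 G0 slope0 g0). Qed.

Variables (T s eta eps : R) (k : nat).
Hypotheses (T0 : 0 <= T) (s0 : 0 < s <= 1) (eta0 : 0 < eta <= 1) (k0 : (0 < k)%N).
Hypotheses (eps0 : 0 <= eps) (epseta : eps <= eta * s ^+ 2).
Local Notation M := (2 * N * k)%N.
Local Notation m := (M%:R : R).
Hypothesis kappa_le : forall (t : R) (j : nat), 0 <= t <= T + 1 -> (0 < j < M)%N ->
  `|g t (j%:R / m) - m / 4 * (slope M (X t) j ^+ 2 - slope M (X t) j.-1 ^+ 2)| <= eps.
Hypothesis gW : forall t y : R, 0 <= t <= T -> 0 <= y <= 1 ->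
  `|g t y - (X (t + s) y - X t y) / s| <= eta.
Hypothesis ge : forall t y z : R, 0 <= t <= T -> 0 <= y <= 1 -> 0 <= z <= 1 ->
  `|y - z| <= m^-1 -> `|g t y - g t z| <= eta.

Let M0 : (0 < M)%N. Proof. by rewrite !muln_gt0 N0 k0. Qed.
Let m0 : 0 < m. Proof. by rewrite ltr0n. Qed.
Let Q t := fineQ M (X (t + s)) (X t).
Let W t := fineW M (X (t + s)) (X t).
Let Y t := fineY M (X (t + s)) (X t).
(** With the factor r + 1, the dissipation of W pays for the growth r Q of Q and leaves one Q. *)
Let P t := Q t + (r + 1) * W t.

Let rangeT (t : R) : 0 <= t <= T -> 0 <= t <= T + 1 /\ 0 <= t + s <= T + 1.
Proof. by move: s0; lra. Qed.

Let Y0 t : 0 <= Y t. Proof. by apply: sumr_ge0 => j _; exact: sqr_ge0. Qed.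

Let Q_ge0 (t : R) : 0 <= t <= T -> 0 <= Q t.
Proof.
move=> /rangeT[h1 h2]; have := fineW_le flowX c0 C0 slope0 M0 h2 h1.
apply: le_trans; rewrite mulr_ge0 ?(ltW c0)//; apply: sumr_ge0 => j _; exact: sqr_ge0.
Qed.

Let PQ (t : R) : 0 <= t <= T -> P t <= Kpoincare * Q t.
Proof.
move=> /rangeT[h1 h2]; have := fineW_le flowX c0 C0 slope0 M0 h2 h1.
rewrite -/(W t) -/(Q t) mulrC -ler_pdivlMr// => H.
have := ler_wpM2l (addr_ge0 r0 ler01) H; rewrite /P /Kpoincare -/r.
have -> : (r + 1) * (Q t / c) = (r + 1) / c * Q t by ring.
by lra.
Qed.

Let dP t := \sum_(0 <= j < M)
   (m * ((g (t + s) (j.+1%:R / m) + g t (j.+1%:R / m)) / 2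
      - (g (t + s) (j%:R / m) + g t (j%:R / m)) / 2) * dslope M (X (t + s)) (X t) j ^+ 2 +
   2 * mean_slope M (X (t + s)) (X t) j * dslope M (X (t + s)) (X t) j *
     (m * ((g (t + s) (j.+1%:R / m) - g t (j.+1%:R / m)) - (g (t + s) (j%:R / m) - g t (j%:R / m)))))
  + (r + 1) * \sum_(0 <= j < M) 2 * (X (t + s) (j%:R / m) - X t (j%:R / m)) *
       (g (t + s) (j%:R / m) - g t (j%:R / m)).

Let node01 (j : nat) : (j <= M)%N -> 0 <= (j%:R / m) <= 1.
Proof. by move=> jM; rewrite divr_ge0//= ler_pdivrMr// mul1r ler_nat. Qed.

Let is_derive_P (t : R) : 0 < t -> is_derive t (1 : R) P (dP t).
Proof.
move=> t0; have ts0 : 0 < t + s by rewrite addr_gt0//; case/andP: s0.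
have d1 j : (j <= M)%N -> is_derive t (1 : R) (fun q => X (q + s) (j%:R / m)) (g (t + s) (j%:R / m)).
  move=> jM; apply: (@is_derive_shift _ (X ^~ (j%:R / m))).
  exact: (flow_dt flowX ts0 (node01 jM)).
have d2 j : (j <= M)%N -> is_derive t (1 : R) (X ^~ (j%:R / m)) (g t (j%:R / m)).
  by move=> jM; exact: (flow_dt flowX t0 (node01 jM)).
have dQ := is_derive_fineQ (A := fun q => X (q + s)) d1 d2.
have dW := is_derive_fineW (A := fun q => X (q + s)) d1 d2.
exact: is_deriveD dQ (@is_deriveZ _ _ _ _ (r + 1) _ _ _ dW).
Qed.

(** The grid errors are 16 m eps^2 and a multiple of eps times the sum of the increments of X,
    itself at most m G s by [flow_dist]. The hypothesis eps <= eta s^2 brings both to order m s^2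
    eta, which the weight of P turns into order eta. *)
Let dP_le (t : R) : 0 <= t <= T -> dP t <= - 2 * Y t - Q t + m * (s ^+ 2 * eta * Ktime).
Proof.
move=> tT; have [h1 h2] := rangeT tT; have t0 : 0 <= t by case/andP: tT.
have s0' : 0 <= s by apply: ltW; case/andP: s0.
have gt0 := flow_g_bnd flowX t0.
have H1 := fineQ_derive_le flowX c0 C0 G0 slope0 g0 M0 eps0 kappa_le h2 h1
  (Bt := fun j => g t (j%:R / m)) (pt := fun j => (g (t + s) (j%:R / m) + g t (j%:R / m)) / 2)
  (wt := fun j => g (t + s) (j%:R / m) - g t (j%:R / m))
  (fun j jM => gb t0 (node01 jM)) _ _ (fun=> erefl) (fun=> erefl).
have {H1} := H1 _ _.
rewrite mul0r gt0.1 mulfV ?gt_eqF// gt0.2 => /(_ erefl erefl).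
rewrite [X in _ + 2 * m * X]big1_seq ?mulr0 ?addr0; last first.
  by move=> j _; rewrite !subrr mul0r.
have H2 := fineW_derive_le flowX M0 kappa_le h2 h1.
have H3 : \sum_(0 <= j < M) `|X (t + s) (j%:R / m) - X t (j%:R / m)| <= m * (G * s).
  have -> : m * (G * s) = \sum_(0 <= j < M) G * s.
    by rewrite big_const_nat iter_addr addr0 subn0 -[RHS]mulr_natl.
  rewrite ler_sum_nat// => j /= /ltnW jM.
  exact: (flow_dist flowX c0 C0 G0 slope0 g0 t0 s0' (node01 jM)).
have H4 := ler_wpM2l (addr_ge0 r0 ler01) (le_trans H2 (lerD (lexx _)
   (ler_wpM2l (mulr_ge0 (ler0n _ 4) eps0) H3))).
rewrite /dP -/(Y t) -/(Q t) -/r in H4 *.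
move: H4; move: (\sum_(0 <= j < M) 2 * _ * (g _ _ - g _ _)) => SW H4.
move: (\sum_(0 <= j < M) _) => SQ H1.
suff : 16 * m * eps ^+ 2 + (r + 1) * (4 * eps * (m * (G * s))) <= m * (s ^+ 2 * eta * Ktime).
  by move: H1 H4; rewrite mulrDr; lra.
have e2 : eps ^+ 2 <= s ^+ 2 * eta.
  rewrite expr2; apply: (@le_trans _ _ (1 * (eta * s ^+ 2))); last by rewrite mul1r mulrC.
  apply: ler_pM => //; apply: (le_trans epseta).
  by rewrite -[leRHS]mulr1 ler_pM ?mulr_ge0 ?sqr_ge0 ?exprn_ile1//; move: eta0 s0; lra.
have e3 : eps * s <= s ^+ 2 * eta.
  rewrite -[leRHS]mulr1; apply: ler_pM => //; last by case/andP: s0.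
  by rewrite mulrC.
have rG : 0 <= 4 * (r + 1) * G by rewrite !mulr_ge0// addr_ge0.
have H5 := ler_wpM2l rG e3.
have -> : 16 * m * eps ^+ 2 + (r + 1) * (4 * eps * (m * (G * s))) =
   m * (16 * eps ^+ 2 + 4 * (r + 1) * G * (eps * s)) by ring.
rewrite ler_pM2l// /Ktime -/r; move: H5 e2; rewrite mulrDr; lra.
Qed.

Let dE t := n^-1 * \sum_(1 <= i < N.+1)
  2 * (x t i - X t (theta i)) * (n / 4 * (a t i ^+ 2 - a t i.-1 ^+ 2) - g t (theta i)).

Let is_derive_E (t : R) : 0 < t -> is_derive t (1 : R) E (dE t).
Proof.
move=> t0.
apply: (@is_deriveZ _ _ _ _ n^-1 _ _ _ (@is_derive_sum_nat R _ _
  (fun q i => (x q i - X q (theta i)) ^+ 2) _ t _)) => i iN.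
have iN' : (1 <= i <= N)%N by [].
have d1 := is_deriveB (dx t0 iN') (flow_dt flowX t0 (theta01 iN')).
have := is_deriveM d1 d1.
set w := _ - g t _; set f := (x ^~ i - X ^~ (theta i)).
by have -> : f t *: w + f t *: w = 2 * f t * w by rewrite /GRing.scale /=; ring.
Qed.

Let dE_le (t : R) : 0 <= t <= T -> dE t <= - (c / 4) * E t +
  n ^- 4 * Kflux * (m^-1 * (Y t + Q t)) / s ^+ 2 + Kgrid * n ^- 4 + Kosc * eta.
Proof.
move=> tT; have [h1 h2] := rangeT tT; have t0 : 0 <= t by case/andP: tT.
pose Xi := fun i : nat => X t (theta i).
pose b i := n * (ghost_extend N Xi i.+1 - ghost_extend N Xi i).
pose e i := ghost_extend N (x t) i - ghost_extend N Xi i.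
pose f i := u t (i%:R / n) ^+ 2 / 4.
pose gt i := g t (theta i).
have dXt (y : R) : 0 < y < 1 -> is_derive y (1 : R) (X t) (u t y) by exact: (flow_dy flowX).
have dut (y : R) : 0 < y < 1 -> is_derive y (1 : R) (u t) (2 * g t y / u t y).
  by exact: (flow_du flowX c0 C0 slope0).
have dFt (y : R) : 0 < y < 1 -> is_derive y (1 : R) (fun z => u t z ^+ 2) (4 * g t y).
  by exact: (flow_dflux flowX).
have ubt (y : R) : 0 <= y <= 1 -> c <= u t y <= C by exact: ub.
have gbt (y : R) : 0 <= y <= 1 -> `|g t y| <= G by exact: gb.
have [g00 g10] := flow_g_bnd flowX t0.
have cXt : continuous (X t) by exact: (flow_cXy flowX).
have cut : continuous (u t) by exact: (flow_cuy flowX).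
have X00 := flow_0 flowX t0; have X11 := flow_1 flowX t0.
have bc i : (i <= N)%N -> c <= b i.
  by move=> iN; have [/andP[]] := coarse_b c0 G0 cXt cut
     dXt dut ubt gbt N0 g00 g10 X00 X11 iN.
have eE i : (1 <= i <= N)%N -> e i = x t i - Xi i.
  by move=> /andP[i1 iN]; rewrite /e /ghost_extend gtn_eqF// ltn_eqF.
(* f is the exact flux u^2 / 4 at the interfaces, and both defects are defined as what is missing in
   the ideal relations; those hypotheses of [coarse_energy] then hold by algebra. *)
have H := @coarse_energy R N c e (a t) b gt (fun i => gt i - n * (f i - f i.-1)) f
  (fun i => f i - b i ^+ 2 / 4) N0 c0.
have {}H := H _ _ _ _ _ _.
have {H} : 2 / n * (\sum_(1 <= i < N.+1) e i * (n / 4 * (a t i ^+ 2 - a t i.-1 ^+ 2) - gt i)) <=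
  n^-1 * (- (c / 4) * (\sum_(1 <= i < N.+1) e i ^+ 2)
     + 2 / c * (\sum_(0 <= i < N.+1) (f i - b i ^+ 2 / 4) ^+ 2)
     + 4 / c * (\sum_(1 <= i < N.+1) (gt i - n * (f i - f i.-1)) ^+ 2)).
  apply: H.
  - rewrite /e /ghost_extend /= eqSS [0%N == N]ltn_eqF//; ring.
  - by rewrite /e /ghost_extend /= eqxx gtn_eqF// ltn_eqF//; ring.
  - by move=> i iN; rewrite /a /b /e; ring.
  - by move=> i iN; have := ac t0 iN; have := bc _ iN; lra.
  - by move=> i iN; ring.
  - by move=> i iN; ring.
have -> : \sum_(1 <= i < N.+1) e i ^+ 2 = \sum_(1 <= i < N.+1) (x t i - X t (theta i)) ^+ 2.
  by apply: eq_big_nat => i iN; rewrite eE.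
have -> : 2 / n * (\sum_(1 <= i < N.+1) e i * (n / 4 * (a t i ^+ 2 - a t i.-1 ^+ 2) - gt i)) = dE t.
  rewrite /dE mulr_sumr mulr_sumr; apply: eq_big_nat => i iN; rewrite eE// /gt /Xi; ring.
have s0' : 0 < s by case/andP: s0.
have eta0' : 0 <= eta by apply: ltW; case/andP: eta0.
have gWt (y : R) : 0 <= y <= 1 -> `|g t y - (X (t + s) y - X t y) / s| <= eta by exact: gW.
have get (y z : R) : 0 <= y <= 1 -> 0 <= z <= 1 -> `|y - z| <= m^-1 -> `|g t y - g t z| <= eta.
  by exact: ge.
have Hr := @sum_defect_r R (u t) (g t) (fun y => X (t + s) y - X t y) s eta s0'
   cut dFt N k N0 k0 gWt get.
have Hd := @sum_defect_d R (X t) (u t) (g t) (fun y => X (t + s) y - X t y) c C G s eta c0 G0 s0'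
   cXt cut dXt dut ubt gbt g00 g10 X00 X11 N k N0 k0 gWt get.
have omE j : m * (X (t + s) (j.+1%:R / m) - X t (j.+1%:R / m) - (X (t + s) (j%:R / m) - X t (j%:R / m)))
   = dslope M (X (t + s)) (X t) j by rewrite /dslope /slope; ring.
have B0 : 0 <= 3 * (4 * G / c) ^+ 2 / c ^+ 3.
  by rewrite divr_ge0 ?exprn_ge0 ?(ltW c0)// mulr_ge0// sqr_ge0.
move=> /le_trans; apply.
apply: (@defect_arith R n m s c Kdefect eta (Y t) (Q t) _ _ (\sum_(1 <= i < N.+1) (x t i - X t (theta i)) ^+ 2) _ _ _ n1 m0 s0' c0 Kd0 eta0
  (Y0 t) (Q_ge0 tT) B0 Hd Hr).
- apply: le_trans (fineZ_le flowX c0 C0 G0 slope0 g0 M0 h2 h1).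
  by rewrite /fineZ le_eqVlt; apply/orP; left; apply/eqP; apply: eq_bigr => j _; rewrite !omE.
- apply: le_trans (fine_dslope_le flowX c0 C0 slope0 M0 h2 h1).
  by rewrite le_eqVlt; apply/orP; left; apply/eqP; congr (_ * _); apply: eq_bigr => j _; rewrite omE.
Qed.

(* The Lyapunov function is E + z P, where P / s ^+ 2 is the discrete substitute
   for \int u (d_theta g)^2 + (rate + 1) \int g^2: its dissipation absorbs the
   second difference of g occurring in the consistency errors of E. *)
Lemma lyapunov : E T <= expR (- decay * T) * E 0 + Kerr * n ^- 4 + (Kosc + 2 * Kflux * Ktime) / decay * eta.
Proof.
have s0' : 0 < s by case/andP: s0.
have s1 : s <= 1 by case/andP: s0.
have eta0' : 0 <= eta by apply: ltW; case/andP: eta0.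
pose z := 2 * Kflux * n ^- 4 * m^-1 / s ^+ 2.
have w01 : 0 <= n ^- 4 <= 1.
  by rewrite invr_ge0 exprn_ge0 ?(ltW n0)//= invf_le1 ?exprn_gt0// exprn_ege1.
have z0 : 0 <= z.
  by rewrite /z !mulr_ge0 ?invr_ge0 ?exprn_ge0 ?(ltW m0) ?(ltW s0') ?(ltW n0).
have cE : continuous E.
  move=> q; apply: cvgM; first exact: cvg_cst.
  apply: (@continuous_sum_nat R _ _ (fun q i => (x q i - X q (theta i)) ^+ 2)) => i _ p.
  by apply: cvgM; apply: cvgB; [exact: cx|exact: (flow_cXt flowX)|exact: cx|exact: (flow_cXt flowX)].
have cXs y : continuous ((fun q => X (q + s)) ^~ y).
  move=> q; apply: (@cvg_comp _ _ _ (fun q => q + s) (X ^~ y) _ (nbhs (q + s))).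
    by apply: cvgD; [exact: cvg_id|exact: cvg_cst].
  exact: (flow_cXt flowX).
have cP : continuous P.
  have cQ : continuous Q by apply: continuous_fineQ => //; exact: (flow_cXt flowX).
  have cW : continuous W by apply: continuous_fineW => //; exact: (flow_cXt flowX).
  by move=> q; apply: cvgD; [exact: cQ|apply: cvgM; [exact: cvg_cst|exact: cW]].
have W0 t : 0 <= W t by apply: sumr_ge0 => j _; exact: sqr_ge0.
have E0 t : 0 <= E t.
  by rewrite /E mulr_ge0 ?invr_ge0 ?(ltW n0)//; apply: sumr_ge0 => j _; exact: sqr_ge0.
have P0 t : 0 <= t <= T -> 0 <= P t.
  by move=> /Q_ge0 h; rewrite /P addr_ge0// mulr_ge0// addr_ge0.
have d0 := decay_gt0.
have cL : continuous (fun t => E t + z * P t).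
  move=> q; apply: cvgD; first exact: cE.
  by apply: cvgM; [exact: cvg_cst|exact: cP].
have dL t : 0 < t < T -> is_derive t (1 : R) (fun t => E t + z * P t) (dE t + z * dP t).
  move=> /andP[t0 _].
  exact: is_deriveD (is_derive_E t0) (@is_deriveZ _ _ _ _ z _ _ _ (is_derive_P t0)).
have dLle t : 0 < t < T -> dE t + z * dP t <= - decay * (E t + z * P t) +
    (Kgrid * n ^- 4 + (Kosc + 2 * Kflux * Ktime) * eta).
  move=> /andP[t0 tT]; have tT' : 0 <= t <= T by rewrite !ltW.
  exact: (lyapunov_arith c0 KP1 m0 s0' w01 R10 R50 eta0' (E0 t) (Y0 t) (P0 _ tT') (PQ tT')
    (erefl decay) (dE_le tT') (dP_le tT')).
have := gronwall T0 (lt0r_neq0 d0) cL dL dLle.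
set b := Kgrid * n ^- 4 + (Kosc + 2 * Kflux * Ktime) * eta.
have oT : 0 <= (0 : R) <= T by rewrite lexx.
have b0 : 0 <= b.
  rewrite /b; apply: addr_ge0; first by apply: mulr_ge0 => //; case/andP: w01.
  apply: mulr_ge0 => //; apply: addr_ge0 => //; apply: mulr_ge0 => //; exact: mulr_ge0.
have ex : 0 < expR (- decay * T) by exact: expR_gt0.
have ex1 : expR (- decay * T) <= 1 by rewrite -expR0 ler_expR mulNr oppr_le0 mulr_ge0// ltW.
have zP : 0 <= z * P T by rewrite mulr_ge0// P0// lexx T0.
have epss : eps <= s.
  apply: (le_trans epseta); rewrite expr2 mulrA -[leRHS]mul1r ler_wpM2r ?(ltW s0')//.
  by rewrite mulr_ile1//; [exact: ltW|case/andP: eta0].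
have sT1 : s <= T + 1 by move: s1 T0; lra.
have HI := fineQ_init flowX c0 C0 G0 slope0 g0 M0 eps0 kappa_le l0 glip s0 sT1 epss.
have HP0 : z * P 0 <= 2 * Kflux * Kpoincare * Kinitial * n ^- 4.
  apply: (le_trans (ler_wpM2l z0 (PQ oT))).
  have : Kpoincare * Q 0 <= Kpoincare * (m * (Kinitial * s ^+ 2)).
    by rewrite ler_wpM2l ?(le_trans ler01 KP1)// /Q add0r.
  move=> /(ler_wpM2l z0) /le_trans; apply.
  by rewrite /z initial_arith.
have HP0' : expR (- decay * T) * (z * P 0) <= 2 * Kflux * Kpoincare * Kinitial * n ^- 4.
  apply: le_trans HP0; rewrite ler_piMl// mulr_ge0// P0//.
have Hb : b / decay * (1 - expR (- decay * T)) <= b / decay.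
  by rewrite ler_piMr ?divr_ge0 ?(ltW d0)//; move: ex; lra.
have bE : b / decay = Kgrid / decay * n ^- 4 + (Kosc + 2 * Kflux * Ktime) / decay * eta by rewrite /b; ring.
rewrite /Kerr mulrDl; move: Hb; rewrite bE mulrDr; lra.
Qed.

End Lyapunov.

(** * Choice of the parameters and the comparison of the two flows *)

Section FlowComparison.
Context {R : realType}.
Variables (X u g : R -> R -> R) (c C G l : R).
Hypotheses (flowX : classical_flow X u g) (c0 : 0 < c) (C0 : 0 < C) (G0 : 0 <= G).
Hypothesis slope0 : forall y : R, 0 < y < 1 -> c <= u 0 y <= C.
Hypothesis g0 : forall y : R, 0 < y < 1 -> `|g 0 y| <= G.
Hypotheses (l0 : 0 <= l) (glip : forall y z : R, 0 <= y <= 1 -> 0 <= z <= 1 ->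
  `|g 0 y - g 0 z| <= l * `|y - z|).
Variables (N : nat) (x : R -> nat -> R).
Hypothesis N0 : (0 < N)%N.
Local Notation n := (N%:R : R).
Let theta (i : nat) : R := (i%:R - 2^-1) / n.
Let a (t : R) (i : nat) := n * (ghost_extend N (x t) i.+1 - ghost_extend N (x t) i).
Hypothesis cx : forall i, continuous (x ^~ i).
Hypothesis dx : forall (t : R) i, 0 < t -> (1 <= i <= N)%N ->
  is_derive t (1 : R) (x ^~ i) (n / 4 * (a t i ^+ 2 - a t i.-1 ^+ 2)).
Hypothesis ac : forall (t : R) i, 0 <= t -> (i <= N)%N -> c <= a t i.

Theorem flow_comparison (T : R) : 0 <= T ->
  n^-1 * \sum_(1 <= i < N.+1) (x T i - X T (theta i)) ^+ 2 <=
  expR (- decay c G * T) * (n^-1 * \sum_(1 <= i < N.+1) (x 0 i - X 0 (theta i)) ^+ 2)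
  + Kerr c C G l * n ^- 4.
Proof.
move=> T0; apply/ler_addgt0Pr => e e0.
have d0 : 0 < decay c G by exact: decay_gt0.
pose Ke := (Kosc c C G + 2 * Kflux c C G * Ktime c G) / decay c G.
(* [Ke] is the coefficient of eta in [lyapunov]; with this choice the corresponding error is at most
   e. *)
pose eta := Num.min 1 (e / (`|Ke| + 1)).
have Ke1 : 0 < `|Ke| + 1 by rewrite ltr_wpDl.
have eta0 : 0 < eta by rewrite lt_min ltr01 divr_gt0.
have eta1 : eta <= 1 by rewrite ge_min lexx.
have Kee : Ke * eta <= e.
  apply: (@le_trans _ _ (`|Ke| * eta)); first by rewrite ler_wpM2r ?(ltW eta0)// ler_norm.
  apply: (@le_trans _ _ ((`|Ke| + 1) * eta)); first by rewrite ler_wpM2r ?(ltW eta0)// lerDl.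
  by rewrite -ler_pdivlMl// mulrC ge_min lexx orbT.
have T10 : 0 <= T + 1 by rewrite addr_ge0.
have [d1 d10 d1P] := uniform_continuity T10 eta0 (flow_cg flowX).
(* A time quotient over a step s < d1 is a value of g at an intermediate time, hence within eta of
   g. *)
pose s := Num.min 1 (d1 / 2).
have s0 : 0 < s by rewrite lt_min ltr01 divr_gt0.
have s1 : s <= 1 by rewrite ge_min lexx.
have sd1 : s < d1 by rewrite gt_min [d1 / 2 < d1]ltr_pdivrMr// ltr_pMr// ltr1n orbT.
pose K9 := 2 * G ^+ 2 / c ^+ 2 + 2 * C / c + 4 * C * G ^+ 2 / c ^+ 3.
have K90 : 0 <= K9.
  have c0' := ltW c0; have C0' := ltW C0; rewrite /K9.
  apply: addr_ge0; first apply: addr_ge0; apply: divr_ge0; rewrite ?exprn_ge0//.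
  - by apply: mulr_ge0 => //; exact: exprn_ge0.
  - exact: mulr_ge0.
  - by apply: mulr_ge0; [exact: mulr_ge0|exact: exprn_ge0].
(* By [fine_consistency] the grid error is at most K9 (e1 + 1 / M) <= 2 K9 e1, where M is the number
   of meshes; it must not exceed eta s^2. *)
pose e1 := Num.min eta (eta * s ^+ 2 / (2 * (K9 + 1))).
have K91 : 0 < 2 * (K9 + 1) by rewrite mulr_gt0// ltr_wpDl.
have es0 : 0 < eta * s ^+ 2 by rewrite mulr_gt0 ?exprn_gt0.
have e10 : 0 < e1 by rewrite lt_min eta0 divr_gt0.
have e1eta : e1 <= eta by rewrite ge_min lexx.
have [d2 d20 d2P] := uniform_continuity T10 e10 (flow_cg flowX).
pose w := Num.min d2 e1.
have w0 : 0 < w by rewrite lt_min d20.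
pose k := (Num.trunc w^-1).+1.
have kw : w^-1 < k%:R.
  have wi : 0 <= w^-1 by rewrite invr_ge0 ltW.
  by have /andP[] := truncn_itv wi.
have k0 : (0 < k)%N by [].
have M0 : (0 < 2 * N * k)%N by rewrite !muln_gt0 N0.
have mw : (2 * N * k)%:R^-1 < w.
  rewrite -[ltRHS]invrK ltf_pV2 ?posrE ?invr_gt0 ?ltr0n//.
  by apply: (lt_le_trans kw); rewrite ler_nat leq_pmull// muln_gt0 N0.
have mod1 (t y z : R) : 0 <= t <= T + 1 -> 0 <= y <= 1 -> 0 <= z <= 1 ->
    `|y - z| <= (2 * N * k)%:R^-1 -> `|g t y - g t z| <= e1.
  move=> tT y1 z1 yz; apply/ltW/d2P => //; first by rewrite subrr normr0.
  by apply: (le_lt_trans yz); apply: (lt_le_trans mw); rewrite ge_min lexx.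
have kappa (t : R) (j : nat) : 0 <= t <= T + 1 -> (0 < j < 2 * N * k)%N ->
  `|g t (j%:R / (2 * N * k)%:R) - (2 * N * k)%:R / 4 *
     (slope (2 * N * k) (X t) j ^+ 2 - slope (2 * N * k) (X t) j.-1 ^+ 2)| <= eta * s ^+ 2.
  move=> tT jM; have t0 : 0 <= t by case/andP: tT.
  have cXt : continuous (X t) by exact: (flow_cXy flowX).
  have cut : continuous (u t) by exact: (flow_cuy flowX).
  have dXt (y : R) : 0 < y < 1 -> is_derive y (1 : R) (X t) (u t y) by exact: (flow_dy flowX).
  have dut (y : R) : 0 < y < 1 -> is_derive y (1 : R) (u t) (2 * g t y / u t y).
    by exact: (flow_du flowX c0 C0 slope0).
  have ubt (y : R) : 0 <= y <= 1 -> c <= u t y <= C.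
    by move=> y01; exact: (flow_u_bounds flowX c0 C0 slope0).
  have gbt (y : R) : 0 <= y <= 1 -> `|g t y| <= G.
    by move=> y01; exact: (flow_g_bound flowX c0 C0 G0 slope0 g0).
  apply: (le_trans (fine_consistency c0 G0 cXt cut dXt dut ubt gbt M0
    (fun y z => mod1 t y z tT) jM)).
  rewrite -/K9; apply: (@le_trans _ _ (K9 * (2 * (eta * s ^+ 2 / (2 * (K9 + 1)))))).
    rewrite ler_wpM2l//; have : (2 * N * k)%:R^-1 <= e1.
      by apply: ltW; apply: (lt_le_trans mw); rewrite ge_min lexx orbT.
    have : e1 <= eta * s ^+ 2 / (2 * (K9 + 1)) by rewrite ge_min lexx orbT.
    by lra.
  have K91' : K9 + 1 != 0 by rewrite gt_eqF// ltr_wpDl.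
  have -> : K9 * (2 * (eta * s ^+ 2 / (2 * (K9 + 1)))) = (eta * s ^+ 2) * (K9 / (K9 + 1)).
    by field.
  rewrite ler_piMr ?(ltW es0)// ler_pdivrMr ?mul1r ?lerDl// ltr_wpDl//.
have gW (t y : R) : 0 <= t <= T -> 0 <= y <= 1 -> `|g t y - (X (t + s) y - X t y) / s| <= eta.
  move=> /andP[t0 tT] y01.
  have tts : t < t + s by rewrite ltrDl.
  have dXr (q : R) : q \in `]t, (t + s)[ -> is_derive q (1 : R) (X ^~ y) (g q y).
    rewrite in_itv/= => /andP[tq _]; apply: (flow_dt flowX) => //; exact: le_lt_trans tq.
  have cXr : continuous (X ^~ y) by exact: (flow_cXt flowX).
  have [q] := MVT tts dXr (continuous_subspaceT cXr).
  rewrite in_itv/= => /andP[tq qs] ->; rewrite addrAC subrr add0r mulfK ?gt_eqF//.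
  apply/ltW/d1P => //; rewrite ?subrr ?normr0//.
  - by move: T0; lra.
  - by move: s1; lra.
  - by rewrite ltr0_norm; move: sd1; lra.
have ge (t y z : R) : 0 <= t <= T -> 0 <= y <= 1 -> 0 <= z <= 1 ->
    `|y - z| <= (2 * N * k)%:R^-1 -> `|g t y - g t z| <= eta.
  move=> /andP[t0 tT] y1 z1 yz; apply: le_trans e1eta; apply: mod1 => //.
  by move: t0 tT; lra.
have s01 : 0 < s <= 1 by rewrite s0.
have eta01 : 0 < eta <= 1 by rewrite eta0.
have := lyapunov flowX c0 C0 G0 slope0 g0 l0 glip N0 cx dx ac T0 s01 eta01 k0
  (ltW es0) (lexx _) kappa gW ge.
by move: Kee; rewrite /Ke; lra.
Qed.

End FlowComparison.

(** * Regularity up to the boundary and initial data *)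

Section FromDefinition.
Context {R : realType}.

(** The positive part; [clamp_unit] is the projection on [0, 1], written with two positive parts.
    Composition with these retractions turns continuity within the strip into continuity on the
    plane. *)
Definition clamp_time (t : R) : R := (t + `|t|) / 2.
Definition clamp_unit (y : R) : R := 1 - clamp_time (1 - clamp_time y).

Lemma clamp_time_ge0 t : 0 <= clamp_time t.
Proof. by rewrite /clamp_time divr_ge0// -lerBlDl sub0r -normrN ler_norm. Qed.

Lemma clamp_time_id t : 0 <= t -> clamp_time t = t.
Proof. by move=> t0; rewrite /clamp_time ger0_norm//; field. Qed.

Lemma clamp_unit01 y : 0 <= clamp_unit y <= 1.
Proof.
rewrite /clamp_unit; have := clamp_time_ge0 y; move: (clamp_time y) => z z0.
rewrite /clamp_time; have [z1|z1] := leP 0 (1 - z); [rewrite ger0_norm//|rewrite ltr0_norm//]; lra.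
Qed.

Lemma clamp_unit_id y : 0 <= y <= 1 -> clamp_unit y = y.
Proof.
move=> /andP[y0 y1]; rewrite /clamp_unit (clamp_time_id y0) clamp_time_id ?subr_ge0//; ring.
Qed.

Lemma continuous_clamp_time : continuous clamp_time.
Proof.
move=> t; apply: cvgM; last exact: cvg_cst.
by apply: cvgD; [exact: cvg_id|exact: norm_continuous].
Qed.

Lemma continuous_clamp_unit : continuous clamp_unit.
Proof.
move=> y; apply: cvgB; first exact: cvg_cst.
apply: (@cvg_comp _ _ _ (fun y => 1 - clamp_time y) clamp_time _ (nbhs (1 - clamp_time y))).
  by apply: cvgB; [exact: cvg_cst|exact: continuous_clamp_time].
exact: continuous_clamp_time.
Qed.

Let strip : set (R * R) := `[0, +oo[%classic `*` `[0, 1]%classic.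

Lemma continuous_clamp (f : R -> R -> R) :
  {within strip, continuous (fun p : R * R => f p.1 p.2)} ->
  continuous (fun p : R * R => f (clamp_time p.1) (clamp_unit p.2)).
Proof.
move=> cf p; pose k (q : R * R) := (clamp_time q.1, clamp_unit q.2).
have kstrip q : strip (k q).
  by split => /=; rewrite in_itv/= ?clamp_time_ge0// clamp_unit01.
have kc : k q @[q --> p] --> k p.
  apply: (@cvg_pair _ _ _ _ (nbhs (clamp_time p.1)) (nbhs (clamp_unit p.2))).
    by apply: (@cvg_comp _ _ _ fst _ _ (nbhs p.1)); [exact: cvg_fst|exact: continuous_clamp_time].
  by apply: (@cvg_comp _ _ _ snd _ _ (nbhs p.2)); [exact: cvg_snd|exact: continuous_clamp_unit].
move/subspace_continuousP : cf => /(_ _ (kstrip p)) cf.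
apply: (@cvg_comp _ _ _ k (fun q => f q.1 q.2) _ (within strip (nbhs (k p)))); last exact: cf.
move=> U kU; suff : nbhs p (fun q => U (k q)) by [].
have : nbhs p (fun q => strip (k q) -> U (k q)) by exact: (kc _ kU).
by apply: filterS => q h; exact: (h (kstrip q)).
Qed.

Lemma is_derive_near (f h : R -> R) (a l d : R) : 0 < d ->
  (forall y, `|y - a| < d -> f y = h y) -> is_derive a (1 : R) f l -> is_derive a (1 : R) h l.
Proof.
move=> d0 fh; apply: near_eq_is_derive; apply/nbhs_ballP; exists d => //= y.
by rewrite -ball_normE /= distrC; exact: fh.
Qed.

Lemma nbhs_unit (a : R) : 0 < a < 1 -> nbhs a `[0, 1]%classic.
Proof.
move=> /andP[a0 a1]; apply: (@filterS _ (nbhs a) _ `]0, 1[%classic).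
  by move=> y /=; rewrite !in_itv/= => /andP[/ltW -> /ltW ->].
by apply: near_in_itvoo; rewrite in_itv/= a0.
Qed.

Lemma nbhs_half_line (a : R) : 0 < a -> nbhs a `[0, +oo[%classic.
Proof.
move=> a0; apply: filterS (lt_nbhsr a0) => y /= y0; by rewrite in_itv/= andbT ltW.
Qed.

Lemma near_unit (a : R) : 0 < a < 1 -> exists2 d, 0 < d & forall y, `|y - a| < d -> 0 <= y <= 1.
Proof.
move=> /andP[a0 a1]; exists (Num.min a (1 - a)); first by rewrite lt_min a0 subr_gt0.
by move=> y; rewrite lt_min !ltr_norml => /andP[/andP[h1 _] /andP[_ h2]]; lra.
Qed.

(** The functions are precomposed with the clamps. The equation holds at t = 0 as well, and
    [derive_in] only sees values on [0, 1]; the last two clauses therefore read u 0 and g 0 off the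
    initial datum. *)
Lemma gradient_flow_classical (X0 : R -> R) (X : R -> R -> R) : F_gradient_flow X0 X ->
  exists X' u g, [/\ classical_flow X' u g,
    forall t y : R, 0 <= t -> 0 <= y <= 1 -> X' t y = X t y,
    forall y : R, 0 <= y <= 1 -> u 0 y = derive_in `[0, 1] X0 y &
    forall y : R, 0 < y < 1 ->
      is_derive y (1 : R) (fun z => derive_in `[0, 1] X0 z ^+ 2) (4 * g 0 y)].
Proof.
move=> [[cX cg cu] [dX [bnd init]]].
pose X' t y := X (clamp_time t) (clamp_unit y).
pose u t y := dth X (clamp_time t) (clamp_unit y).
pose g t y := dt X (clamp_time t) (clamp_unit y).
have fluxE (t y : R) : 0 <= t -> 0 < y < 1 -> is_derive y (1 : R) (fun z => dth X t z ^+ 2) (4 * g t y).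
  move=> t0 y01; have y01' : 0 <= y <= 1 by case/andP: y01 => *; rewrite !ltW.
  have [_ _ d3 d4] := dX t y t0 y01'.
  have gE : g t y = 4^-1 * dth (fun s y => dth X s y ^+ 2) t y.
    by rewrite /g (clamp_time_id t0) (clamp_unit_id y01').
  have -> : 4 * g t y = dth (fun s y => dth X s y ^+ 2) t y by rewrite gE; field.
  by apply: is_derive_derive_in => //; exact: nbhs_unit.
exists X', u, g; split.
- split.
  + exact: continuous_clamp.
  + exact: continuous_clamp.
  + exact: continuous_clamp.
  + move=> t y t0 y01; have [d1 _ _ _] := dX t y (ltW t0) y01.
    have -> : g t y = dt X t y by rewrite /g (clamp_time_id (ltW t0)) (clamp_unit_id y01).
    apply: (is_derive_near (f := X ^~ y) t0) => [s|]; last first.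
      by apply: is_derive_derive_in => //; exact: nbhs_half_line.
    rewrite ltr_norml => /andP[s0 _].
    by rewrite /X' clamp_time_id ?clamp_unit_id//; lra.
  + move=> t y t0 y01; have y01' : 0 <= y <= 1 by case/andP: y01 => *; rewrite !ltW.
    have [_ d2 _ _] := dX t y t0 y01'; have [d d0 dP] := near_unit y01.
    have -> : u t y = dth X t y by rewrite /u (clamp_time_id t0) (clamp_unit_id y01').
    apply: (is_derive_near (f := X t) d0) => [z /dP z01|].
      by rewrite /X' clamp_time_id// clamp_unit_id.
    by apply: is_derive_derive_in => //; exact: nbhs_unit.
  + move=> t y t0 y01; have [d d0 dP] := near_unit y01.
    apply: (is_derive_near d0 _ (fluxE _ _ t0 y01)) => z /dP z01.
    by rewrite /u clamp_time_id// clamp_unit_id.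
  + by move=> t t0; rewrite /X' clamp_time_id// clamp_unit_id ?lexx ?ler01// (bnd t t0).1.
  + by move=> t t0; rewrite /X' clamp_time_id// clamp_unit_id ?lexx ?ler01// (bnd t t0).2.
- by move=> t y t0 y01; rewrite /X' clamp_time_id// clamp_unit_id.
- move=> y y01; rewrite /u clamp_time_id// clamp_unit_id//.
  apply: eq_derive_in => [|z]; first by rewrite /= in_itv.
  by rewrite /= in_itv/=; exact: init.
- move=> y y01; have [d d0 dP] := near_unit y01.
  apply: (is_derive_near d0 _ (fluxE 0 y (lexx _) y01)) => z /dP z01.
  congr (_ ^+ 2); apply: eq_derive_in => [|v]; first by rewrite /= in_itv.
  by rewrite /= in_itv/=; exact: init.
Qed.

(** Each summand of the norm is a supremum of nonnegative numbers over a nonempty set, so any single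
    one is at most the total. *)
Lemma in_holder_bounds (alpha K : R) (f : R -> R) : in_holder `[0, 1]%classic 4 alpha f ->
  holder_norm `[0, 1]%classic 4 alpha f = K%:E ->
  forall j (y : R), (j <= 4)%N -> 0 <= y <= 1 -> `|derive_in_n `[0, 1]%classic j f y| <= K.
Proof.
move=> _ nK j y j4 y01.
have sup0 i : (0 <= ereal_sup [set `|derive_in_n `[0, 1]%classic i f a|%:E | a in `[0%R, 1%R]%classic])%E.
  apply: (@le_trans _ _ (`|derive_in_n `[0, 1]%classic i f 0|%:E)); first by rewrite lee_fin.
  by apply: ereal_sup_ubound; exists 0 => //=; rewrite in_itv/= lexx ler01.
rewrite -lee_fin -nK /holder_norm.
apply: (@le_trans _ _ (ereal_sup [set `|derive_in_n `[0, 1]%classic j f a|%:E | a in `[0%R, 1%R]%classic])).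
  by apply: ereal_sup_ubound; exists y => //=; rewrite in_itv.
apply: (@le_trans _ _ (\sum_(j < 5) ereal_sup [set `|derive_in_n `[0, 1]%classic j f a|%:E | a in `[0%R, 1%R]%classic])%E).
  by rewrite (bigD1 (Ordinal (j4 : (j < 5)%N)))//= leeDl// sume_ge0.
rewrite leeDl//.
apply: (@le_trans _ _ ((`|derive_in_n `[0, 1]%classic 4 f 0 - derive_in_n `[0, 1]%classic 4 f 1|
             / `|0 - 1| `^ alpha)%:E)).
  by rewrite lee_fin divr_ge0// powR_ge0.
apply: ereal_sup_ubound; exists (0, 1) => //=; split; rewrite ?in_itv/= ?lexx ?ler01//.
by rewrite eq_sym oner_eq0.
Qed.

End FromDefinition.

(** * Bounds for the initial speed *)

Section InitialData.
Context {R : realType}.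
Variables (c C K alpha : R) (X0 v : R -> R).
Hypotheses (C0 : 0 < C) (c0 : 0 < c).
Hypothesis X0holder : in_holder `[0, 1]%classic 4 alpha X0.
Hypothesis X0norm : holder_norm `[0, 1]%classic 4 alpha X0 = K%:E.
Hypothesis X0slope : forall th : R, 0 <= th <= 1 -> c <= derive_in `[0, 1]%classic X0 th <= C.
Hypothesis cv : continuous v.
Hypothesis vE : forall y : R, 0 < y < 1 ->
  is_derive y (1 : R) (fun z => derive_in `[0, 1]%classic X0 z ^+ 2) (4 * v y).

Let f j := derive_in_n `[0, 1]%classic j X0.

Let fK j (y : R) : (j <= 4)%N -> 0 <= y <= 1 -> `|f j y| <= K.
Proof. exact: (in_holder_bounds X0holder X0norm). Qed.

Let df j (y : R) : (j < 4)%N -> 0 < y < 1 -> is_derive y (1 : R) (f j) (f j.+1 y).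
Proof.
move=> j4 y01; apply: is_derive_derive_in; first exact: nbhs_unit.
apply: X0holder.1 => //=; rewrite in_itv/=; by case/andP: y01 => /ltW -> /ltW ->.
Qed.

Lemma initial_speed (y : R) : 0 < y < 1 -> v y = f 1 y * f 2 y / 2.
Proof.
move=> y01; have H := is_deriveM (df (isT : (1 < 4)%N) y01) (df (isT : (1 < 4)%N) y01).
have E := is_derive_unique (vE y01) H.
by move: E; rewrite /GRing.scale /= -/(f 2 y); lra.
Qed.

Lemma initial_speed_bound (y : R) : 0 < y < 1 -> `|v y| <= C * `|K|.
Proof.
move=> y01; have y01' : 0 <= y <= 1 by case/andP: y01 => /ltW -> /ltW ->.
rewrite initial_speed// !normrM (@gtr0_norm _ 2^-1)//.
have h1 : `|f 1 y| <= C by have /andP[h1 h2] := X0slope y01'; rewrite ger0_norm// (le_trans (ltW c0)).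
have h2 : `|f 2 y| <= `|K| by apply: (le_trans (fK (isT : (2 <= 4)%N) y01')); exact: ler_norm.
have := ler_pM (normr_ge0 _) (normr_ge0 _) h1 h2.
have : 0 <= C * `|K| by rewrite mulr_ge0// ltW.
by lra.
Qed.

(** The derivative of the initial speed X0' X0'' / 2 is (X0' X0''' + X0''^2) / 2. *)
Lemma initial_speed_lip (y z : R) : 0 <= y <= 1 -> 0 <= z <= 1 ->
  `|v y - v z| <= (K ^+ 2 + C * `|K|) * `|y - z|.
Proof.
wlog yz : y z / z < y.
  move=> H y01 z01; have [yz|zy|->] := ltgtP z y; first exact: H.
    by rewrite distrC [`|y - z|]distrC; exact: H.
  by rewrite !subrr !normr0 mulr0.
move=> /andP[y0 y1] /andP[z0 z1].
have dv (w : R) : 0 < w < 1 -> is_derive w (1 : R) v ((f 1 w * f 3 w + f 2 w * f 2 w) / 2).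
  move=> w01; have [d d0 dP] : exists2 d : R, 0 < d & forall q, `|q - w| < d -> 0 < q < 1.
    case/andP: w01 => a0 a1; exists (Num.min w (1 - w)); first by rewrite lt_min a0 subr_gt0.
    by move=> q; rewrite lt_min !ltr_norml => /andP[/andP[h1 _] /andP[_ h2]]; lra.
  apply: (is_derive_near (f := fun q => 2^-1 * (f 1 q * f 2 q)) d0).
    by move=> q /dP q01; rewrite initial_speed// mulrC.
  have H := is_deriveM (df (isT : (1 < 4)%N) w01) (df (isT : (2 < 4)%N) w01).
  rewrite mulrC; exact: (@is_deriveZ _ _ _ _ 2^-1 _ _ _ H).
have [w w01 ->] := MVT01 z0 yz y1 cv dv.
rewrite normrM ler_wpM2r//.
have w01' : 0 <= w <= 1 by move: w01 y1 z0; lra.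
have h1 : `|f 1 w| <= C by have /andP[h1 h2] := X0slope w01'; rewrite ger0_norm// (le_trans (ltW c0)).
have h2 : `|f 2 w| <= `|K| by apply: (le_trans (fK (isT : (2 <= 4)%N) w01')); exact: ler_norm.
have h3 : `|f 3 w| <= `|K| by apply: (le_trans (fK (isT : (3 <= 4)%N) w01')); exact: ler_norm.
rewrite normrM (@gtr0_norm _ 2^-1)// -(real_normK (num_real K)).
have := ler_normD (f 1 w * f 3 w) (f 2 w * f 2 w); rewrite !normrM.
have := ler_pM (normr_ge0 _) (normr_ge0 _) h1 h3.
have := ler_pM (normr_ge0 _) (normr_ge0 _) h2 h2; rewrite -expr2.
have : 0 <= `|K| ^+ 2 by exact: sqr_ge0.
have : 0 <= C * `|K| by rewrite mulr_ge0// ltW.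
by rewrite expr2; lra.
Qed.

End InitialData.

(** * The gradient of F_N2 and the point dynamics *)

Section Quantization.
Context {R : realType}.
Local Notation mu := (@lebesgue_measure R).

Lemma big_mine_eq (f : nat -> \bar R) (N k : nat) : (1 <= k <= N)%N ->
  (forall j, (1 <= j <= N)%N -> (f k <= f j)%E) ->
  (\big[mine/+oo]_(1 <= i < N.+1) f i = f k)%E.
Proof.
move=> kN fk; apply/le_anti/andP; split.
  have H m d : (m + d = N.+1)%N -> (m <= k)%N -> (\big[mine/+oo%E]_(m <= i < N.+1) f i <= f k)%E.
    elim: d m => [|d IH] m; first by rewrite addn0 => ->; move: kN; lia.
    move=> mE; rewrite leq_eqVlt => /predU1P[->|mk].
      by rewrite big_ltn ?ge_min ?lexx//; move: kN; lia.
    rewrite big_ltn; last by move: mE; lia.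
    by rewrite ge_min IH ?orbT//; move: mE; lia.
  by apply: (H 1%N N); [rewrite add1n|case/andP: kN].
rewrite big_nat_cond; elim/big_ind : _ => [|a b fa fb|j]; first exact: leey.
  by rewrite le_min fa fb.
by rewrite andbT => /andP[j1 jN]; apply: fk; rewrite j1.
Qed.

Lemma measurable_big_mine d (S : measurableType d) (f : nat -> S -> \bar R) (D : set S) (m n : nat) :
  (forall i, measurable_fun D (f i)) ->
  measurable_fun D (fun y => \big[mine/+oo%E]_(m <= i < n) f i y).
Proof.
move=> mf; have [nm|mn] := leqP n m.
  rewrite (_ : (fun _ => _) = (fun=> +oo%E)); first exact: measurable_cst.
  by apply/funext => y; rewrite big_geq.
have [q dE] : exists q, (m + q = n)%N by exists (n - m)%N; rewrite subnKC// ltnW.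
elim: q m dE {mn} => [|q IH] m dE.
  rewrite (_ : (fun _ => _) = (fun=> +oo%E)); first exact: measurable_cst.
  by apply/funext => y; rewrite big_geq// -dE addn0.
rewrite (_ : (fun _ => _) = (fun y => mine (f m y) (\big[mine/+oo%E]_(m.+1 <= i < n) f i y))).
  by apply: measurable_mine => //; apply: IH; rewrite -dE addnS.
by apply/funext => y; rewrite big_ltn// -dE addnS ltnS leq_addr.
Qed.

Lemma is_derive_cube (f : R -> R) (l s : R) : is_derive s (1 : R) f l ->
  is_derive s (1 : R) (fun s => f s ^+ 3) (3 * f s ^+ 2 * l).
Proof.
move=> df; have := is_deriveM (is_deriveM df df) df.
have -> : (fun s => f s ^+ 3) = f * f * f.
  by apply/funext => z; rewrite (_ : (f * f * f) z = f z * f z * f z)//; ring.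
have -> // : 3 * f s ^+ 2 * l = f s * f s * l + f s * (f s * l + f s * l) by ring.
Qed.

Lemma integral_cubic (a p q : R) : p <= q ->
  (\int[mu]_(y in `[p, q]) (`|a - y| ^+ 2)%:E = (((q - a) ^+ 3 - (p - a) ^+ 3) / 3)%:E)%E.
Proof.
rewrite le_eqVlt => /predU1P[<-|pq].
  by rewrite set_itv1 integral_set1 subrr mul0r.
have dF (y : R) : is_derive y (1 : R) (fun y => (y - a) ^+ 3 / 3) ((y - a) ^+ 2).
  have d1 : is_derive y (1 : R) (fun y => y - a) 1.
    by rewrite -[X in is_derive _ _ _ X]subr0; exact: is_deriveB (is_derive_id y 1) (is_derive_cst a y (1 : R)).
  have H := @is_deriveZ _ _ _ _ 3^-1 _ _ _ (is_derive_cube d1).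
  have -> : (fun y => (y - a) ^+ 3 / 3) = 3^-1 \*: (fun y => (y - a) ^+ 3).
    by apply/funext => z; rewrite mulrC.
  have E : 3^-1 * (3 * (y - a) ^+ 2 * 1) = (y - a) ^+ 2 by field.
  by rewrite -[X in is_derive _ _ _ X]E; exact: H.
have cf : continuous (fun y : R => (y - a) ^+ 2).
  by move=> y; apply: cvgM; apply: cvgB; (exact: cvg_id || exact: cvg_cst).
have cF : continuous (fun y : R => (y - a) ^+ 3 / 3).
  by move=> y; exact: is_derive_continuous (dF y).
under eq_integral do rewrite distrC (real_normK (num_real _)).
rewrite (continuous_FTC2 pq (F := fun y => (y - a) ^+ 3 / 3)).
- by rewrite -EFinB mulrBl.
- exact: continuous_subspaceT.
- split; first by move=> y _; exact: ex_derive.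
    by apply: cvg_at_right_filter; exact: cF.
  by apply: cvg_at_left_filter; exact: cF.
- by move=> y _; rewrite derive1E; exact: derive_val.
Qed.

Lemma integral_itv_split (h : measurableTypeR R -> \bar R) (p q r : R) : measurable_fun setT h ->
  (forall y, 0 <= h y)%E -> p <= q -> q <= r ->
  (\int[mu]_(y in `[p, r]) h y = \int[mu]_(y in `[p, q]) h y + \int[mu]_(y in `[q, r]) h y)%E.
Proof.
move=> mh h0 pq qr.
have -> : `[p, r]%classic = `[p, q]%classic `|` `]q, r]%classic.
  by rewrite -itv_bndbnd_setU// bnd_simp.
rewrite ge0_integral_setU//.
- by congr (_ + _)%E; rewrite integral_itv_obnd_cbnd//; exact: measurable_funTS.
- exact: measurable_funTS.
- apply/disj_set2P; rewrite -subset0 => y /= []; rewrite !in_itv/= => /andP[_ yq] /andP[qy _].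
  by move: yq; rewrite leNgt qy.
Qed.

Section Formula.
Variables (N : nat) (x : nat -> R).
Hypothesis N0 : (0 < N)%N.
Local Notation gh := (ghost_extend N x).
Hypothesis ghS : forall k, (k <= N)%N -> gh k <= gh k.+1.

Let p (k : nat) : R := (gh k + gh k.+1) / 2.

Let ghE j : (1 <= j <= N)%N -> gh j = x j.
Proof. by move=> /andP[j1 jN]; rewrite /ghost_extend gtn_eqF// ltn_eqF. Qed.

Let gh_mono i j : (i <= j <= N.+1)%N -> gh i <= gh j.
Proof.
move=> /andP[ij]; elim: j ij => [|j IH]; first by rewrite leqn0 => /eqP ->.
rewrite leq_eqVlt => /predU1P[->//|ij] jN.
by apply: le_trans (ghS jN); apply: IH => //; exact: ltnW.
Qed.

Let p_mono k : (1 <= k <= N)%N -> p k.-1 <= p k.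
Proof.
move=> /andP[k1 kN]; rewrite /p prednK//.
have := ghS kN; have : gh k.-1 <= gh k by apply: gh_mono; rewrite leq_pred ltnW.
by lra.
Qed.

Let nearest k (z : R) j : (1 <= k <= N)%N -> p k.-1 <= z <= p k -> (1 <= j <= N)%N ->
  `|gh k - z| ^+ 2 <= `|gh j - z| ^+ 2.
Proof.
move=> /andP[k1 kN] /andP[z1 z2] /andP[j1 jN]; rewrite !(real_normK (num_real _)) -subr_ge0.
have -> : (gh j - z) ^+ 2 - (gh k - z) ^+ 2 = (gh j - gh k) * (gh j + gh k - 2 * z) by ring.
have [jk|kj|->] := ltngtP j k; last by rewrite subrr mul0r.
  have h1 : gh j <= gh k.-1 by apply: gh_mono; rewrite -ltnS prednK// jk/= (leq_trans (leq_pred _))// ltnW.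
  have h2 : gh k.-1 <= gh k by apply: gh_mono; rewrite leq_pred ltnW.
  by rewrite mulr_le0//; move: z1; rewrite /p prednK//; lra.
have h1 : gh k.+1 <= gh j by apply: gh_mono; rewrite kj ltnW.
have h2 := ghS kN.
by rewrite mulr_ge0//; move: z2; rewrite /p; lra.
Qed.

(** The minimum is attained at x k on the Voronoi cell between the midpoints p k.-1 and p k. Each of
    its two parts has the length of half a gap and contributes (gap / 2)^3 / 3 = gap^3 / 24. The
    ghost points put p 0 at 0 and p N at 1. *)
Lemma F_N2_gaps : F_N2 N (fun=> 1) x = \sum_(1 <= k < N.+1)
  ((gh k.+1 - gh k) ^+ 3 + (gh k - gh k.-1) ^+ 3) / 24.
Proof.
pose h (y : measurableTypeR R) := (\big[mine/+oo]_(1 <= i < N.+1) (`|x i - y| ^+ 2)%:E * 1%:E)%E.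
have mh : measurable_fun setT h.
  have -> : h = (fun y => \big[mine/+oo]_(1 <= i < N.+1) (`|x i - y| ^+ 2)%:E)%E.
    by apply/funext => y; rewrite /h mule1.
  apply: (@measurable_big_mine _ (measurableTypeR R) (fun i (y : measurableTypeR R) => (`|x i - y| ^+ 2)%:E)) => i.
  apply/measurable_EFinP; apply: continuous_measurable_fun => y.
  apply: (@cvgM _ _ _ _ (fun y => `|x i - y|) (fun y => `|x i - y|));
    apply: cvg_norm; apply: cvgB; (exact: cvg_cst || exact: cvg_id).
have h0 y : (0 <= h y)%E.
  rewrite /h mule1; elim/big_ind : _ => [|u v u0 v0|i _]; first exact: leey.
    by rewrite le_min u0 v0.
  by rewrite lee_fin sqr_ge0.
have pieces K : (K <= N)%N -> (\int[mu]_(y in `[p 0%N, p K]) h y =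
    \sum_(1 <= k < K.+1) \int[mu]_(y in `[p k.-1, p k]) h y)%E.
  elim: K => [_|K IH KN]; first by rewrite big_geq// set_itv1 integral_set1.
  rewrite big_nat_recr//= -IH ?(ltnW KN)// (@integral_itv_split h (p 0%N) (p K) (p K.+1))//.
    elim: K {IH} KN => // K IH KN; apply: (le_trans (IH (ltnW KN))).
    exact: (p_mono (k := K.+1) (ltnW KN)).
  exact: (p_mono (k := K.+1) KN).
have p0 : p 0%N = 0.
  have h1 : gh 1%N = x 1%N by apply: ghE; rewrite N0.
  by rewrite /p h1 /ghost_extend /= addNr mul0r.
have pN : p N = 1.
  have h1 : gh N = x N by apply: ghE; rewrite N0 leqnn.
  by rewrite /p h1 /ghost_extend /= eqxx; field.
have := pieces N (leqnn N); rewrite p0 pN => E.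
have -> : F_N2 N (fun=> 1) x = fine (\int[mu]_(y in `[0%R, 1%R]) h y)%E by [].
rewrite E.
have -> : (\sum_(1 <= k < N.+1) \int[mu]_(y in `[p k.-1, p k]) h y =
   \sum_(1 <= k < N.+1) (((gh k.+1 - gh k) ^+ 3 + (gh k - gh k.-1) ^+ 3) / 24)%:E)%E.
  apply: eq_big_nat => k kN; have kN' : (1 <= k <= N)%N by [].
  rewrite (eq_integral (fun y : measurableTypeR R => (`|gh k - (y : R)| ^+ 2)%:E)); last first.
    move=> y; rewrite inE /= in_itv/= => yp.
    rewrite /h mule1 (big_mine_eq kN')//; first by rewrite ghE.
    by move=> j jN; rewrite lee_fin -!ghE//; exact: nearest.
  rewrite integral_cubic; last exact: p_mono.
  by congr (_%:E); rewrite /p prednK; [field|case/andP: kN].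
by rewrite sumEFin.
Qed.

End Formula.

Lemma big_nat_delta (N i : nat) (d F : nat -> R) : (1 <= i <= N)%N ->
  (forall k, (1 <= k <= N)%N -> d k = if k == i then 1 else 0) ->
  \sum_(1 <= k < N.+1) d k * F k = F i.
Proof.
move=> /andP[i1 iN] dE.
rewrite (@big_cat_nat _ _ _ i)//=; last exact: ltnW.
rewrite [X in _ + X]big_ltn//= big_nat big1 ?add0r; last first.
  move=> k /andP[k1 ki]; rewrite dE; last by rewrite k1 (leq_trans (ltnW ki)).
  by rewrite ltn_eqF// mul0r.
rewrite [X in _ + X]big_nat [X in _ + X]big1 ?addr0; last first.
  move=> k /andP[ik kN]; rewrite dE; last by rewrite (leq_trans i1 (ltnW ik)).
  by rewrite gtn_eqF// mul0r.
by rewrite dE ?i1// eqxx mul1r.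
Qed.

(** Every gap is shared by two neighbouring cells, except the first and the last. *)
Lemma half_weights (A : nat -> R) (N : nat) : (0 < N)%N ->
  \sum_(1 <= k < N.+1) (A k + A k.-1) =
  2 * \sum_(0 <= k < N.+1) (if (k == 0%N) || (k == N) then 2^-1 else 1) * A k.
Proof.
case: N => // N _.
rewrite big_split /= [X in _ + X]big_add1 /= big_nat_recr//= [X in _ + X]big_nat_recl//=.
rewrite [in RHS]big_nat_recl//= [in RHS]big_nat_recr//= eqxx.
rewrite [X in _ = 2 * (_ + (X + _))](_ : _ = \sum_(0 <= k < N) A k.+1); last first.
  apply: eq_big_nat => k /andP[_ kN].
  by rewrite eqSS (ltn_eqF kN) mul1r.
by rewrite big_add1 /=; field.
Qed.

(** Derivative of [ghost_extend] along points moving with velocity d; the additive constant 2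
    disappears. *)
Definition ghost_velocity (N : nat) (d : nat -> R) (j : nat) : R :=
  if j == 0%N then - d 1%N else if j == N.+1 then - d N else d j.

Lemma is_derive_ghost (N : nat) (y : R -> nat -> R) (d : nat -> R) (s : R) : (0 < N)%N ->
  (forall j, (1 <= j <= N)%N -> is_derive s (1 : R) (y ^~ j) (d j)) ->
  forall j, (j <= N.+1)%N ->
  is_derive s (1 : R) (fun r => ghost_extend N (y r) j) (ghost_velocity N d j).
Proof.
move=> N0 dy j jN; rewrite /ghost_velocity /ghost_extend.
case: eqP => [_|/eqP j0]; first by apply: is_deriveN; apply: dy.
case: eqP => [_|/eqP jN1].
  have dN : is_derive s (1 : R) (y ^~ N) (d N) by apply: dy; rewrite N0 leqnn.
  by have := is_deriveB (is_derive_cst (2 : R) s (1 : R)) dN; rewrite sub0r.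
by apply: dy; rewrite lt0n j0 -ltnS ltn_neqAle jN1.
Qed.

Section Gradient.
Variables (N : nat) (x : nat -> R) (i : nat).
Hypotheses (N0 : (0 < N)%N) (iN : (1 <= i <= N)%N).
Local Notation gh := (ghost_extend N x).
Hypothesis ghS : forall k, (k <= N)%N -> gh k < gh k.+1.

Let del (j : nat) : R := if j == i then 1 else 0.
Let dgh := ghost_velocity N del.
Let y (s : R) := set_coord x i s.

Let yx : y (x i) = x.
Proof. by apply/funext => j; rewrite /y /set_coord; case: eqP => [->|]. Qed.

Let dy (s : R) j : is_derive s (1 : R) (fun s => y s j) (del j).
Proof.
rewrite /y /set_coord /del; case: eqP => _; first exact: (is_derive_id s 1).
exact: (is_derive_cst (x j) s (1 : R)).
Qed.

Let dghE (s : R) j : (j <= N.+1)%N ->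
  is_derive s (1 : R) (fun s => ghost_extend N (y s) j) (dgh j).
Proof. by apply: is_derive_ghost => // k _; exact: dy. Qed.

(** Strict inequalities between consecutive points survive a small displacement of x i, so the
    formula of [F_N2_gaps] holds nearby and can be differentiated. *)
Lemma F_N2_derive : is_derive (x i) (1 : R) (fun s => F_N2 N (fun=> 1) (set_coord x i s))
  (- (((gh i.+1 - gh i) ^+ 2 - (gh i - gh i.-1) ^+ 2) / 4)).
Proof.
pose A k := (gh k.+1 - gh k) ^+ 2 * (dgh k.+1 - dgh k).
have near_gap : \forall s \near x i, forall k, (k < N.+1)%N ->
    ghost_extend N (y s) k < ghost_extend N (y s) k.+1.
  have H n : (n <= N.+1)%N -> \forall s \near x i, forall k, (k < n)%N ->
    ghost_extend N (y s) k < ghost_extend N (y s) k.+1.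
    elim: n => [_|n IH nN]; first by apply: filterE => s k; rewrite ltn0.
    have cgap : {for x i, continuous (fun s => ghost_extend N (y s) n.+1 - ghost_extend N (y s) n)}.
      by apply: cvgB; apply: is_derive_continuous; apply: dghE => //; exact: ltnW.
    have gap0 : 0 < ghost_extend N (y (x i)) n.+1 - ghost_extend N (y (x i)) n.
      by rewrite yx subr_gt0 ghS.
    have [d d0 dP] := cont_gt0_near cgap gap0.
    have near1 : \forall s \near x i, `|s - x i| < d.
      by apply/nbhs_ballP; exists d => //= s; rewrite -ball_normE /= distrC.
    near=> s => k; rewrite ltnS leq_eqVlt => /predU1P[->|kn].
      by rewrite -subr_gt0; apply: dP; near: s.
    move: k kn; near: s; exact: IH (ltnW nN).
  exact: H.
have {near_gap} near_eq : \forall s \near x i, \sum_(1 <= k < N.+1)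
   ((ghost_extend N (y s) k.+1 - ghost_extend N (y s) k) ^+ 3 +
    (ghost_extend N (y s) k - ghost_extend N (y s) k.-1) ^+ 3) / 24 =
    F_N2 N (fun=> 1) (set_coord x i s).
  near=> s.
  have gs : forall k, (k < N.+1)%N -> ghost_extend N (y s) k < ghost_extend N (y s) k.+1 by near: s.
  by rewrite F_N2_gaps// => k kN; apply: ltW; exact: gs.
apply: (near_eq_is_derive near_eq).
have D : is_derive (x i) (1 : R) (fun s => \sum_(1 <= k < N.+1)
   ((ghost_extend N (y s) k.+1 - ghost_extend N (y s) k) ^+ 3 +
    (ghost_extend N (y s) k - ghost_extend N (y s) k.-1) ^+ 3) / 24)
   (\sum_(1 <= k < N.+1) (A k + A k.-1) / 8).
  apply: (@is_derive_sum_nat R _ _ (fun s k => ((ghost_extend N (y s) k.+1 - ghost_extend N (y s) k) ^+ 3 +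
    (ghost_extend N (y s) k - ghost_extend N (y s) k.-1) ^+ 3) / 24)) => k /andP[k1 kN].
  have kp : (k.-1 <= N.+1)%N by rewrite (leq_trans (leq_pred _)) 1?ltnW.
  have d1 := is_derive_cube (is_deriveB (dghE (x i) (kN : (k.+1 <= N.+1)%N)) (dghE (x i) (ltnW kN))).
  have d2 := is_derive_cube (is_deriveB (dghE (x i) (ltnW kN)) (dghE (x i) kp)).
  have := @is_deriveZ _ _ _ _ 24^-1 _ _ _ (is_deriveD d1 d2).
  rewrite !fctE /= yx.
  suff -> : 24^-1 *: (3 * (gh k.+1 - gh k) ^+ 2 * (dgh k.+1 - dgh k) +
      3 * (gh k - gh k.-1) ^+ 2 * (dgh k - dgh k.-1)) = (A k + A k.-1) / 8.
    by congr (is_derive _ _ _ _); apply/funext => s; rewrite mulrC.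
  by rewrite /A prednK// /GRing.scale /=; field.
have -> : - (((gh i.+1 - gh i) ^+ 2 - (gh i - gh i.-1) ^+ 2) / 4) = \sum_(1 <= k < N.+1) (A k + A k.-1) / 8; last exact: D.
pose w k : R := if (k == 0%N) || (k == N) then 2^-1 else 1.
have nn : (N%:R : R) != 0 by rewrite pnatr_eq0 -lt0n.
(* The velocities of the extended points are antisymmetric at both ends, so [coarse_by_parts]
   applies with e the velocities and moves the difference onto the squared gaps. As only the point i
   moves, one term remains. *)
have parts := @coarse_by_parts R N dgh (fun k => N%:R * (dgh k.+1 - dgh k)) (fun=> 0) N0.
have dgh0 : dgh 0%N = - dgh 1%N by rewrite /dgh /ghost_velocity /= ltn_eqF// -[(1 < N.+1)%N]/(0 < N)%N N0.
have dghN : dgh N.+1 = - dgh N by rewrite /dgh /ghost_velocity /= eqxx gtn_eqF// ltn_eqF.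
have ab k : (k <= N)%N -> N%:R * (dgh k.+1 - dgh k) - 0 = N%:R * (dgh k.+1 - dgh k).
  by rewrite subr0.
have {parts} := parts dgh0 dghN ab (fun k => (gh k.+1 - gh k) ^+ 2).
have -> : \sum_(1 <= k < N.+1) dgh k * ((gh k.+1 - gh k) ^+ 2 - (gh k.-1.+1 - gh k.-1) ^+ 2) =
    (gh i.+1 - gh i) ^+ 2 - (gh i - gh i.-1) ^+ 2.
  rewrite (@big_nat_delta N i dgh (fun k => (gh k.+1 - gh k) ^+ 2 - (gh k.-1.+1 - gh k.-1) ^+ 2) iN).
    by rewrite prednK//; case/andP: iN.
  by move=> k /andP[k1 kN]; rewrite /dgh /ghost_velocity (gtn_eqF k1) (@ltn_eqF k N.+1).
move=> ->.
have -> : N%:R^-1 * \sum_(0 <= k < N.+1) w k * (N%:R * (dgh k.+1 - dgh k) - 0) * (gh k.+1 - gh k) ^+ 2 =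
    \sum_(0 <= k < N.+1) w k * A k.
  rewrite big_distrr /=; apply: eq_bigr => k _; rewrite subr0 /A; field.
  exact: nn.
by rewrite -mulr_suml (half_weights A N0); field.
Unshelve. all: by end_near.
Qed.

End Gradient.

End Quantization.

(** * Dynamics of the points and persistence of their gaps *)

Section PointDynamics.
Context {R : realType}.

Lemma derivable_in_continuous (A : set R) (f : R -> R) (a e : R) : derivable_in A f a -> 0 < e ->
  exists2 d, 0 < d & forall y, A y -> `|y - a| < d -> `|f y - f a| <= e.
Proof.
move=> df e0; have /cvgrPdist_le /(_ 1 ltr01) : (f y - f a) / (y - a) @[y --> within A a^'] -->
  derive_in A f a by exact: df.
set l := derive_in A f a => /nbhs_ballP[d /= d0 dP].
have l1 : 0 < `|l| + 1 by rewrite ltr_wpDl.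
exists (Num.min d (e / (`|l| + 1))); first by rewrite lt_min d0 divr_gt0.
move=> y Ay; rewrite lt_min => /andP[yd ye].
have [->|ya] := eqVneq y a; first by rewrite subrr normr0 ltW.
have ya0 : y - a != 0 by rewrite subr_eq0.
have q1 : `|l - (f y - f a) / (y - a)| <= 1 by apply: dP => //; rewrite -ball_normE /= distrC.
have q2 : `|(f y - f a) / (y - a)| <= `|l| + 1.
  by have := ler_normB l (l - (f y - f a) / (y - a)); rewrite subKr; lra.
rewrite -[f y - f a](divfK ya0) normrM.
apply: (@le_trans _ _ ((`|l| + 1) * `|y - a|)); first exact: ler_wpM2r.
by rewrite mulrC -ler_pdivlMr// ltW.
Qed.

(** The indices carry the discrete topology; this lets [maximum_principle] run over the finite set
    of gaps. *)
Lemma continuous_uncurry_nat (Z : R -> nat -> R) : (forall k, continuous (Z ^~ k)) ->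
  continuous (fun p : R * nat => Z p.1 p.2).
Proof.
move=> cZ [t k]; apply/cvgrPdist_le => e e0 /=.
have /cvgrPdist_le /(_ e e0) H : Z s k @[s --> t] --> Z t k by exact: cZ.
exists ([set s | `|Z t k - Z s k| <= e], [set k]) => /=.
  by split; [exact: H|exact: discrete_set1].
by move=> [s j] /= [h ->].
Qed.

(** A minimal gap cannot shrink. The velocities are known only while all gaps are positive; taking m
    / 2 as threshold in [maximum_principle] removes the circularity, since they are then needed only
    when the smallest gap is at least m / 2. *)
Lemma gap_lower_bound (N : nat) (y : R -> nat -> R) (m : R) : (0 < N)%N -> 0 < m ->
  let gap t k := ghost_extend N (y t) k.+1 - ghost_extend N (y t) k in
  (forall i, continuous (y ^~ i)) ->
  (forall t i, 0 < t -> (forall k, (k <= N)%N -> 0 < gap t k) -> (1 <= i <= N)%N ->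
    is_derive t (1 : R) (y ^~ i) ((gap t i ^+ 2 - gap t i.-1 ^+ 2) / 4)) ->
  (forall k, (k <= N)%N -> m <= gap 0 k) ->
  forall t k, 0 <= t -> (k <= N)%N -> m <= gap t k.
Proof.
move=> N0 m0 gap cy dy gap0 t k t0 kN.
have cgh j : continuous (fun s => ghost_extend N (y s) j).
  rewrite /ghost_extend; case: eqP => _; first by move=> s; apply: cvgN; exact: cy.
  case: eqP => _; last exact: cy.
  by move=> s; apply: cvgB; [exact: cvg_cst|exact: cy].
pose Z s j := m - gap s j.
have m20 : 0 < m / 2 by rewrite divr_gt0.
suff : Z t k <= 0 by rewrite subr_le0.
apply: (@maximum_principle R nat `I_N.+1 Z t (m / 2) m20) => //.
- exact/finite_compact/finite_II.
- apply: continuous_uncurry_nat => j s.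
  by apply: cvgB; [exact: cvg_cst|apply: cvgB; exact: cgh].
- by move=> j jN; rewrite subr_le0; exact: gap0.
- move=> s j /andP[s0 _] jN /andP[_ Zm] Zmax.
  have gap_min i : (i <= N)%N -> gap s j <= gap s i.
    by move=> iN; have := Zmax i iN; rewrite /Z; lra.
  have gap_pos i : (i <= N)%N -> 0 < gap s i.
    by move=> /gap_min; move: Zm; rewrite /Z; lra.
  have dgh := is_derive_ghost N0 (fun i => dy s i s0 gap_pos).
  set V := ghost_velocity _ _ in dgh.
  exists (- (V j.+1 - V j)).
    have D := is_deriveB (is_derive_cst m s (1 : R)) (is_deriveB (dgh j.+1 jN) (dgh j (ltnW jN))).
    by rewrite -[X in is_derive _ _ _ X]sub0r; exact: D.
  have sq i : (i <= N)%N -> gap s j ^+ 2 <= gap s i ^+ 2.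
    by move=> iN; rewrite ler_sqr ?nnegrE ?(ltW (gap_pos _ _))//; exact: gap_min.
  rewrite oppr_le0 subr_ge0 /V /ghost_velocity eqSS /= (@ltn_eqF j N.+1)//.
  have [j0|j0] := eqVneq j 0%N.
    rewrite j0; have := sq 1%N N0; rewrite j0.
    by case: ifP => [/eqP <-|_] /=; lra.
  have := sq j.-1 (leq_trans (leq_pred j) (jN : (j <= N)%N)).
  have [->|jN'] := eqVneq j N; first by rewrite /=; lra.
  have j1N : (j < N)%N by rewrite ltn_neqAle jN'.
  by have := sq j.+1 j1N; rewrite /=; lra.
- by rewrite t0 lexx.
Qed.

(* Only the entries 1, ..., N of x are constrained by the flow, and only for
   nonnegative times. *)
Definition clamp_flow (N : nat) (x : R -> nat -> R) (t : R) (i : nat) : R :=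
  if (1 <= i <= N)%N then x (clamp_time t) i else 0.

Section Flow.
Variables (N : nat) (x : R -> nat -> R).
Hypotheses (N0 : (0 < N)%N) (flowx : F_N2_gradient_flow N (fun=> 1) x).
Local Notation y := (clamp_flow N x).

Lemma clamp_flow_id t i : 0 <= t -> (1 <= i <= N)%N -> y t i = x t i.
Proof. by move=> t0 iN; rewrite /clamp_flow iN clamp_time_id. Qed.

Lemma ghost_clamp_flow t i : 0 <= t -> (i <= N.+1)%N ->
  ghost_extend N (y t) i = ghost_extend N (x t) i.
Proof.
move=> t0 iN; rewrite /ghost_extend; case: eqP => [_|/eqP i0]; first by rewrite clamp_flow_id.
case: eqP => [_|/eqP iN1]; first by rewrite clamp_flow_id// N0 leqnn.
by rewrite clamp_flow_id// lt0n i0 -ltnS ltn_neqAle iN1.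
Qed.

Lemma continuous_clamp_flow i : continuous (y ^~ i).
Proof.
rewrite /clamp_flow; case iN : (1 <= i <= N)%N => t; last exact: cvg_cst.
apply/cvgrPdist_le => e e0.
have [_ dx _] := flowx (clamp_time_ge0 t) iN.
have [d d0 dP] := derivable_in_continuous dx e0.
have /cvgrPdist_lt /(_ d d0) := @continuous_clamp_time R t.
apply: filterS => s; rewrite distrC => sd; rewrite distrC; apply: dP => //.
by rewrite /= in_itv/= andbT clamp_time_ge0.
Qed.

Lemma is_derive_clamp_flow t i : 0 < t ->
  let gap k := ghost_extend N (y t) k.+1 - ghost_extend N (y t) k in
  (forall k, (k <= N)%N -> 0 < gap k) -> (1 <= i <= N)%N ->
  is_derive t (1 : R) (y ^~ i) ((gap i ^+ 2 - gap i.-1 ^+ 2) / 4).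
Proof.
move=> t0 gap gap0 iN; have [i1 iN'] := andP iN.
have [_ dx dxE] := flowx (ltW t0) iN.
have ghS k : (k <= N)%N -> ghost_extend N (x t) k < ghost_extend N (x t) k.+1.
  by move=> kN; have := gap0 k kN; rewrite /gap !ghost_clamp_flow ?(ltW t0)// ?subr_gt0//; exact: ltnW.
have [_ dF] := F_N2_derive N0 iN ghS.
have dx' : is_derive t (1 : R) (fun s => x s i) (derive_in `[0, +oo[ (fun s => x s i) t).
  by apply: is_derive_derive_in => //; exact: nbhs_half_line.
move: dx'; rewrite dxE derive1E dF opprK => dx'.
have iN1 : (i <= N.+1)%N by exact: ltnW.
have iN2 : (i.-1 <= N.+1)%N by rewrite (leq_trans (leq_pred _)).
have -> : gap i ^+ 2 - gap i.-1 ^+ 2 =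
    (ghost_extend N (x t) i.+1 - ghost_extend N (x t) i) ^+ 2 -
    (ghost_extend N (x t) i - ghost_extend N (x t) i.-1) ^+ 2.
  by rewrite /gap prednK// !ghost_clamp_flow ?(ltW t0).
apply: (is_derive_near t0 _ dx') => s; rewrite ltr_norml => /andP[s0 _].
by rewrite clamp_flow_id//; lra.
Qed.

End Flow.

End PointDynamics.

(** * Relaxation to the uniform distribution and transport cost *)

Section Relaxation.
Context {R : realType}.
Variables (N : nat) (c : R) (x : R -> nat -> R).
Hypotheses (N0 : (0 < N)%N) (c0 : 0 < c).
Local Notation n := (N%:R : R).
Let theta (i : nat) : R := (i%:R - 2^-1) / n.
Let a (t : R) (i : nat) := n * (ghost_extend N (x t) i.+1 - ghost_extend N (x t) i).
Hypothesis cx : forall i, continuous (x ^~ i).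
Hypothesis dx : forall (t : R) i, 0 < t -> (1 <= i <= N)%N ->
  is_derive t (1 : R) (x ^~ i) (n / 4 * (a t i ^+ 2 - a t i.-1 ^+ 2)).
Hypothesis ac : forall (t : R) i, 0 <= t -> (i <= N)%N -> c <= a t i.

Let n0 : 0 < n. Proof. by rewrite ltr0n. Qed.

Let E (t : R) := n^-1 * \sum_(1 <= i < N.+1) (x t i - theta i) ^+ 2.

(** [coarse_energy] requires a lower bound for the sum of a gap, at least c, and of the stationary
    gap 1. *)
Let c1 := Num.min c 1.
Let c10 : 0 < c1. Proof. by rewrite lt_min c0 ltr01. Qed.

(* The equidistant points theta_i are stationary: all their gaps equal 1/N. *)
Lemma relaxation_sqr (T : R) : 0 <= T -> E T <= expR (- (c1 / 4) * T) * E 0.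
Proof.
move=> T0.
have cE : continuous E.
  move=> t; apply: cvgM; first exact: cvg_cst.
  apply: (continuous_sum_nat (F := fun t i => (x t i - theta i) ^+ 2)) => j _ s.
  have cj : {for s, continuous (fun r => x r j - theta j)}.
    by apply: cvgB; [exact: cx|exact: cvg_cst].
  exact: (cvgM cj cj).
pose dE (t : R) := 2 / n * \sum_(1 <= i < N.+1) (x t i - theta i) * (n / 4 * (a t i ^+ 2 - a t i.-1 ^+ 2)).
have dEE (t : R) : 0 < t < T -> is_derive t (1 : R) E (dE t).
  move=> /andP[t0 _].
  have D : is_derive t (1 : R) (fun t => \sum_(1 <= i < N.+1) (x t i - theta i) ^+ 2)
     (\sum_(1 <= i < N.+1) 2 * (x t i - theta i) * (n / 4 * (a t i ^+ 2 - a t i.-1 ^+ 2))).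
    apply: (is_derive_sum_nat (F := fun t i => (x t i - theta i) ^+ 2)) => i iN.
    apply: is_derive_sqr; rewrite -[X in is_derive _ _ _ X]subr0.
    by apply: is_deriveB (is_derive_cst (theta i) t (1 : R)); exact: dx.
  have -> : dE t = n^-1 *: (\sum_(1 <= i < N.+1) 2 * (x t i - theta i) * (n / 4 * (a t i ^+ 2 - a t i.-1 ^+ 2))).
    rewrite /dE /GRing.scale /= !mulr_sumr; apply: eq_bigr => i _; field.
    by rewrite gt_eqF.
  exact: is_deriveZ.
have dEle (t : R) : 0 < t < T -> dE t <= - (c1 / 4) * E t + 0.
  move=> /andP[/ltW t0 _]; pose e i := ghost_extend N (x t) i - theta i.
  have eE i : (1 <= i <= N)%N -> e i = x t i - theta i.
    by move=> /andP[i1 iN]; rewrite /e /ghost_extend gtn_eqF// ltn_eqF.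
  have e0 : e 0%N = - e 1%N.
    by rewrite (eE 1%N) ?N0// /e /ghost_extend /= /theta; field; rewrite gt_eqF.
  have eN : e N.+1 = - e N.
    rewrite (eE N) ?N0 ?leqnn// /e /ghost_extend /= eqxx /theta -natr1; field.
    by rewrite gt_eqF.
  have abE i : (i <= N)%N -> a t i - 1 = n * (e i.+1 - e i).
    by move=> _; rewrite /a /e /theta -natr1; field; rewrite gt_eqF.
  have abc i : (i <= N)%N -> 2 * c1 <= a t i + 1.
    move=> iN; have := ac t0 iN.
    have : c1 <= c by rewrite ge_min lexx.
    have : c1 <= 1 by rewrite ge_min lexx orbT.
    by lra.
  (* The stationary gaps b = 1 have constant flux 1 / 4, zero speed and no defect. *)
  have := @coarse_energy R N c1 e (a t) (fun=> 1) (fun=> 0) (fun=> 0) (fun=> 4^-1) (fun=> 0)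
    N0 c10 e0 eN abE abc.
  have gE i : (1 <= i <= N)%N -> 0 = 0 + n * (4^-1 - 4^-1) :> R by rewrite subrr mulr0 addr0.
  have fE i : (i <= N)%N -> 4^-1 = 1 ^+ 2 / 4 + 0 :> R by rewrite expr1n addr0 mul1r.
  move=> /(_ gE fE).
  have z (m : nat) : \sum_(m <= i < N.+1) 0 ^+ 2 = 0 :> R by rewrite big1// => i _; rewrite expr0n.
  rewrite !z !mulr0 !addr0.
  have -> : \sum_(1 <= i < N.+1) e i ^+ 2 = \sum_(1 <= i < N.+1) (x t i - theta i) ^+ 2.
    by apply: eq_big_nat => i iN; rewrite eE.
  have -> : 2 / n * (\sum_(1 <= i < N.+1) e i * (n / 4 * (a t i ^+ 2 - a t i.-1 ^+ 2) - 0)) = dE t.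
    by congr (_ * _); apply: eq_big_nat => i iN; rewrite eE// subr0.
  by rewrite /E mulrCA.
have ne : c1 / 4 != 0 by rewrite gt_eqF// divr_gt0.
have := gronwall T0 ne cE dEE dEle.
by rewrite mul0r mul0r addr0.
Qed.

(** Passing from squares to absolute values by Cauchy-Schwarz halves the rate; the initial value is
    at most 1 because all points lie in [0, 1]. *)
Lemma relaxation_abs (T : R) : 0 <= T ->
  (forall i, (1 <= i <= N)%N -> 0 <= x 0 i <= 1) ->
  n^-1 * \sum_(1 <= i < N.+1) `|x T i - theta i| <= expR (- (c1 / 8) * T).
Proof.
move=> T0 x01.
have E0 : E 0 <= 1.
  rewrite /E ler_pdivrMl// mulr1.
  have -> : n = \sum_(1 <= i < N.+1) 1 :> R by rewrite sumr_const_nat subn1.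
  apply: ler_sum_nat => i iN; have /andP[h1 h2] := x01 i iN.
  have /andP[i1 iN'] := iN.
  have t0 : 0 <= theta i.
    rewrite divr_ge0 ?(ltW n0)// subr_ge0 (@le_trans _ _ 1) ?ler1n// invf_le1 ?ler1n//.
  have t1 : theta i <= 1.
    rewrite ler_pdivrMr// mul1r lerBlDr ler_wpDr//.
    by rewrite ler_nat.
  by rewrite -real_normK ?num_real// expr_le1// ler_norml; lra.
have H := relaxation_sqr T0.
set S := n^-1 * _.
have S0 : 0 <= S by rewrite mulr_ge0 ?invr_ge0 ?(ltW n0)// sumr_ge0.
have SE : S ^+ 2 <= E T.
  rewrite exprMn /E [n^-1 ^+ 2]expr2 -mulrA ler_pM2l ?invr_gt0// ler_pdivrMl//.
  have := @sum_sqr_le R 1 N.+1 (fun i => `|x T i - theta i|).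
  rewrite subn1 /= => h; apply: (le_trans h); rewrite ler_pM2l//.
  by apply: ler_sum => i _; rewrite real_normK ?num_real.
rewrite -ler_sqr ?nnegrE ?expR_ge0//; apply: (le_trans SE); apply: (le_trans H).
have -> : expR (- (c1 / 8) * T) ^+ 2 = expR (- (c1 / 4) * T).
  by rewrite expr2 -expRD; congr expR; field.
by rewrite ler_piMr// expR_ge0.
Qed.

End Relaxation.

(** * Transport cost to the uniform measure *)

Section Coupling.
Context {R : realType}.
Local Notation mu := (@lebesgue_measure R).

Lemma integral_mrestr d (T : measurableType d) (m : {measure set T -> \bar R}) (D : set T)
    (mD : measurable D) (f : T -> \bar R) : (forall x, 0 <= f x)%E -> measurable_fun setT f ->
  (\int[mrestr m mD]_x f x = \int[m]_(x in D) f x)%E.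
Proof.
move=> f0 mf; rewrite -(setvU D) ge0_integral_setU//=.
- rewrite [X in (X + _)%E](eq_measure_integral mzero); last first.
    by move=> A mA AD; rewrite /= /mrestr (_ : A `&` D = set0) ?measure0// -subset0 => y [/AD].
  rewrite integral_measure_zero add0e; apply: eq_measure_integral => A mA AD.
  by rewrite /= /mrestr; congr (m _); apply/setIidPl.
- exact: measurableC.
- by rewrite setvU.
- by apply/disj_set2P; rewrite setICl.
Qed.

Section Cells.
Variables (N : nat) (x : nat -> R).
Hypothesis N0 : (0 < N)%N.
Local Notation n := (N%:R : R).

Let cell (i : nat) : set (measurableTypeR R) := `[i%:R / n, i.+1%:R / n]%classic.

Let mcell i : measurable (cell i). Proof. exact: measurable_itv. Qed.

Let graph (i : nat) (y : measurableTypeR R) : (measurableTypeR R * measurableTypeR R)%type :=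
  (x i.+1, y).

Let mgraph i : measurable_fun setT (graph i).
Proof. by apply: measurable_fun_pair => //; exact: measurable_cst. Qed.

(** The mass at [x i.+1] is matched with Lebesgue measure on the cell from i / n to (i + 1) / n. The
    sum of these pieces is an explicit coupling, which bounds the infimum from above. *)
Let piece i : {measure set (measurableTypeR R * measurableTypeR R)%type -> \bar R} :=
  measure_function_pushforward__canonical__measure_function_Measure
    (mrestr mu (mcell i)) (mgraph i).

Let n0 : 0 < n. Proof. by rewrite ltr0n. Qed.

Let cell_le i : i%:R / n <= i.+1%:R / n.
Proof. by rewrite ler_pM2r ?invr_gt0// ler_nat. Qed.

Let integral_cells (h : measurableTypeR R -> \bar R) : measurable_fun setT h ->
  (forall y, 0 <= h y)%E ->
  (\int[mu]_(y in `[0%R, 1%R]) h y = \sum_(i < N) \int[mu]_(y in cell i) h y)%E.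
Proof.
move=> mh h0.
have -> : (\int[mu]_(y in `[0%R, 1%R]) h y = \int[mu]_(y in `[0%R, (N%:R / n)%R]) h y)%E.
  by rewrite divff// gt_eqF.
have H k : (\int[mu]_(y in `[0%R, (k%:R / n)%R]) h y = \sum_(i < k) \int[mu]_(y in cell i) h y)%E.
  elim: k => [|k IH]; first by rewrite big_ord0 mul0r set_itv1 integral_set1.
  rewrite big_ord_recr/= -IH (@integral_itv_split _ h 0 (k%:R / n))//.
exact: H.
Qed.

Let mu_cell i : mu (cell i) = (n^-1)%:E.
Proof.
rewrite lebesgue_measure_itv /= lte_fin.
by rewrite ltr_pM2r ?invr_gt0// ltr_nat ltnSn -EFinB -mulrBl -natrB// subSnn mul1r.
Qed.

Let coupling_setT : msum piece N setT = 1%E.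
Proof.
rewrite /msum; under eq_bigr do rewrite /= /pushforward /mrestr preimage_setT setTI mu_cell.
by rewrite sumEFin sumr_const card_ord -[_ *+ N]mulr_natr mulVf// gt_eqF.
Qed.

Let total : {measure set (measurableTypeR R * measurableTypeR R)%type -> \bar R} :=
  msum piece N.

Let coupling : probability (measurableTypeR R * measurableTypeR R)%type R :=
  HB.pack_for (probability (measurableTypeR R * measurableTypeR R)%type R) (Measure.sort total)
    (Measure_isProbability.Build _ _ _ (Measure.sort total) coupling_setT).

Let coupling_marginals : couplings (empirical_measure N x) lebesgue01 coupling.
Proof.
move=> A mA; split; rewrite /= /msum /=.
  rewrite /empirical_measure /mscale /= /msum /=.
  rewrite ge0_sume_distrr; last by move=> i _; exact: measure_ge0.
  apply: eq_bigr => i _; rewrite /pushforward /mrestr /dirac indicE.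
  have [xA|xA] := boolP (x i.+1 \in A).
    rewrite mule1 -(mu_cell i); congr (mu _); apply/setIidPr => y _ /=.
    by split => //; rewrite -in_setE.
  rewrite mule0 (_ : _ `&` _ = set0) ?measure0// -subset0 => y [[/= H _] _].
  by move: xA; rewrite notin_setE.
rewrite /lebesgue01 /mrestr -integral_indic//.
rewrite integral_cells//.
  apply: eq_bigr => i _; rewrite integral_indic//.
  by rewrite /pushforward /mrestr /graph; congr (mu (_ `&` _)); apply/seteqP; split => y //= [].
- by apply/measurable_EFinP; exact: measurable_indic.
Qed.

Lemma MK1_le_cells : (MK1 (empirical_measure N x) lebesgue01 <=
  \sum_(i < N) \int[mu]_(y in `[(i%:R / n)%R, (i.+1%:R / n)%R]) `|x i.+1 - y|%:E)%E.
Proof.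
have cost : measurable_fun setT
    (fun z : (measurableTypeR R * measurableTypeR R)%type => `|(z.1 : R) - z.2|%:E).
  apply/measurable_EFinP; apply: measurableT_comp => //.
  by apply: measurable_funB; [exact: measurable_fst|exact: measurable_snd].
apply: (@le_trans _ _ (\int[coupling]_z `|(z.1 : R) - z.2|%:E)%E).
  by apply: ereal_inf_lbound; exists coupling => //; exact: coupling_marginals.
rewrite [leLHS](_ : _ = \int[msum piece N]_z `|(z.1 : R) - z.2|%:E)%E//.
rewrite ge0_integral_measure_sum//.
apply: lee_sum => i _.
rewrite ge0_integral_pushforward// preimage_setT integral_mrestr ?lexx//.
- by move=> y; rewrite lee_fin.
- exact: (measurableT_comp cost (mgraph i)).
Qed.

End Cells.

Lemma integral_affine (c s m p q : R) : p <= q ->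
  (\int[mu]_(y in `[p, q]) (c + s * (y - m))%:E =
   (c * (q - p) + s * ((q - m) ^+ 2 - (p - m) ^+ 2) / 2)%:E)%E.
Proof.
rewrite le_eqVlt => /predU1P[<-|pq].
  by rewrite set_itv1 integral_set1 !subrr !mulr0 mul0r addr0.
pose F (y : R) := c * (y - m) + s / 2 * (y - m) ^+ 2.
have dF (y : R) : is_derive y (1 : R) F (c + s * (y - m)).
  have d1 : is_derive y (1 : R) (fun y => y - m) 1.
    by rewrite -[X in is_derive _ _ _ X]subr0; exact: is_deriveB (is_derive_id y 1) (is_derive_cst m y (1 : R)).
  have H := is_deriveD (@is_deriveZ _ _ _ _ c _ _ _ d1) (@is_deriveZ _ _ _ _ (s / 2) _ _ _ (is_deriveM d1 d1)).
  have -> : c + s * (y - m) = c *: 1 + (s / 2) *: ((y - m) *: 1 + (y - m) *: 1).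
    by rewrite /GRing.scale /=; field.
  exact: H.
have cf : continuous (fun y : R => c + s * (y - m)).
  move=> y; apply: cvgD; first exact: cvg_cst.
  by apply: cvgM; [exact: cvg_cst|apply: cvgB; [exact: cvg_id|exact: cvg_cst]].
have cF : continuous F by move=> y; exact: is_derive_continuous (dF y).
rewrite (continuous_FTC2 pq (F := F)).
- by rewrite -EFinB /F; congr (_%:E); field.
- exact: continuous_subspaceT.
- split; first by move=> y _; exact: ex_derive.
    by apply: cvg_at_right_filter; exact: cF.
  by apply: cvg_at_left_filter; exact: cF.
- by move=> y _; rewrite derive1E; exact: derive_val.
Qed.

(** Triangle inequality through the midpoint: the mean distance of the cell to its midpoint is a
    quarter of its length, which is the origin of 1 / (4 N). *)
Lemma integral_abs_cell (a p q : R) : p <= q ->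
  (\int[mu]_(y in `[p, q]) `|a - y|%:E <=
   ((q - p) * `|a - (p + q) / 2| + (q - p) ^+ 2 / 4)%:E)%E.
Proof.
move=> pq; pose m := (p + q) / 2; set D := `|a - m|.
have pm : p <= m by rewrite /m; lra.
have mq : m <= q by rewrite /m; lra.
have mabs : measurable_fun setT (fun y : measurableTypeR R => `|a - (y : R)|%:E).
  apply/measurable_EFinP; apply: continuous_measurable_fun => y.
  by apply: cvg_norm; apply: cvgB; (exact: cvg_cst || exact: cvg_id).
have maff (s : R) : measurable_fun setT (fun y : measurableTypeR R => (D + s * ((y : R) - m))%:E).
  apply/measurable_EFinP; apply: continuous_measurable_fun => y.
  apply: cvgD; first exact: cvg_cst.
  by apply: cvgM; [exact: cvg_cst|apply: cvgB; [exact: cvg_id|exact: cvg_cst]].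
have half (s p' q' : R) : p' <= q' -> (forall y, p' <= y <= q' -> `|m - y| = s * (y - m)) ->
    (\int[mu]_(y in `[p', q']) `|a - y|%:E <=
     (D * (q' - p') + s * ((q' - m) ^+ 2 - (p' - m) ^+ 2) / 2)%:E)%E.
  move=> pq' H; rewrite -integral_affine//; apply: ge0_le_integral => //.
  - exact: measurable_funTS.
  - exact: measurable_funTS.
  - move=> y; rewrite /= in_itv/= => /H E; rewrite lee_fin -E.
    by rewrite -[a - y](subrKA m) ler_normD.
rewrite (@integral_itv_split _ (fun y : measurableTypeR R => `|a - (y : R)|%:E) p m q)//.
apply: (le_trans (leeD (half (-1) p m pm _) (half 1 m q mq _))).
- by move=> y /andP[_ ym]; rewrite ger0_norm ?subr_ge0//; ring.
- by move=> y /andP[my _]; rewrite distrC ger0_norm ?subr_ge0//; ring.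
rewrite -EFinD lee_fin le_eqVlt; apply/orP; left; apply/eqP.
by rewrite /m; field.
Qed.

Lemma MK1_le (N : nat) (x : nat -> R) : (0 < N)%N ->
  (MK1 (empirical_measure N x) lebesgue01 <=
   (1 / (4 * N%:R) + N%:R^-1 * \sum_(1 <= i < N.+1) `|x i - (i%:R - 2^-1) / N%:R|)%:E)%E.
Proof.
move=> N0; have n0 : 0 < (N%:R : R) by rewrite ltr0n.
apply: (le_trans (MK1_le_cells x N0)).
have cell_le i : i%:R / N%:R <= i.+1%:R / N%:R :> R by rewrite ler_pM2r ?invr_gt0// ler_nat.
pose B (i : 'I_N) := (i.+1%:R / N%:R - i%:R / N%:R) *
  `|x i.+1 - (i%:R / N%:R + i.+1%:R / N%:R) / 2| + (i.+1%:R / N%:R - i%:R / N%:R) ^+ 2 / 4 : R.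
apply: (@le_trans _ _ (\sum_(i < N) (B i)%:E)%E).
  by apply: lee_sum => i _; exact: integral_abs_cell.
rewrite sumEFin lee_fin le_eqVlt; apply/orP; left; apply/eqP.
rewrite big_add1 /= big_mkord mulr_sumr.
have -> : 1 / (4 * N%:R) = \sum_(i < N) (4 * N%:R ^+ 2)^-1 :> R.
  by rewrite sumr_const card_ord -[_ *+ N]mulr_natr; field; rewrite gt_eqF.
rewrite -big_split; apply: eq_bigr => i _ /=; rewrite /B.
have E : i.+1%:R = i%:R + 1 :> R by rewrite -natr1.
have -> : i.+1%:R / N%:R - i%:R / N%:R = N%:R^-1 :> R by rewrite E; field; rewrite gt_eqF.
have -> : (i%:R / N%:R + i.+1%:R / N%:R) / 2 = (i.+1%:R - 2^-1) / N%:R :> R by rewrite E; field; rewrite gt_eqF.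
by field; rewrite gt_eqF.
Qed.

End Coupling.

Section RescaledFlow.
Context {R : realType}.
Variables (N : nat) (x : R -> nat -> R) (c : R).
Hypotheses (N0 : (0 < N)%N) (c0 : 0 < c) (flowx : F_N2_gradient_flow N (fun=> 1) x).
Local Notation n := (N%:R : R).
Hypothesis gap0 : forall k, (k <= N)%N ->
  c / n <= ghost_extend N (x 0) k.+1 - ghost_extend N (x 0) k.

(** In terms of a = N gap, one has N^3 gap^2 / 4 = N a^2 / 4, so the time scale N^3 produces the
    finite volume scheme. *)
Definition rescaled_flow (t : R) : nat -> R := clamp_flow N x (n ^+ 3 * t).
Local Notation y := rescaled_flow.
Let a (t : R) (i : nat) := n * (ghost_extend N (y t) i.+1 - ghost_extend N (y t) i).

Let n0 : 0 < n. Proof. by rewrite ltr0n. Qed.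

Let gap_ge (t : R) k : 0 <= t -> (k <= N)%N ->
  c / n <= ghost_extend N (clamp_flow N x t) k.+1 - ghost_extend N (clamp_flow N x t) k.
Proof.
apply: gap_lower_bound => //.
- by rewrite divr_gt0.
- exact: continuous_clamp_flow.
- by move=> s i s0 gap_pos iN; exact: is_derive_clamp_flow.
- by move=> j jN; rewrite !ghost_clamp_flow// ?gap0// ltnW.
Qed.

Lemma rescaled_flow_id (t : R) i : 0 <= t -> (1 <= i <= N)%N -> y t i = x (n ^+ 3 * t) i.
Proof. by move=> t0 iN; rewrite /y clamp_flow_id// mulr_ge0// exprn_ge0// ltW. Qed.

Lemma continuous_rescaled_flow i : continuous (y ^~ i).
Proof.
move=> t; apply: (@cvg_comp _ _ _ (fun t => n ^+ 3 * t) (clamp_flow N x ^~ i) _ (nbhs (n ^+ 3 * t))).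
  by apply: cvgM; [exact: cvg_cst|exact: cvg_id].
exact: continuous_clamp_flow.
Qed.

Lemma rescaled_gap_ge (t : R) i : 0 <= t -> (i <= N)%N -> c <= a t i.
Proof.
move=> t0 iN; rewrite /a -ler_pdivrMl// mulrC; apply: gap_ge => //.
by rewrite mulr_ge0// exprn_ge0// ltW.
Qed.

Lemma is_derive_rescaled_flow (t : R) i : 0 < t -> (1 <= i <= N)%N ->
  is_derive t (1 : R) (y ^~ i) (n / 4 * (a t i ^+ 2 - a t i.-1 ^+ 2)).
Proof.
move=> t0 iN; have t30 : 0 < n ^+ 3 * t by rewrite mulr_gt0 ?exprn_gt0.
have gap_pos k : (k <= N)%N -> 0 < ghost_extend N (y t) k.+1 - ghost_extend N (y t) k.
  by move=> kN; apply: lt_le_trans (gap_ge (ltW t30) kN); rewrite divr_gt0.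
have H := @is_derive1_comp R (clamp_flow N x ^~ i) (fun t => n ^+ 3 * t) t _ _
  (is_derive_clamp_flow N0 flowx t30 gap_pos iN) (is_derive_scale (n ^+ 3) t).
have -> : n / 4 * (a t i ^+ 2 - a t i.-1 ^+ 2) =
  ((ghost_extend N (y t) i.+1 - ghost_extend N (y t) i) ^+ 2 -
   (ghost_extend N (y t) i.-1.+1 - ghost_extend N (y t) i.-1) ^+ 2) / 4 * n ^+ 3.
  by rewrite /a; field.
exact: H.
Qed.

End RescaledFlow.

Lemma ordered_points_itv (R : realType) (N : nat) (z : nat -> R) :
  0 <= z 1%N -> (forall i, (1 <= i < N)%N -> z i <= z i.+1) -> z N <= 1 ->
  forall i, (1 <= i <= N)%N -> 0 <= z i <= 1.
Proof.
move=> z1 zS zN i /andP[i1 iN].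
have mono p q : (1 <= p)%N -> (p + q <= N)%N -> z p <= z (p + q)%N.
  move=> p1; elim: q => [_|q IH pqN]; first by rewrite addn0.
  rewrite addnS in pqN *; apply: (le_trans (IH (ltnW pqN))); apply: zS.
  by rewrite pqN (leq_trans p1)// leq_addr.
apply/andP; split.
  by apply: (le_trans z1); have := mono 1%N i.-1; rewrite add1n prednK//; apply.
by apply: le_trans zN; have := mono i (N - i)%N; rewrite subnKC//; apply.
Qed.

(** At the threshold time the exponent equals - 2 ln N. *)
Lemma expR_ln_bound (R : realType) (c t : R) (N : nat) : (0 < N)%N -> 0 < c ->
  2 * N%:R ^+ 3 * ln N%:R / c <= t -> 0 <= t /\ expR (- c * t / N%:R ^+ 3) <= N%:R ^- 2.
Proof.
move=> N0 c0 h; have n0 : 0 < (N%:R : R) by rewrite ltr0n.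
have n30 : 0 < (N%:R : R) ^+ 3 by rewrite exprn_gt0.
have ln0 : 0 <= ln (N%:R : R) by apply: ln_ge0; rewrite ler1n.
split; first by apply: le_trans h; rewrite divr_ge0 ?(ltW c0)// !mulr_ge0// ltW.
have -> : (N%:R : R) ^- 2 = expR (- (2 * ln N%:R)).
  by rewrite expRN mulr_natl mulr2n expRD lnK ?posrE// -expr2.
rewrite ler_expR !mulNr lerN2 ler_pdivlMr//.
by move: h; rewrite ler_pdivrMr//; lra.
Qed.

Theorem theorem1p1 (R : realType) (c0 C0 K : R) (c0_gt0 : 0 < c0) (C0_gt0 : 0 < C0) :
  exists c' C' : R, [/\ 0 < c', 0 < C' &
  forall (N : nat) (x : R -> nat -> R)
         (alpha : R) (X0 : R -> R) (X : R -> R -> R),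
  (1 <= N)%N ->
  F_N2_gradient_flow N (fun=> 1) x ->
  0 <= x 0 1%N ->
  (forall i, (1 <= i < N)%N -> x 0 i <= x 0 i.+1) ->
  x 0 N <= 1 ->
  F_gradient_flow X0 X ->
  0 < alpha < 1 ->
  in_holder `[0, 1] 4 alpha X0 ->
  holder_norm `[0, 1] 4 alpha X0 = K%:E ->
  let Xi (t : R) (i : nat) := X t ((i%:R - 2^-1) / N%:R) in
  let xbar (t : R) := x (N%:R ^+ 3 * t) in
  (forall i, (1 <= i <= N.+1)%N ->
     c0 / N%:R <= ghost_extend N (xbar 0) i - ghost_extend N (xbar 0) i.-1
               <= C0 / N%:R) ->
  (forall th : R, 0 <= th <= 1 -> c0 <= derive_in `[0, 1] X0 th <= C0) ->
  [/\ forall t : R, 0 <= t ->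
        N%:R^-1 * (\sum_(1 <= i < N.+1) (xbar t i - Xi t i) ^+ 2)
        <= expR (- c' * t)
             * (N%:R^-1 * \sum_(1 <= i < N.+1) (xbar 0 i - Xi 0 i) ^+ 2)
           + C' / N%:R ^+ 4,
      forall t : R, 0 <= t ->
        (MK1 (empirical_measure N (x t)) lebesgue01
         <= (1 / (4 * N%:R) + C' * expR (- c' * t / N%:R ^+ 3)
             + C' / N%:R ^+ 2)%:E)%E
    & forall t : R, 2 * N%:R ^+ 3 * ln N%:R / c' <= t ->
        (MK1 (empirical_measure N (x t)) lebesgue01
         <= (1 / (4 * N%:R) + 2 * C' / N%:R ^+ 2)%:E)%E]].
Proof.
(* The sign of K is not assumed; the absolute values keep G and l nonnegative, so all constants can
   be fixed before N and the data. *)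
pose G := C0 * `|K|; pose l := K ^+ 2 + C0 * `|K|.
have G0 : 0 <= G by rewrite mulr_ge0// ltW.
have l0 : 0 <= l by rewrite addr_ge0// sqr_ge0.
pose d := decay c0 G; pose m := Num.min c0 1 / 8.
have d0 : 0 < d by exact: decay_gt0.
have m0 : 0 < m by rewrite divr_gt0// lt_min c0_gt0 ltr01.
(* d is the rate of the comparison of the flows, m that of the relaxation to equal spacing. C'
   dominates [Kerr] and is at least 1, as it also multiplies the exponential in the transport
   bound. *)
pose c' := Num.min d m; pose C' := `|Kerr c0 C0 G l| + 1.
have c'0 : 0 < c' by rewrite lt_min d0.
have C'1 : 1 <= C' by rewrite lerDr.
have C'0 : 0 < C' by apply: lt_le_trans C'1.
exists c', C'; split => // N x alpha X0 X N0 flowx x01 xS xN flowX _ X0holder X0norm Xi xbar gaps X0slope.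
have n0 : 0 < (N%:R : R) by rewrite ltr0n.
have gap0 k : (k <= N)%N -> c0 / N%:R <= ghost_extend N (x 0) k.+1 - ghost_extend N (x 0) k.
  by move=> kN; have := gaps k.+1 kN; rewrite /xbar mulr0 => /andP[].
pose y := rescaled_flow N x.
have cy := continuous_rescaled_flow flowx.
have dy := is_derive_rescaled_flow N0 c0_gt0 flowx gap0.
have ygap := rescaled_gap_ge N0 c0_gt0 flowx gap0.
have yE t i : 0 <= t -> (1 <= i <= N)%N -> y t i = xbar t i by exact: rescaled_flow_id.
have first : forall t : R, 0 <= t ->
    N%:R^-1 * (\sum_(1 <= i < N.+1) (xbar t i - Xi t i) ^+ 2)
    <= expR (- c' * t) * (N%:R^-1 * \sum_(1 <= i < N.+1) (xbar 0 i - Xi 0 i) ^+ 2)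
       + C' / N%:R ^+ 4.
  move=> t t0.
  have [X' [u [g [flowX' X'E uE gE]]]] := gradient_flow_classical flowX.
  have cg : continuous (g 0) := @flow_cgy _ _ _ _ flowX' 0.
  have slope0 (z : R) : 0 < z < 1 -> c0 <= u 0 z <= C0.
    by move=> /andP[/ltW z0 /ltW z1]; rewrite uE ?z0//; apply: X0slope; rewrite z0.
  have gG (z : R) : 0 < z < 1 -> `|g 0 z| <= G.
    exact: (initial_speed_bound C0_gt0 c0_gt0 X0holder X0norm X0slope gE).
  have glip (z w : R) : 0 <= z <= 1 -> 0 <= w <= 1 -> `|g 0 z - g 0 w| <= l * `|z - w|.
    exact: (initial_speed_lip C0_gt0 c0_gt0 X0holder X0norm X0slope cg gE).
  have sumE s : 0 <= s -> \sum_(1 <= i < N.+1) (xbar s i - Xi s i) ^+ 2 =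
      \sum_(1 <= i < N.+1) (y s i - X' s ((i%:R - 2^-1) / N%:R)) ^+ 2.
    move=> s0; apply: eq_big_nat => i iN; rewrite yE// X'E//.
    have /andP[i1 iN'] := iN; apply/andP; split.
      by rewrite divr_ge0 ?(ltW n0)// subr_ge0 (@le_trans _ _ 1) ?ler1n// invf_le1 ?ler1n.
    by rewrite ler_pdivrMr// mul1r lerBlDr ler_wpDr// ler_nat.
  rewrite !sumE//.
  have := flow_comparison flowX' c0_gt0 C0_gt0 G0 slope0 gG l0 glip N0 cy dy ygap t0.
  move=> /le_trans; apply; apply: lerD.
    apply: ler_wpM2r; first by rewrite mulr_ge0 ?invr_ge0 ?(ltW n0)// sumr_ge0// => i _; rewrite sqr_ge0.
    by rewrite ler_expR !mulNr lerN2 ler_wpM2r// ge_min lexx.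
  rewrite ler_wpM2r// ?invr_ge0 ?exprn_ge0 ?(ltW n0)// (le_trans (ler_norm _))//.
  by rewrite lerDl.
have second : forall t : R, 0 <= t -> (MK1 (empirical_measure N (x t)) lebesgue01 <=
    (1 / (4 * N%:R) + C' * expR (- c' * t / N%:R ^+ 3) + C' / N%:R ^+ 2)%:E)%E.
  move=> t t0; apply: (le_trans (MK1_le (x t) N0)); rewrite lee_fin -addrA lerD2l.
  have s0 : 0 <= t / N%:R ^+ 3 by rewrite divr_ge0// exprn_ge0// ltW.
  have tE : N%:R ^+ 3 * (t / N%:R ^+ 3) = t by rewrite mulrCA divff ?mulr1// gt_eqF// exprn_gt0.
  have y01 i : (1 <= i <= N)%N -> 0 <= y 0 i <= 1.
    by move=> iN; rewrite yE// /xbar mulr0; exact: (ordered_points_itv x01 xS xN).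
  have := relaxation_abs N0 c0_gt0 cy dy ygap s0 y01.
  have -> : \sum_(1 <= i < N.+1) `|y (t / N%:R ^+ 3) i - (i%:R - 2^-1) / N%:R| =
      \sum_(1 <= i < N.+1) `|x t i - (i%:R - 2^-1) / N%:R|.
    by apply: eq_big_nat => i iN; rewrite yE// /xbar tE.
  move=> /le_trans; apply; rewrite -[leLHS]addr0; apply: lerD.
    apply: (@le_trans _ _ (expR (- c' * t / N%:R ^+ 3))).
      rewrite -mulrA ler_expR; apply: ler_wpM2r => //.
      by rewrite lerN2 ge_min lexx orbT.
    by rewrite ler_peMl// expR_ge0.
  by rewrite divr_ge0 ?exprn_ge0// ltW.
split=> // t /(expR_ln_bound N0 c'0)[t0 h].
apply: (le_trans (second t t0)); rewrite lee_fin -addrA lerD2l.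
have := ler_wpM2l (ltW C'0) h; lra.
Qed.
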